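(* Suppose that Assumption [A] holds with sequence $(a_n)$ and function $\psi_\alpha$, i.e. $(a_n)$ is a deterministic sequence of positive numbers with $a_n\to\infty$, $\psi_\alpha:\mathbb{R}\to\overline{\mathbb{R}}$ satisfies $\lim_{t\to\infty}\psi_\alpha(t)=\infty$ and $\lim_{t\to-\infty}\psi_\alpha(t)=-\infty$, and $$\lim_{n\to\infty}\sqrt n\,\bigl[F(q_\alpha+t/a_n)-F(q_\alpha)\bigr]=\psi_\alpha(t)\qquad\text{for all }t\in\mathbb{R}.$$ Suppose also that Assumption [B] holds: $\mathbb{E}[1_{Y\le 0}Y^2]<\infty$. Then, as $n\to\infty$, $$\bigl(a_n(\widehat q_{n,\alpha}-q_\alpha),\ \sqrt n\,(\widehat{es}_{n,\alpha}-es_\alpha)\bigr)\Rightarrow\bigl(\psi_\alpha^{\leftrightarrow}(W_1),\,W_2\bigr)$$ in distribution, where $(W_1,W_2)\sim\mathcal{N}(0,\Sigma)$ is jointly normal with $$\Sigma=\begin{pmatrix}\alpha(1-\alpha)&(1-\alpha)(q_\alpha-es_\alpha)\\(1-\alpha)(q_\alpha-es_\alpha)&\operatorname{Var}\bigl(1_{Y\le q_\alpha}(q_\alpha-Y)/\alpha\bigr)\end{pmatrix}$$ and $$\psi_\alpha^{\leftrightarrow}(x)=\begin{cases}\inf\{t\le 0:\psi_\alpha(t)\ge x\}&\text{if }x<0,\\0&\text{if }x=0,\\\sup\{t\ge 0:\psi_\alpha(t)\le x\}&\text{if }x>0.\end{cases}$$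
   Context: Fix $\alpha\in(0,1)$. $Y$ is a real random variable with distribution function $F$ and $\mathbb{E}|Y|<\infty$, and $X_1,X_2,\ldots$ are i.i.d. with distribution function $F$. Standing assumption: $F$ is continuous and strictly increasing at its $\alpha$-quantile $q_\alpha$ (so that $q_\alpha$ is unique). The lower tail expected shortfall is $es_\alpha=\frac1\alpha\int_0^\alpha F^{-1}(u)\,du=\frac1\alpha\int_{-\infty}^{q_\alpha}y\,dF(y)$. $\overline{\mathbb{R}}=\mathbb{R}\cup\{-\infty,\infty\}$. Scoring function: let $\mathcal{G}:\mathbb{R}\to\mathbb{R}$ be three times continuously differentiable with $\mathcal{G}'=G$, $G'>0$ and $\lim_{x\to-\infty}G(x)=0$, and set $$S(x_1,x_2;y)=(1_{y\le x_1}-\alpha)(x_1-y)+G(x_2)\bigl(x_2+\alpha^{-1}(1_{y\le x_1}-\alpha)(x_1-y)\bigr)-\mathcal{G}(x_2)-G(x_2)\,y .$$ The minimum contrast estimator is any $$(\widehat q_{n,\alpha},\widehat{es}_{n,\alpha})\in\operatorname*{arg\,min}_{(x_1,x_2)\in\mathbb{R}^2}\sum_{i=1}^n S(x_1,x_2;X_i).$$ *)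

(* Defs.v *)
From HB Require Import structures.
From mathcomp Require Import all_boot all_order all_algebra finmap.
From mathcomp Require Import all_classical all_reals all_analysis.

Set Implicit Arguments.
Unset Strict Implicit.
Unset Printing Implicit Defensive.

Import Order.TTheory GRing.Theory Num.Theory.
Import numFieldNormedType.Exports.

Local Open Scope classical_set_scope.
Local Open Scope ring_scope.

(* On [0 < u < 1] and for a distribution function F the set is nonempty and
   bounded below, so that [inf] is the usual generalized inverse F^{-1}(u). *)
Definition quantile (R : realType) (F : R -> R) (u : R) : R :=
  inf [set x | u <= F x].

Definition strictly_increasing_at (R : realType) (F : R -> R) (x : R) : Prop :=
  (forall y, y < x -> F y < F x) /\ (forall y, x < y -> F x < F y).

Definition lower_expected_shortfall (R : realType) (F : R -> R) (alpha : R) : R :=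
  alpha^-1 * \int[lebesgue_measure]_(u in `]0, alpha[) quantile F u.

Definition continuously_differentiable (R : realType) (k : nat) (f : R -> R) :
    Prop :=
  (forall i : nat, (i < k)%N -> forall x, derivable (derive1n i f) x 1) /\
  continuous (derive1n k f).

(* [cG] is the antiderivative (calligraphic G) of [G]. *)
Definition score (R : realType) (alpha : R) (G cG : R -> R) (x1 x2 y : R) : R :=
  ((y <= x1)%R%:R - alpha) * (x1 - y)
  + G x2 * (x2 + alpha^-1 * (((y <= x1)%R%:R - alpha) * (x1 - y)))
  - cG x2 - G x2 * y.

Definition argmin (R : realType) (T : Type) (f : T -> R) : set T :=
  [set x | forall y, f x <= f y].

(* Since [psi] tends to +oo at +oo and to -oo at -oo with [psi 0 = 0], the two
   sets are nonempty and bounded, so [inf] and [sup] in R are the genuine ones. *)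
Definition psi_inv (R : realType) (psi : R -> \bar R) (x : R) : R :=
  if x < 0 then inf [set t | t <= 0 /\ (x%:E <= psi t)%E]
  else if 0 < x then sup [set t | 0 <= t /\ (psi t <= x%:E)%E]
  else 0.

Definition mutually_independent (R : realType) (d : measure_display)
    (T : measurableType d) (P : probability T R) (X : nat -> {RV P >-> R}) :
    Prop :=
  forall (J : {fset nat}) (B : nat -> set R),
    (forall j, measurable (B j)) ->
    P (\bigcap_(j in [set` J]) (X j @^-1` B j)) =
      (\prod_(j <- J) P (X j @^-1` B j))%E.

(* N(m, v) parametrized by the variance; for v = 0 it is the point mass at m
   ([normal_prob m 0] is not a point mass). *)
Definition normal_law (R : realType) (m v : R) : set R -> \bar R :=
  if v == 0 then \d_m else normal_prob m (Num.sqrt v).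

(* W ~ N(m, Sigma): every linear combination of the coordinates is univariate
   normal with the mean and variance prescribed by m and Sigma. *)
Definition jointly_normal (R : realType) (d : measure_display)
    (T : measurableType d) (P : probability T R) (k : nat)
    (W : 'I_k -> {RV P >-> R}) (m : 'rV[R]_k) (Sigma : 'M[R]_k) : Prop :=
  [/\ Sigma^T = Sigma,
      (forall t : 'rV[R]_k, 0 <= (t *m Sigma *m t^T) 0 0) &
      forall (t : 'rV[R]_k) (A : set R), measurable A ->
        P [set w | A (\sum_(i < k) t 0 i * W i w)] =
          normal_law ((m *m t^T) 0 0) ((t *m Sigma *m t^T) 0 0) A].

Definition mx22 (R : realType) (a b c d : R) : 'M[R]_2 :=
  \matrix_(i < 2, j < 2) nth 0 (nth [::] [:: [:: a; b]; [:: c; d]] i) j.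

Definition cvg_in_distribution (R : realType) (U : topologicalType)
    (d : measure_display) (T : measurableType d) (P : probability T R)
    (Z : nat -> T -> U)
    (d' : measure_display) (T' : measurableType d') (Q : probability T' R)
    (Z0 : T' -> U) : Prop :=
  forall f : U -> R, continuous f -> (exists M : R, forall u, `|f u| <= M) ->
    'E_P[f \o Z n]%E @[n --> \oo] --> 'E_Q[f \o Z0]%E.

(* Main.v *)
Require Import Defs.
From HB Require Import structures.
From mathcomp Require Import all_boot all_order all_algebra finmap.
From mathcomp Require Import all_classical all_reals all_analysis.
From mathcomp Require Import measurable_realfun ring lra.

(** Let [U n] and [V n] be the sums over the sample, divided by [sqrt n], of
    [alpha - 1_{x <= q}] and of [q - es - 1_{x <= q} (q - x) / alpha]. These
    functions are centred and square integrable with covariance matrix [Sigma],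
    so that [(U n, V n)] converges in law to [(W 0, W 1)]. The estimator is a
    function of such sums, up to errors that vanish in the limit.

    The quantile. For fixed [x2] the score summed over the sample is an increasing
    affine function of the check loss at [x1], so [qhat n] is an empirical
    quantile: it is at most [t] if more than [alpha n] observations are, and larger
    than [t] if fewer are ([argmin_quantile_le], [argmin_quantile_gt]). Hence the
    event [a n (qhat n - q) <= t] is decided by the sign of [r n - U n], where
    [r n = sqrt n (F (q + t / a n) - F q)] tends to [psi t], up to an error whose
    mean square is at most [F (q + t / a n) - F q] in absolute value, and tends to
    [0] ([quantile_sign_criterion]).

    The shortfall. At [x1 = qhat n] the sum of the scores is a Bregman divergence of
    the strictly convex [cG], so [eshat n] is the value at [qhat n] of a concave
    functional that is maximal there ([argmin_shortfall]). Replacing [qhat n] by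
    [q] therefore costs a product of two deviations only, and
    [sqrt n (eshat n - es)] differs from [V n] by at most
    [`|a n (qhat n - q)| * `|U n| / (alpha a n)] ([shortfall_deviation]).

    The central limit theorem. Characteristic functions are handled as
    expectations of cosines. Independence turns the cosine and the sine of a sum
    into the components of a power [(c + i s) ^+ n], with [n (1 - c)] tending to
    half the variance and [n s] to [0]; and the cosine transform of a normal law
    solves a differential equation. Since second moments are bounded, a bounded
    continuous function can be approximated on a large interval by a polynomial in
    a sine, so the convergence extends to the expectations of [f (U n) * g (V n)]
    ([cvg_Ex_product]).

    The joint limit. As [W 0] has no atoms, the expectation of
    [1_{a n (qhat n - q) <= t} * g (V n)] tends to that of
    [1_{W 0 <= psi t} * g (W 1)] ([cvg_indicator]). For the finitely many points [t]
    of a grid, and up to a null event, [W 0 <= psi t] says that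
    [psi_inv psi (W 0) <= t]. Discretizing the first coordinate of a test function
    of two variables then gives the theorem ([cvg_joint]). *)

Set Implicit Arguments.
Unset Strict Implicit.
Unset Printing Implicit Defensive.

Import Order.TTheory GRing.Theory Num.Theory.
Import numFieldNormedType.Exports.

Local Open Scope classical_set_scope.
Local Open Scope ring_scope.

(** * Expectations *)

Notation Ex P f := (Rintegral P setT f).
Notation integrableR P f := (integrable P setT (EFin \o f)).

Lemma dominated_Rintegral d (T : measurableType d) (R : realType)
    (P : {measure set T -> \bar R}) (f_ : nat -> T -> R) (f g : T -> R) :
  (forall n, measurable_fun setT (f_ n)) -> measurable_fun setT f ->
  integrableR P g -> (forall n x, `|f_ n x| <= g x) ->
  (forall x, f_ n x @[n --> \oo] --> f x) ->
  Ex P (f_ n) @[n --> \oo] --> Ex P f.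
Proof.
move=> mf_ mf ig fg ff.
have [] := @dominated_convergence _ _ _ P setT measurableT (fun n => EFin \o f_ n) (EFin \o f) (EFin \o g).
- by move=> n; apply/measurable_EFinP.
- exact/measurable_EFinP.
- apply: aeW => x _ /=; apply: cvg_EFin; last exact: ff.
  by near=> n.
- exact: ig.
- by apply: aeW => x /= n _; rewrite lee_fin.
move=> If _ cv; apply: fine_cvg.
by rewrite fineK//; apply: integrable_fin_num.
Unshelve. all: by end_near. Qed.

Lemma measurable_trunc_fiber d (T : measurableType d) (R : realType) (h : T -> R) (l : nat) :
  measurable_fun setT h -> measurable [set w | Num.trunc (h w) = l].
Proof.
move=> mh; have mlt j : measurable_fun setT (fun w => (h w < j.+1%:R)%R).
  exact: measurable_fun_ltr.
rewrite (_ : [set w | _] = (fun w => ((Num.trunc (h w) <= l)%N && ~~ (Num.trunc (h w) < l)%N)) @^-1` [set true]).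
  rewrite -[X in measurable X]setTI.
  have : measurable_fun setT (fun w => ((Num.trunc (h w) <= l)%N && ~~ (Num.trunc (h w) < l)%N)).
    apply: measurable_and.
      by under eq_fun do rewrite truncn_le_nat; exact: mlt.
    apply: measurable_neg.
    case: l => [|l]; first by apply: (eq_measurable_fun (fun=> false)).
    by under eq_fun do rewrite ltnS truncn_le_nat; exact: mlt.
  by move=> m; exact: (m measurableT [set true]).
apply/seteqP; split => w /=; first by move=> ->; rewrite leqnn ltnn.
by rewrite -leqNgt -eqn_leq => /eqP.
Qed.

Section Expectation.
Context {d} {T : measurableType d} {R : realType} (P : probability T R).
Implicit Types f g : T -> R.

Definition bounded_rv f := measurable_fun setT f /\ exists M, forall x, `|f x| <= M.

Lemma bounded_rv_integrable f : bounded_rv f -> integrableR P f.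
Proof.
move=> [mf [M fM]]; apply: measurable_bounded_integrable => //.
  by apply: le_lt_trans (probability_le1 _ _) (ltry _).
exists M; split; rewrite ?num_real// => y yM x _; exact: le_trans (fM x) (ltW yM).
Qed.

Lemma bounded_rv_cst c : bounded_rv (fun=> c).
Proof. by split=> //; exists `|c|. Qed.

Lemma bounded_rvD f g : bounded_rv f -> bounded_rv g -> bounded_rv (fun x => f x + g x).
Proof.
move=> [mf [M fM]] [mg [N gN]]; split; first exact: measurable_funD.
by exists (M + N) => x; rewrite (le_trans (ler_normD _ _))// lerD.
Qed.

Lemma bounded_rvM f g : bounded_rv f -> bounded_rv g -> bounded_rv (fun x => f x * g x).
Proof.
move=> [mf [M fM]] [mg [N gN]]; split; first exact: measurable_funM.
by exists (M * N) => x; rewrite normrM ler_pM.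
Qed.

Lemma bounded_rvN f : bounded_rv f -> bounded_rv (fun x => - f x).
Proof.
move=> [mf [M fM]]; split; first exact: measurable_funN.
by exists M => x; rewrite normrN.
Qed.

Lemma bounded_rvB f g : bounded_rv f -> bounded_rv g -> bounded_rv (fun x => f x - g x).
Proof. by move=> bf bg; apply: bounded_rvD => //; exact: bounded_rvN. Qed.

Lemma bounded_rv_sum (I : Type) (r : seq I) (Q : pred I) (f : I -> T -> R) :
  (forall i, Q i -> bounded_rv (f i)) ->
  bounded_rv (fun x => \sum_(i <- r | Q i) f i x).
Proof.
move=> bf; elim: r => [|i r IH].
  rewrite (_ : (fun x => _) = fun=> 0); first exact: bounded_rv_cst.
  by apply/funext => x; rewrite big_nil.
rewrite (_ : (fun x => _) = fun x => if Q i then f i x + \sum_(j <- r | Q j) f j x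
    else \sum_(j <- r | Q j) f j x); last by apply/funext => x; rewrite big_cons.
by case: (boolP (Q i)) => // Qi; exact: bounded_rvD (bf _ Qi) IH.
Qed.

Lemma bounded_rv_prod (I : Type) (r : seq I) (Q : pred I) (f : I -> T -> R) :
  (forall i, Q i -> bounded_rv (f i)) ->
  bounded_rv (fun x => \prod_(i <- r | Q i) f i x).
Proof.
move=> bf; elim: r => [|i r IH].
  rewrite (_ : (fun x => _) = fun=> 1); first exact: bounded_rv_cst.
  by apply/funext => x; rewrite big_nil.
rewrite (_ : (fun x => _) = fun x => if Q i then f i x * \prod_(j <- r | Q j) f j x
    else \prod_(j <- r | Q j) f j x); last by apply/funext => x; rewrite big_cons.
by case: (boolP (Q i)) => // Qi; exact: bounded_rvM (bf _ Qi) IH.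
Qed.

Lemma bounded_rv_bool (b : T -> bool) : measurable_fun setT b ->
  bounded_rv (fun x => (b x)%:R).
Proof.
move=> mb; split; last by exists 1 => x; case: (b x); rewrite ?normr1 ?normr0.
by apply: (measurableT_comp (f := fun c : bool => c%:R : R)).
Qed.

Lemma bounded_rv_comp (g : R -> R) f : measurable_fun setT g ->
  (exists M, forall x, `|g x| <= M) -> measurable_fun setT f ->
  bounded_rv (fun x => g (f x)).
Proof.
by move=> mg [M gM] mf; split; [exact: measurableT_comp|exists M].
Qed.

Lemma bounded_rv_continuous (g : R -> R) (M : R) f : measurable_fun setT f ->
  continuous g -> (forall x, `|g x| <= M) -> bounded_rv (fun x => g (f x)).
Proof.
by move=> mf cg gM; apply: bounded_rv_comp mf; [exact: continuous_measurable_fun|exists M].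
Qed.

Lemma measurable_fun_le_ereal f (c : \bar R) : measurable_fun setT f ->
  measurable_fun setT (fun x => ((f x)%:E <= c)%E).
Proof.
move=> mf; case: c => [c||].
- by under eq_fun do rewrite lee_fin; exact: measurable_fun_ler.
- by apply: (eq_measurable_fun (fun=> true)) => // x _; rewrite leey.
- by apply: (eq_measurable_fun (fun=> false)).
Qed.

Lemma ler_dist_chain (x x' y y' e1 e2 e3 : R) : `|x - x'| <= e1 -> `|y - y'| <= e2 ->
  `|x' - y'| <= e3 -> `|x - y| <= e1 + e2 + e3.
Proof.
move=> h1 h2 h3; rewrite (_ : x - y = (x - x') - (y - y') + (x' - y')); last by ring.
by rewrite (le_trans (ler_normD _ _))// lerD// (le_trans (ler_normB _ _))// lerD.
Qed.

Lemma ExD f g : integrableR P f -> integrableR P g ->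
  Ex P (fun x => f x + g x) = Ex P f + Ex P g.
Proof. exact: RintegralD. Qed.

Lemma ExB f g : integrableR P f -> integrableR P g ->
  Ex P (fun x => f x - g x) = Ex P f - Ex P g.
Proof. exact: RintegralB. Qed.

Lemma ExZ c f : integrableR P f -> Ex P (fun x => c * f x) = c * Ex P f.
Proof. exact: RintegralZl. Qed.

Lemma Ex_cst c : Ex P (fun=> c) = c.
Proof.
have PT : (P : {measure set T -> \bar R}) setT = 1%E by exact: probability_setT.
by rewrite Rintegral_cst// PT mulr1.
Qed.

Lemma le_Ex f g : integrableR P f -> integrableR P g ->
  (forall x, f x <= g x) -> Ex P f <= Ex P g.
Proof. by move=> *; apply: le_Rintegral. Qed.

Lemma integrableRD f g : integrableR P f -> integrableR P g ->
  integrableR P (fun x => f x + g x).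
Proof. by move=> h k; have := integrableD measurableT h k; apply: eq_integrable. Qed.

Lemma integrableRZ c f : integrableR P f -> integrableR P (fun x => c * f x).
Proof. by move=> h; have := integrableZl measurableT c h; apply: eq_integrable. Qed.

Lemma integrableRB f g : integrableR P f -> integrableR P g ->
  integrableR P (fun x => f x - g x).
Proof. by move=> h k; have := integrableB measurableT h k; apply: eq_integrable. Qed.

Lemma integrableR_dom f g : measurable_fun setT f -> integrableR P g ->
  (forall x, `|f x| <= g x) -> integrableR P f.
Proof.
move=> mf ig fg; apply: (le_integrable _ _ _ ig) => //; first exact/measurable_EFinP.
by move=> x _ /=; rewrite lee_fin (le_trans (fg x))// ler_norm.
Qed.

Lemma integrableR_sum (I : Type) (r : seq I) (f : I -> T -> R) :
  (forall i, integrableR P (f i)) ->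
  integrableR P (fun x => \sum_(i <- r) f i x).
Proof.
move=> bf; elim: r => [|i r IH].
  rewrite (_ : (fun x => _) = fun=> 0); last by apply/funext => x; rewrite big_nil.
  exact/bounded_rv_integrable/bounded_rv_cst.
rewrite (_ : (fun x => _) = (fun x => f i x + \sum_(i <- r) f i x)).
  exact: integrableRD.
by apply/funext => x; rewrite big_cons.
Qed.

Lemma Ex_sum (I : Type) (r : seq I) (f : I -> T -> R) :
  (forall i, integrableR P (f i)) ->
  Ex P (fun x => \sum_(i <- r) f i x) = \sum_(i <- r) Ex P (f i).
Proof.
move=> bf; elim: r => [|i r IH].
  under eq_Rintegral do rewrite big_nil.
  by rewrite Ex_cst big_nil.
under eq_Rintegral do rewrite big_cons.
by rewrite ExD// ?IH ?big_cons//; exact: integrableR_sum.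
Qed.

Lemma normr_Ex f (M : R) : integrableR P f -> (forall x, `|f x| <= M) -> `|Ex P f| <= M.
Proof.
move=> mf fM; have iM c := bounded_rv_integrable (bounded_rv_cst c).
rewrite ler_norml; apply/andP; split.
  rewrite -(Ex_cst (- M)); apply: le_Ex => // x.
  by have := fM x; rewrite ler_norml => /andP[].
rewrite -[leRHS]Ex_cst; apply: le_Ex => // x.
by have := fM x; rewrite ler_norml => /andP[].
Qed.

Lemma normr_ExB f g h : integrableR P f -> integrableR P g -> integrableR P h ->
  (forall x, `|f x - g x| <= h x) -> `|Ex P f - Ex P g| <= Ex P h.
Proof.
move=> bf bg bh fgh; rewrite -ExB//.
apply: le_trans (le_normr_Rintegral _ _) _ => //; first exact: integrableRB.
apply: le_Ex => //.
have := integrable_norm (integrableRB bf bg).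
by apply: eq_integrable => //.
Qed.

Lemma Ex_bool (b : T -> bool) : measurable_fun setT b ->
  (Ex P (fun x => (b x)%:R))%:E = P [set x | b x].
Proof.
move=> mb.
have mB : measurable [set x | b x].
  by have := mb measurableT [set true] I; rewrite setTI.
rewrite -[X in P X]setIT -integral_indic// /Rintegral fineK; last first.
  by apply: integrable_fin_num => //; apply/bounded_rv_integrable/bounded_rv_bool.
by apply: eq_integral => x _; rewrite indicE mem_setE.
Qed.

End Expectation.

(** * Random variables with the same law *)

Section SameLaw.
Context {R : realType}.

(** Open right rays form a pi-system generating the Borel sets, and they are
    complements of closed left rays. *)
Lemma measure_eq_rays (mu nu : {measure set R -> \bar R}) :
  (mu setT < +oo)%E -> mu setT = nu setT ->
  (forall x : R, mu `]-oo, x]%classic = nu `]-oo, x]%classic) ->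
  forall A, measurable A -> mu A = nu A.
Proof.
move=> muoo munuT munu.
have munu' (x : R) : mu `]x, +oo[%classic = nu `]x, +oo[%classic.
  have mx : measurable (`]-oo, x]%classic : set R) by exact: measurable_itv.
  rewrite -setCitvl -!setTD.
  have nuoo : (nu setT < +oo)%E by rewrite -munuT.
  rewrite [LHS]measureD// [RHS]measureD// !setTI.
  by congr (_ - _)%E; [exact: munuT|exact: munu].
move=> A mA.
apply: (@measure_unique _ R _ (@RGenOInfty.G R) (fun n => `](- n%:R : R), +oo[%classic) _ _ _ _ mu nu) => //.
- exact: RGenOInfty.measurableE.
- move=> _ _ [x ->] [y ->]; exists (Num.max x y).
  apply/seteqP; split => z /=; rewrite !in_itv/= !andbT gt_max.
    by case=> -> ->.
  by move=> /andP[].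
- by move=> i; eexists.
- apply/seteqP; split => // x _; exists (Num.bound `|x|) => //=.
  rewrite in_itv/= andbT ltrNl; apply: le_lt_trans (archi_boundP (normr_ge0 x)).
  by rewrite -normrN ler_norm.
- by move=> _ [x ->]; exact: munu'.
- by move=> k; rewrite (le_lt_trans _ muoo)// le_measure ?inE.
Qed.

Definition same_law d d' (T : measurableType d) (T' : measurableType d')
    (P : probability T R) (P' : probability T' R)
    (X : {RV P >-> R}) (X' : {RV P' >-> R}) :=
  forall B : set R, measurable B -> P (X @^-1` B) = P' (X' @^-1` B).

Context d d' (T : measurableType d) (T' : measurableType d')
    (P : probability T R) (P' : probability T' R).

Lemma same_law_cdf (X : {RV P >-> R}) (X' : {RV P' >-> R}) :
  (forall x, cdf X x = cdf X' x) -> same_law X X'.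
Proof.
move=> XX' B mB; suff : distribution P X B = distribution P' X' B by [].
have XT : distribution P X setT = 1%E by exact: probability_setT.
have XT' : distribution P' X' setT = 1%E by exact: probability_setT.
have := @measure_eq_rays (distribution P X) (distribution P' X').
rewrite /= XT XT' => /(_ (ltry _) erefl XX'); exact.
Qed.

Context (X : {RV P >-> R}) (X' : {RV P' >-> R}) (XX' : same_law X X').

Lemma same_law_ge0_integral (h : R -> \bar R) : measurable_fun setT h ->
  (forall x, 0 <= h x)%E ->
  (\int[P]_w h (X w) = \int[P']_w h (X' w))%E.
Proof.
move=> mh h0.
rewrite -(ge0_integral_distribution X mh h0) -(ge0_integral_distribution X' mh h0).
by apply: eq_measure_integral => A mA _; exact: XX'.
Qed.

Lemma same_law_integrable (h : R -> R) : measurable_fun setT h ->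
  integrableR P (fun w => h (X w)) -> integrableR P' (fun w => h (X' w)).
Proof.
move=> mh /integrableP[_ ih]; apply/integrableP; split.
  by apply/measurable_EFinP; apply: measurableT_comp.
rewrite (_ : (\int[_]_x _ = \int[P]_x `|(EFin \o (fun w => h (X w))) x|)%E)//.
rewrite -(@same_law_ge0_integral (fun x => `|(h x)%:E|%E))//.
by apply: measurableT_comp => //; exact/measurable_EFinP.
Qed.

Lemma same_law_Ex (h : R -> R) : measurable_fun setT h ->
  integrableR P (fun w => h (X w)) -> Ex P (fun w => h (X w)) = Ex P' (fun w => h (X' w)).
Proof.
move=> mh ih; congr fine.
have mh' : measurable_fun setT (EFin \o h) by exact/measurable_EFinP.
have := integral_distribution mh' ih.
have := integral_distribution mh' (same_law_integrable mh ih).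
rewrite /comp => <- <-.
by apply: eq_measure_integral => A mA _; exact: XX'.
Qed.

End SameLaw.

(** * Independence *)

Section Independence.
Context {R : realType} {d} {T : measurableType d} (P : probability T R).

Lemma bounded_rv_indic (B : set R) : measurable B -> bounded_rv (\1_B : R -> R).
Proof.
move=> mB; split; first exact: measurable_indic.
by exists 1 => x; rewrite indicE; case: (_ \in _); rewrite ?normr1 ?normr0.
Qed.

Lemma bounded_rv_of (h : R -> R) (X : {RV P >-> R}) :
  bounded_rv h -> bounded_rv (fun w => h (X w)).
Proof. by move=> [mh bh]; apply: bounded_rv_comp. Qed.

(** [h] is the uniform limit of the step functions [hm m], which are linear
    combinations of indicators of the level sets of [k m]. *)
Lemma indep_bounded (X : {RV P >-> R}) (K : T -> R) : bounded_rv K ->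
  (forall B : set R, measurable B ->
     Ex P (fun w => \1_B (X w) * K w) = Ex P (fun w => \1_B (X w)) * Ex P K) ->
  forall h : R -> R, bounded_rv h ->
    Ex P (fun w => h (X w) * K w) = Ex P (fun w => h (X w)) * Ex P K.
Proof.
move=> bK indK h [mh [M hM]].
have M0 : 0 <= M := le_trans (normr_ge0 _) (hM 0).
have [mK [N KN]] := bK.
pose k m x := Num.trunc ((h x + M) * m.+1%:R).
pose b m (l : nat) : set R := [set x | k m x = l].
pose hm m x := (k m x)%:R / m.+1%:R - M : R.
have hM0 x : 0 <= h x + M by have := hM x; rewrite ler_norml => /andP[]; lra.
have hM1 x : h x <= M by have := hM x; rewrite ler_norml => /andP[].
have kle m x : (k m x)%:R <= (h x + M) * m.+1%:R < (k m x).+1%:R.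
  by apply: truncn_itv; rewrite mulr_ge0.
have hh m x : `|h x - hm m x| <= m.+1%:R^-1.
  have /andP[k1 k2] := kle m x.
  have mp : 0 < m.+1%:R :> R by rewrite ltr0n.
  rewrite -ler_pdivrMr// in k1; rewrite -ltr_pdivlMr// in k2.
  rewrite -natr1 mulrDl div1r in k2.
  rewrite ler_norml /hm; move: k1 k2 mp.
  move: (_ / _) => u; move: (_^-1) => v k1 k2 mp.
  by apply/andP; split; lra.
have mb m l : measurable (b m l).
  apply: measurable_trunc_fiber; apply: measurable_funM => //.
  exact: measurable_funD.
have hmE m x : hm m x = \sum_(l < (Num.trunc (2 * M * m.+1%:R)).+1) (l%:R / m.+1%:R - M) * \1_(b m l) x.
  have kb : (k m x < (Num.trunc (2 * M * m.+1%:R)).+1)%N.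
    rewrite ltnS le_truncn// ler_wpM2r//.
    by have := hM1 x; lra.
  rewrite (bigD1 (Ordinal kb))//= big1 ?addr0.
    by rewrite indicE mem_set// mulr1.
  move=> l /eqP lk; rewrite indicE memNset ?mulr0// => kl; apply: lk.
  exact/val_inj.
have bb m l := bounded_rv_of X (bounded_rv_indic (mb m l)).
have indm m : Ex P (fun w => hm m (X w) * K w) = Ex P (fun w => hm m (X w)) * Ex P K.
  under eq_Rintegral do rewrite hmE mulr_suml.
  under [in RHS]eq_Rintegral do rewrite hmE.
  rewrite !Ex_sum; last 2 first.
  - move=> l; apply: bounded_rv_integrable; apply: bounded_rvM => //.
    exact: bounded_rv_cst.
  - move=> l; apply: bounded_rv_integrable; apply: bounded_rvM => //.
    by apply: bounded_rvM => //; exact: bounded_rv_cst.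
  rewrite mulr_suml; apply: eq_bigr => l _.
  under eq_Rintegral do rewrite -[_ * _ * K _]mulrA.
  rewrite !ExZ ?indK ?mulrA//; apply: bounded_rv_integrable => //.
  exact: bounded_rvM.
have bhm m : bounded_rv (hm m).
  rewrite (_ : hm m = fun x => \sum_(l < (Num.trunc (2 * M * m.+1%:R)).+1) (l%:R / m.+1%:R - M) * \1_(b m l) x).
    apply: bounded_rv_sum => l _; apply: bounded_rvM; first exact: bounded_rv_cst.
    exact: bounded_rv_indic.
  by apply/funext.
have hmbound m x : `|hm m x| <= M + 1.
  rewrite -[hm m x](subrK (h x)) (le_trans (ler_normD _ _))// addrC lerD//.
  rewrite distrC (le_trans (hh _ _))// invf_le1// ler1n//.
have hmcvg x : hm m x @[m --> \oo] --> h x.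
  apply/cvgrPdist_le => e e0; near=> m.
  apply: le_trans (hh m x) _; rewrite ltW//.
  by near: m; exact: near_infty_natSinv_lt (PosNum e0).
have c1 : Ex P (fun w => hm m (X w) * K w) @[m --> \oo] --> Ex P (fun w => h (X w) * K w).
  apply: (@dominated_Rintegral _ _ _ _ _ _ (fun w => (M + 1) * N)).
  - by move=> m; apply: measurable_funM => //; case: (bhm m) => mhm _; exact: measurableT_comp.
  - by apply: measurable_funM => //; exact: measurableT_comp.
  - exact/bounded_rv_integrable/bounded_rv_cst.
  - by move=> m w; rewrite normrM ler_pM.
  - by move=> w; apply: cvgM; [exact: hmcvg|exact: cvg_cst].
have c2 : Ex P (fun w => hm m (X w)) * Ex P K @[m --> \oo] --> Ex P (fun w => h (X w)) * Ex P K.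
  apply: cvgM; last exact: cvg_cst.
  apply: (@dominated_Rintegral _ _ _ _ _ _ (fun w => M + 1)).
  - by move=> m; case: (bhm m) => mhm _; exact: measurableT_comp.
  - exact: measurableT_comp.
  - exact/bounded_rv_integrable/bounded_rv_cst.
  - by move=> m w.
  - by move=> w; exact: hmcvg.
move: c1; under eq_fun do rewrite indm; move=> c1.
exact: cvg_unique c1 c2.
Unshelve. all: by end_near. Qed.

Context (X : nat -> {RV P >-> R}) (indX : mutually_independent X).

Lemma Ex_indic_RV (Y : {RV P >-> R}) (B : set R) : measurable B ->
  (Ex P (fun w => \1_B (Y w)))%:E = P (Y @^-1` B).
Proof.
move=> mB; have mYB : measurable (Y @^-1` B) by exact: measurable_funPTI.
rewrite -[X in P X]setIT -integral_indic// /Rintegral fineK.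
  by apply: eq_integral => w _; rewrite !indicE; congr (_%:R%:E); apply/idP/idP; rewrite !inE.
apply: integrable_fin_num => //; apply: bounded_rv_integrable.
exact: bounded_rv_of (bounded_rv_indic mB).
Qed.

Lemma indep_prod_indic n (B : nat -> set R) : (forall i, measurable (B i)) ->
  Ex P (fun w => \prod_(i < n) \1_(B i) (X i w)) =
  \prod_(i < n) Ex P (fun w => \1_(B i) (X i w)).
Proof.
move=> mB; pose J : {fset nat} := [fset i in iota 0 n]%fset.
have JE : perm_eq J (iota 0 n).
  apply: uniq_perm; rewrite ?fset_uniq ?iota_uniq// => i.
  by rewrite in_fset.
have mJ : measurable (\bigcap_(j in [set` J]) (X j @^-1` B j)).
  rewrite bigcap_fset; apply: bigsetI_measurable => i _; exact: measurable_funPTI.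
apply: EFin_inj.
rewrite -prodEFin (eq_bigr (fun i : 'I_n => P (X i @^-1` B i))); last first.
  by move=> i _; rewrite Ex_indic_RV.
rewrite -(big_mkord xpredT (fun i => P (X i @^-1` B i))) /index_iota subn0.
rewrite -(perm_big _ JE) -indX// -[X in P X]setIT -integral_indic// /Rintegral fineK.
  apply: eq_integral => w _; congr EFin; rewrite indicE.
  have [wB|wB] := pselect (forall i : 'I_n, B i (X i w)).
    rewrite big1 => [|i _]; last by rewrite indicE mem_set.
    rewrite mem_set// => i /=; rewrite in_fset mem_iota => /andP[_ ni].
    exact: (wB (Ordinal ni)).
  move/existsNP : wB => [i wB]; rewrite (bigD1 i)//= indicE memNset// mul0r memNset//.
  by move=> /(_ i) /=; rewrite in_fset mem_iota/= add0n => /(_ (ltn_ord i)).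
apply: integrable_fin_num => //; apply: bounded_rv_integrable.
apply: bounded_rv_prod => i _; exact: bounded_rv_of (bounded_rv_indic (mB i)).
Qed.

(** Coordinates are relaxed one at a time from indicators to bounded
    measurable functions, with the other coordinates as the factor [K] of
    [indep_bounded]. *)
Lemma indep_prod n (h : nat -> R -> R) : (forall i, bounded_rv (h i)) ->
  Ex P (fun w => \prod_(i < n) h i (X i w)) = \prod_(i < n) Ex P (fun w => h i (X i w)).
Proof.
suff : forall j (h : nat -> R -> R), (forall i, bounded_rv (h i)) ->
    (forall i, (j <= i)%N -> exists2 B : set R, measurable B & h i = \1_B) ->
    (j <= n)%N ->
    Ex P (fun w => \prod_(i < n) h i (X i w)) = \prod_(i < n) Ex P (fun w => h i (X i w)).
  move=> H bh.
  pose h' i := if (i < n)%N then h i else \1_setT.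
  transitivity (Ex P (fun w => \prod_(i < n) h' i (X i w))).
    by apply: eq_Rintegral => w _; apply: eq_bigr => i _; rewrite /h' ltn_ord.
  rewrite (H n h')//.
  - by apply: eq_bigr => i _; rewrite /h' ltn_ord.
  - by move=> i; rewrite /h'; case: ifP => // _; exact: bounded_rv_indic.
  - by move=> i ni; exists setT => //; rewrite /h' ltnNge ni.
move=> {h}; elim=> [|j IH] h bh hB jn.
  have /choice[B hBB] : forall i, exists B : set R, measurable B /\ h i = \1_B.
    by move=> i; have [B mB ->] := hB i isT; exists B.
  rewrite (_ : h = fun i => \1_(B i)); last by apply/funext => i; rewrite (hBB i).2.
  by apply: indep_prod_indic => i; exact: (hBB i).1.
pose hj (g : R -> R) i := if i == j then g else h i.
pose o := Ordinal jn.
pose K w := \prod_(i < n | i != o) h i (X i w).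
have KE g w : \prod_(i < n) hj g i (X i w) = g (X j w) * K w.
  rewrite (bigD1 o)//= /hj eqxx; congr (_ * _); apply: eq_bigr => i io.
  by rewrite ifN.
have PE g : \prod_(i < n) Ex P (fun w => hj g i (X i w)) =
    Ex P (fun w => g (X j w)) * \prod_(i < n | i != o) Ex P (fun w => h i (X i w)).
  rewrite (bigD1 o)//= /hj eqxx; congr (_ * _); apply: eq_bigr => i io.
  by rewrite ifN.
have indB B : measurable B -> Ex P (fun w => \1_B (X j w) * K w) =
    Ex P (fun w => \1_B (X j w)) * \prod_(i < n | i != o) Ex P (fun w => h i (X i w)).
  move=> mB; rewrite -PE -IH ?(ltnW jn)//.
  - by apply: eq_Rintegral => w _; rewrite KE.
  - by move=> i; rewrite /hj; case: eqP => // _; exact: bounded_rv_indic.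
  - move=> i ji; rewrite /hj; case: eqP => [_|/eqP ij]; first by exists B.
    by apply: hB; rewrite ltn_neqAle eq_sym ij.
have EK : Ex P K = \prod_(i < n | i != o) Ex P (fun w => h i (X i w)).
  have := indB setT measurableT; under eq_Rintegral do rewrite indicT mul1r.
  by move=> ->; under eq_Rintegral do rewrite indicT; rewrite Ex_cst mul1r.
have := @indep_bounded (X j) K _ _ (h j) (bh j).
rewrite EK -PE (_ : hj (h j) = h); last first.
  by apply/funext => i; rewrite /hj; case: eqP => // ->.
move=> <- //.
- by apply: eq_Rintegral => w _; rewrite -KE (_ : hj (h j) = h)//; apply/funext => i; rewrite /hj; case: eqP => // ->.
- by apply: bounded_rv_prod => i _; exact: bounded_rv_of.
Qed.

Definition truncate (m : nat) (x : R) : R := (`|x| <= m%:R)%R%:R * x.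

Lemma measurable_truncate m : measurable_fun setT (truncate m).
Proof.
apply: measurable_funM => //.
apply: (measurableT_comp (f := fun c : bool => c%:R : R)) => //.
by apply: measurable_fun_ler => //; exact: measurableT_comp.
Qed.

Lemma normr_truncate m x : `|truncate m x| <= m%:R.
Proof.
by rewrite /truncate; case: (boolP (`|x| <= m%:R)) => xm; rewrite ?mul1r// mul0r normr0.
Qed.

Lemma normr_truncate_le m x : `|truncate m x| <= `|x|.
Proof.
by rewrite /truncate; case: (`|x| <= m%:R); rewrite ?mul1r// mul0r normr0.
Qed.

Lemma cvg_truncate x : truncate m x @[m --> \oo] --> x.
Proof.
apply: (@cvg_trans _ (nbhs x)) => //; apply: cvg_near_cst.
near=> m; rewrite /truncate (_ : _ <= _ = true) ?mul1r//.
by near: m; exact: nbhs_infty_ger.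
Unshelve. all: by end_near. Qed.

Lemma integrable_of_sqr (f : T -> R) : measurable_fun setT f ->
  integrableR P (fun w => f w ^+ 2) -> integrableR P f.
Proof.
move=> mf f2.
have f21 : integrableR P (fun w => f w ^+ 2 + 1).
  by apply: integrableRD => //; exact/bounded_rv_integrable/bounded_rv_cst.
apply: (integrableR_dom mf f21) => w; rewrite -(real_normK (num_real (f w))).
by have := sqr_ge0 (`|f w| - 1); have := normr_ge0 (f w); nra.
Qed.

Lemma integrable_prod_of_sqr (f g : T -> R) : measurable_fun setT f -> measurable_fun setT g ->
  integrableR P (fun w => f w ^+ 2) -> integrableR P (fun w => g w ^+ 2) ->
  integrableR P (fun w => f w * g w).
Proof.
move=> mf mg f2 g2.
apply: (integrableR_dom (measurable_funM mf mg) (integrableRD f2 g2)) => w.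
rewrite normrM -(real_normK (num_real (f w))) -(real_normK (num_real (g w))).
by have := sqr_ge0 (`|f w| - `|g w|); have := normr_ge0 (f w); have := normr_ge0 (g w); nra.
Qed.

(** Truncation reduces square-integrable factors to bounded ones. *)
Lemma indep_prod_sqr (i j : nat) (f g : R -> R) : i != j ->
  measurable_fun setT f -> measurable_fun setT g ->
  integrableR P (fun w => f (X i w) ^+ 2) -> integrableR P (fun w => g (X j w) ^+ 2) ->
  Ex P (fun w => f (X i w) * g (X j w)) = Ex P (fun w => f (X i w)) * Ex P (fun w => g (X j w)).
Proof.
move=> ij mf mg f2 g2.
have mfi : measurable_fun setT (fun w => f (X i w)) by exact: measurableT_comp.
have mgj : measurable_fun setT (fun w => g (X j w)) by exact: measurableT_comp.
have bt (h : R -> R) m : measurable_fun setT h -> bounded_rv (fun x => truncate m (h x)).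
  move=> mh; apply: bounded_rv_comp => //; first exact: measurable_truncate.
  by exists m%:R => x; exact: normr_truncate.
have bnd m : Ex P (fun w => truncate m (f (X i w)) * truncate m (g (X j w))) =
    Ex P (fun w => truncate m (f (X i w))) * Ex P (fun w => truncate m (g (X j w))).
  pose h k : R -> R := if k == i then fun x => truncate m (f x) else
    if k == j then fun x => truncate m (g x) else fun=> 1.
  have bh k : bounded_rv (h k).
    rewrite /h; case: ifP => _; first exact: bt.
    by case: ifP => _; [exact: bt|exact: bounded_rv_cst].
  have := @indep_prod (i + j).+1 h bh.
  have iN : (i < (i + j).+1)%N by rewrite ltnS leq_addr.
  have jN : (j < (i + j).+1)%N by rewrite ltnS leq_addl.
  have ij' : Ordinal jN != Ordinal iN by rewrite eq_sym.
  rewrite (bigD1 (Ordinal iN))//= (bigD1 (Ordinal jN))//= big1 ?mulr1; last first.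
    move=> k /andP[ki kj]; rewrite /h ifN// ifN//; exact: Ex_cst.
  rewrite /h eqxx [in RHS]eq_sym.
  rewrite (negbTE ij) eqxx => <-; apply: eq_Rintegral => w _.
  rewrite (bigD1 (Ordinal iN))//= (bigD1 (Ordinal jN))//= big1 ?mulr1.
    by rewrite eqxx eq_sym (negbTE ij) eqxx.
  by move=> k /andP[ki kj]; rewrite ifN// ifN.
have cf : Ex P (fun w => truncate m (f (X i w))) @[m --> \oo] --> Ex P (fun w => f (X i w)).
  apply: (@dominated_Rintegral _ _ _ _ _ _ (fun w => `|f (X i w)|)) => //.
  - by move=> m; apply: measurableT_comp => //; exact: measurable_truncate.
  - by have := integrable_norm (integrable_of_sqr mfi f2).
  - by move=> m w; exact: normr_truncate_le.
  - by move=> w; exact: cvg_truncate.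
have cg : Ex P (fun w => truncate m (g (X j w))) @[m --> \oo] --> Ex P (fun w => g (X j w)).
  apply: (@dominated_Rintegral _ _ _ _ _ _ (fun w => `|g (X j w)|)) => //.
  - by move=> m; apply: measurableT_comp => //; exact: measurable_truncate.
  - by have := integrable_norm (integrable_of_sqr mgj g2).
  - by move=> m w; exact: normr_truncate_le.
  - by move=> w; exact: cvg_truncate.
have cfg : Ex P (fun w => truncate m (f (X i w)) * truncate m (g (X j w))) @[m --> \oo] -->
    Ex P (fun w => f (X i w) * g (X j w)).
  apply: (@dominated_Rintegral _ _ _ _ _ _ (fun w => `|f (X i w) * g (X j w)|)) => //.
  - by move=> m; apply: measurable_funM; apply: measurableT_comp => //; exact: measurable_truncate.
  - exact: measurable_funM.
  - by have := integrable_norm (integrable_prod_of_sqr mfi mgj f2 g2).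
  - by move=> m w; rewrite normrM [leRHS]normrM ler_pM//; exact: normr_truncate_le.
  - by move=> w; apply: cvgM; exact: cvg_truncate.
move: cfg; under eq_fun do rewrite bnd; move=> cfg.
exact: cvg_unique cfg (cvgM cf cg).
Qed.

Lemma Ex_sqr_sum n (f : R -> R) : measurable_fun setT f ->
  (forall i, integrableR P (fun w => f (X i w) ^+ 2)) ->
  (forall i, Ex P (fun w => f (X i w)) = 0) ->
  Ex P (fun w => (\sum_(i < n) f (X i w)) ^+ 2) = \sum_(i < n) Ex P (fun w => f (X i w) ^+ 2).
Proof.
move=> mf f2 f0.
have mfX i : measurable_fun setT (fun w => f (X i w)) by exact: measurableT_comp.
under eq_Rintegral do rewrite expr2 mulr_suml.
under eq_Rintegral do under eq_bigr do rewrite mulr_sumr.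
have iij i j : integrableR P (fun w => f (X i w) * f (X j w)).
  exact: integrable_prod_of_sqr.
rewrite Ex_sum; last by move=> i; apply: integrableR_sum => j; exact: iij.
apply: eq_bigr => i _; rewrite Ex_sum; last by move=> j; exact: iij.
rewrite (bigD1 i)//= big1 ?addr0.
  by apply: eq_Rintegral => w _; rewrite expr2.
by move=> j ji; rewrite indep_prod_sqr ?f0 ?mul0r// eq_sym.
Qed.

End Independence.

(** * Trigonometric functions of sums of independent variables *)

Section TrigonometricSums.
Context {R : realType} {d} {T : measurableType d} (P : probability T R).
Context (X : nat -> {RV P >-> R}) (indX : mutually_independent X).
Context (z : R -> R) (mz : measurable_fun setT z) (c s : R).
Hypothesis hc : forall i, Ex P (fun w => cos (z (X i w))) = c.
Hypothesis hs : forall i, Ex P (fun w => sin (z (X i w))) = s.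

Lemma bounded_rv_cos d' (V : measurableType d') (f : V -> R) :
  measurable_fun setT f -> bounded_rv (fun w => cos (f w)).
Proof.
move=> mf; apply: bounded_rv_comp => //.
  by apply: continuous_measurable_fun; exact: continuous_cos.
by exists 1 => x; rewrite ler_norml cos_geN1 cos_le1.
Qed.

Lemma bounded_rv_sin d' (V : measurableType d') (f : V -> R) :
  measurable_fun setT f -> bounded_rv (fun w => sin (f w)).
Proof.
move=> mf; apply: bounded_rv_comp => //.
  by apply: continuous_measurable_fun; exact: continuous_sin.
by exists 1 => x; rewrite ler_norml sin_geN1 sin_le1.
Qed.

(** Real and imaginary part of [(c + i s) ^+ n]. *)
Fixpoint rotation_power n : R * R :=
  if n is m.+1 then
    let p := rotation_power m in (p.1 * c - p.2 * s, p.2 * c + p.1 * s)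
  else (1, 0).

Let S j w := \sum_(i < j) z (X i w).

Let mS j : measurable_fun setT (S j).
Proof. by apply: measurable_sum => i; exact: measurableT_comp. Qed.

(** One factor of the addition formulas for [S j.+1] is a function of [X j]
    alone. Carrying a product over the later coordinates lets the induction
    absorb that factor, down to a plain product of functions of the [X i]. *)
Lemma Ex_trig_sum_prod j k (h : nat -> R -> R) : (forall i, bounded_rv (h i)) ->
  Ex P (fun w => cos (S j w) * \prod_(j <= i < j + k) h i (X i w)) =
    (rotation_power j).1 * \prod_(j <= i < j + k) Ex P (fun w => h i (X i w)) /\
  Ex P (fun w => sin (S j w) * \prod_(j <= i < j + k) h i (X i w)) =
    (rotation_power j).2 * \prod_(j <= i < j + k) Ex P (fun w => h i (X i w)).
Proof.
elim: j k h => [|j IH] k h bh.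
  have S0 w : S 0 w = 0 by rewrite /S big_ord0.
  rewrite /= add0n mul1r mul0r; split.
    rewrite big_mkord -(indep_prod indX k bh); apply: eq_Rintegral => w _.
    by rewrite S0 cos0 mul1r big_mkord.
  rewrite -[RHS](Ex_cst P); apply: eq_Rintegral => w _.
  by rewrite S0 sin0 mul0r.
pose h' (g : R -> R) i := if i == j then g else h i.
have h'E g w : \prod_(j <= i < j + k.+1) h' g i (X i w) =
    g (X j w) * \prod_(j.+1 <= i < j.+1 + k) h i (X i w).
  rewrite big_ltn ?addnS ?ltnS ?leq_addr// /h' eqxx; congr (_ * _).
  apply: eq_big_nat => i /andP[ji _]; by rewrite gtn_eqF.
have h'P g : \prod_(j <= i < j + k.+1) Ex P (fun w => h' g i (X i w)) =
    Ex P (fun w => g (X j w)) * \prod_(j.+1 <= i < j.+1 + k) Ex P (fun w => h i (X i w)).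
  rewrite big_ltn ?addnS ?ltnS ?leq_addr// /h' eqxx; congr (_ * _).
  apply: eq_big_nat => i /andP[ji _]; by rewrite gtn_eqF.
have bh' g : bounded_rv g -> forall i, bounded_rv (h' g i).
  by move=> bg i; rewrite /h'; case: eqP.
have bcz := bounded_rv_cos mz; have bsz := bounded_rv_sin mz.
have [cc sc] := IH k.+1 (h' (cos \o z)) (bh' _ bcz).
have [cs ss] := IH k.+1 (h' (sin \o z)) (bh' _ bsz).
rewrite !h'P /= hc in cc sc; rewrite !h'P /= hs in cs ss.
have SS w : S j.+1 w = S j w + z (X j w) by rewrite /S big_ord_recr.
have bK : bounded_rv (fun w => \prod_(j.+1 <= i < j.+1 + k) h i (X i w)).
  by apply: bounded_rv_prod => i _; exact: bounded_rv_of.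
have bcS := bounded_rv_cos (mS j); have bsS := bounded_rv_sin (mS j).
have bzc : bounded_rv (fun w => cos (z (X j w))) by exact: (bounded_rv_of (X j) bcz).
have bzs : bounded_rv (fun w => sin (z (X j w))) by exact: (bounded_rv_of (X j) bsz).
have ir (f g : T -> R) : bounded_rv f -> bounded_rv g ->
    integrableR P (fun w => f w * (g w * \prod_(j.+1 <= i < j.+1 + k) h i (X i w))).
  by move=> bf bg; apply/bounded_rv_integrable/bounded_rvM => //; exact: bounded_rvM.
split.
  rewrite /= mulrBl -!mulrA -cc -ss -ExB//; last 2 first.
  - by under eq_fun do rewrite h'E; exact: ir.
  - by under eq_fun do rewrite h'E; exact: ir.
  apply: eq_Rintegral => w _; rewrite SS cosD !h'E /=; ring.
rewrite /= mulrDl -!mulrA -sc -cs -ExD//; last 2 first.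
- by under eq_fun do rewrite h'E; exact: ir.
- by under eq_fun do rewrite h'E; exact: ir.
apply: eq_Rintegral => w _; rewrite SS sinD !h'E /=; ring.
Qed.

Lemma Ex_cos_sum n : Ex P (fun w => cos (\sum_(i < n) z (X i w))) = (rotation_power n).1.
Proof.
have [+ _] := @Ex_trig_sum_prod n 0 (fun=> cst 1) (fun=> bounded_rv_cst _).
rewrite big_geq ?addn0// mulr1 => <-; apply: eq_Rintegral => w _.
by rewrite big_geq// mulr1.
Qed.

Lemma Ex_sin_sum n : Ex P (fun w => sin (\sum_(i < n) z (X i w))) = (rotation_power n).2.
Proof.
have [_ +] := @Ex_trig_sum_prod n 0 (fun=> cst 1) (fun=> bounded_rv_cst _).
rewrite big_geq ?addn0// mulr1 => <-; apply: eq_Rintegral => w _.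
by rewrite big_geq// mulr1.
Qed.

Hypothesis (c1 : `|c| <= 1).

(** The two components stay in [- 1, 1], so replacing the rotation by
    the contraction [c] costs at most [`|s|] per step. *)
Lemma rotation_power_approx n :
  `|(rotation_power n).1 - c ^+ n| <= n%:R * `|s| /\
  `|(rotation_power n).2| <= n%:R * `|s|.
Proof.
elim: n => [|n [IH1 IH2]]; first by rewrite /= expr0 subrr normr0 mul0r.
have p2 : `|(rotation_power n).2| <= 1.
  rewrite -Ex_sin_sum; apply: normr_Ex => [|w].
    apply: bounded_rv_integrable; exact: (bounded_rv_sin (mS n)).
  by rewrite ler_norml sin_geN1 sin_le1.
have p1 : `|(rotation_power n).1| <= 1.
  rewrite -Ex_cos_sum; apply: normr_Ex => [|w].
    apply: bounded_rv_integrable; exact: (bounded_rv_cos (mS n)).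
  by rewrite ler_norml cos_geN1 cos_le1.
have H (a b : R) : `|a| <= n%:R * `|s| -> `|b| <= 1 -> `|a * c + b * s| <= n.+1%:R * `|s|.
  move=> ha hb; rewrite (le_trans (ler_normD _ _))// -natr1 mulrDl mul1r lerD//.
    by rewrite normrM (le_trans _ ha)// ler_piMr.
  by rewrite normrM ler_piMl.
rewrite /=; split; last exact: H.
rewrite (_ : _ - _ = ((rotation_power n).1 - c ^+ n) * c + (- (rotation_power n).2) * s).
  by apply: H => //; rewrite normrN.
by rewrite exprSr; ring.
Qed.

End TrigonometricSums.

(** * Trigonometric inequalities *)

Section TrigBounds.
Context {R : realType}.
Implicit Types x : R.

Lemma mean_value_from0 (f df : R -> R) x :
  (forall y, is_derive y (1 : R) f (df y)) ->
  exists2 y, `|y| <= `|x| & f x - f 0 = df y * x.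
Proof.
move=> fdf.
have cf (i : interval R) : {within [set` i], continuous f}.
  by apply: derivable_within_continuous => y _; case: (fdf y).
have [x0|x0] := leP 0 x.
  have [y] := MVT_segment x0 (fun y _ => fdf y) (cf _).
  rewrite in_itv/= subr0 => /andP[y0 yx] fE; exists y => //.
  by rewrite !ger0_norm.
have [y] := MVT_segment (ltW x0) (fun y _ => fdf y) (cf _).
rewrite in_itv/= sub0r => /andP[xy y0] fE; exists y.
  by rewrite !ler0_norm ?lerN2// ltW.
by rewrite -opprB fE mulrN opprK.
Qed.

Lemma normr_sin_le x : `|sin x| <= `|x|.
Proof.
have [y _] := mean_value_from0 x (fun y => is_derive_sin y).
by rewrite sin0 subr0 => ->; rewrite normrM ler_piMl// ler_norml cos_geN1 cos_le1.
Qed.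

Lemma normr_1Bcos_le x : `|1 - cos x| <= x ^+ 2.
Proof.
have [y yx] := mean_value_from0 x (fun y => is_derive_cos y).
rewrite cos0 distrC => ->; rewrite normrM normrN.
rewrite -(real_normK (num_real x)) expr2 ler_wpM2r//.
by rewrite (le_trans (normr_sin_le y)).
Qed.

Lemma normr_sinB_le3 x : `|sin x - x| <= `|x| ^+ 3.
Proof.
have H y : is_derive y (1 : R) (fun x => sin x - x) (cos y - 1) by apply: is_deriveB.
have [y yx] := mean_value_from0 x H.
rewrite sin0 !subr0 => ->; rewrite normrM exprSr ler_wpM2r// distrC.
rewrite (le_trans (normr_1Bcos_le y))// -(real_normK (num_real y)).
by rewrite ler_sqr ?nnegrE.
Qed.

(** Weaker than the cubic bound near [0], but integrable as soon as [x] has a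
    second moment. *)
Lemma normr_sinB_le2 x : `|sin x - x| <= 2 * x ^+ 2.
Proof.
rewrite -(real_normK (num_real x)); have [x1|x1] := leP `|x| 1.
  rewrite (le_trans (normr_sinB_le3 x))// exprSr.
  by have := normr_ge0 x; have := exprn_ge0 2 (normr_ge0 x); nra.
rewrite (le_trans (ler_normB _ _))//.
by have := normr_sin_le x; nra.
Qed.

Lemma normr_cos_taylor2 x : `|1 - cos x - x ^+ 2 / 2| <= x ^+ 4.
Proof.
have H y : is_derive y (1 : R) (fun x => 1 - cos x - x ^+ 2 / 2) (sin y - y).
  by apply: is_derive_eq; rewrite ?scaler1 !scaler0 /GRing.scale/=; field.
have [y yx] := mean_value_from0 x H.
rewrite cos0 subrr expr0n/= mul0r !subr0 => ->.
rewrite normrM (_ : x ^+ 4 = `|x| ^+ 4); last first.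
  by rewrite -normrX ger0_norm// exprn_even_ge0.
rewrite exprSr ler_wpM2r// (le_trans (normr_sinB_le3 y))//.
by rewrite lerXn2r ?nnegrE.
Qed.

End TrigBounds.

(** * The central limit theorem for one normalized sum *)

Section CharacteristicLimit.
Context {R : realType}.

Lemma cvg_near_eq (f g : nat -> R) (l : R) :
  (\forall n \near \oo, f n = g n) -> f n @[n --> \oo] --> l -> g n @[n --> \oo] --> l.
Proof. by move=> fg fl; exact: cvg_trans (near_eq_cvg fg) fl. Qed.

Lemma cvgnM (f g : nat -> R) (l m : R) : f n @[n --> \oo] --> l ->
  g n @[n --> \oo] --> m -> f n * g n @[n --> \oo] --> l * m.
Proof. by move=> fl gm; apply: cvgM. Qed.

Lemma cvgnD (f g : nat -> R) (l m : R) : f n @[n --> \oo] --> l ->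
  g n @[n --> \oo] --> m -> f n + g n @[n --> \oo] --> l + m.
Proof. by move=> fl gm; apply: cvgD. Qed.

Lemma cvgnB (f g : nat -> R) (l m : R) : f n @[n --> \oo] --> l ->
  g n @[n --> \oo] --> m -> f n - g n @[n --> \oo] --> l - m.
Proof. by move=> fl gm; apply: cvgB. Qed.

Lemma cvgn_cst (l : R) : (l : R) @[n --> \oo] --> l.
Proof. exact: cvg_cst. Qed.

Lemma cvgn_sum N (u : nat -> nat -> R) (l : nat -> R) :
  (forall j, u j n @[n --> \oo] --> l j) ->
  (\sum_(j < N) u j n) @[n --> \oo] --> \sum_(j < N) l j.
Proof.
move=> ul; elim: N => [|N IH].
  by under eq_fun do rewrite big_ord0; rewrite big_ord0; exact: cvgn_cst.
under eq_fun do rewrite big_ord_recr/=; rewrite big_ord_recr/=.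
exact: cvgnD IH (ul N).
Qed.

Lemma cvg_natV : (n%:R : R)^-1 @[n --> \oo] --> (0 : R).
Proof.
apply/cvgr0Pnorm_le => e e0; near=> n.
rewrite ger0_norm ?invr_ge0// invf_ple ?posrE//; last first.
  by rewrite ltr0n; near: n; exact: nbhs_infty_gt.
by near: n; exact: nbhs_infty_ger.
Unshelve. all: by end_near. Qed.

(** [1 + u <= expR u], at [u = - (1 - c)] and at [u = (1 - c) / c], bounds
    [c ^+ n] from above and from below. *)
Lemma cvg_expn_expR (c : nat -> R) (L : R) :
  n%:R * (1 - c n) @[n --> \oo] --> L -> c n ^+ n @[n --> \oo] --> expR (- L).
Proof.
move=> cL.
have cinv := cvg_natV.
have y0 : 1 - c n @[n --> \oo] --> (0 : R).
  have := cvgnM cinv cL; rewrite mul0r; apply: cvg_near_eq.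
  near=> n; rewrite /= mulrA mulVf ?mul1r// pnatr_eq0 -lt0n.
  by near: n; exact: nbhs_infty_gt.
have c1 : c n @[n --> \oo] --> (1 : R).
  have := cvgnB (@cvgn_cst 1) y0; rewrite subr0; apply: cvg_near_eq; near=> n; rewrite /= subKr//.
have cup : expR (- (n%:R * (1 - c n))) @[n --> \oo] --> expR (- L).
  exact: (cvg_comp _ _ (cvgN cL) (@continuous_expR R (- L))).
have clo : expR (- (n%:R * (1 - c n) / c n)) @[n --> \oo] --> expR (- L).
  have h : n%:R * (1 - c n) / c n @[n --> \oo] --> L.
    have : (c n)^-1 @[n --> \oo] --> (1 : R)^-1.
      apply: (cvgV (oner_neq0 R) c1).
    rewrite invr1 => cV; by have := cvgnM cL cV; rewrite mulr1.
  exact: (cvg_comp _ _ (cvgN h) (@continuous_expR R (- L))).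
apply: (squeeze_cvgr _ clo cup).
have cpos : \forall n \near \oo, 0 < c n by apply: (cvgr_gt 1 c1); exact: ltr01.
near=> n; have cn : 0 < c n by near: n.
rewrite -!mulrA -![- (n%:R * _)]mulrN !expRM_natl; apply/andP; split.
  apply: lerXn2r; rewrite ?nnegrE ?expR_ge0 ?(ltW cn)//.
  rewrite expRN -[leRHS]invrK lef_pV2 ?posrE ?expR_gt0 ?invr_gt0//.
  have := expR_ge1Dx ((1 - c n) / c n); apply: le_trans.
  by rewrite mulrBl divff ?gt_eqF// mul1r addrC subrK.
apply: lerXn2r; rewrite ?nnegrE ?expR_ge0 ?(ltW cn)//.
by have := expR_ge1Dx (- (1 - c n)); rewrite opprB addrC subrK.
Unshelve. all: by end_near. Qed.

Lemma cvg_sqrt_natV : (Num.sqrt (n%:R : R))^-1 @[n --> \oo] --> (0 : R).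
Proof.
have cinv := cvg_natV.
have := cvg_comp _ _ cinv (@sqrt_continuous R 0); rewrite sqrtr0.
apply: cvg_near_eq; near=> n => /=.
by rewrite sqrtrV.
Unshelve. all: by end_near. Qed.

Context {d} {T : measurableType d} (P : probability T R).
Context (X : nat -> {RV P >-> R}) (indX : mutually_independent X).
Hypothesis lawX : forall i, same_law (X i) (X 0%N).
Context (f : R -> R) (mf : measurable_fun setT f).
Hypothesis f2 : integrableR P (fun w => f (X 0%N w) ^+ 2).
Hypothesis f0 : Ex P (fun w => f (X 0%N w)) = 0.

Let v := Ex P (fun w => f (X 0%N w) ^+ 2).

Let c n := Ex P (fun w => cos (f (X 0%N w) / Num.sqrt n%:R)).
Let s n := Ex P (fun w => sin (f (X 0%N w) / Num.sqrt n%:R)).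

Let mfX : measurable_fun setT (fun w => f (X 0%N w)).
Proof. exact: measurableT_comp. Qed.

Let mfn n : measurable_fun setT (fun x => f x / Num.sqrt n%:R).
Proof. exact: measurable_funM. Qed.

Let mfXn n : measurable_fun setT (fun w => f (X 0%N w) / Num.sqrt n%:R).
Proof. exact: measurable_funM. Qed.

Lemma sqr_div_sqrtn n (x : R) : n%:R * (x / Num.sqrt n%:R) ^+ 2 = (0 < n)%N%:R * x ^+ 2.
Proof.
case: n => [|n]; first by rewrite !mul0r.
rewrite exprMn exprVn sqr_sqrtr// mulrC -mulrA mulVf ?pnatr_eq0//.
by rewrite mulr1 mul1r.
Qed.

(** The integrands [n (1 - cos (f / sqrt n))] converge to [f ^+ 2 / 2] and are
    dominated by [f ^+ 2]. *)
Let cvgc : n%:R * (1 - c n) @[n --> \oo] --> v / 2.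
Proof.
have -> : (fun n => n%:R * (1 - c n)) =
    (fun n => Ex P (fun w => n%:R * (1 - cos (f (X 0%N w) / Num.sqrt n%:R)))).
  apply/funext => n; have bc := bounded_rv_cos (mfXn n).
  rewrite ExZ ?ExB ?Ex_cst//; apply: bounded_rv_integrable => //.
  - exact: bounded_rv_cst.
  - by apply: bounded_rvB => //; exact: bounded_rv_cst.
rewrite (_ : v / 2 = Ex P (fun w => f (X 0%N w) ^+ 2 / 2)); last first.
  rewrite mulrC -ExZ//; by apply: eq_Rintegral => w _; rewrite mulrC.
apply: (@dominated_Rintegral _ _ _ _ _ _ (fun w => f (X 0%N w) ^+ 2)) => //.
- move=> n; apply: measurable_funM => //; apply: measurable_funB => //.
  by case: (bounded_rv_cos (mfXn n)).
- by apply: measurable_funM => //; exact: measurable_funX.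
- move=> n w; rewrite normrM ger0_norm//.
  apply: le_trans (ler_wpM2l _ (normr_1Bcos_le _)) _ => //.
  rewrite sqr_div_sqrtn; case: (0 < n)%N; rewrite ?mul1r// mul0r; exact: sqr_ge0.
move=> w; set x := f _.
suff : n%:R * (1 - cos (x / Num.sqrt n%:R)) - x ^+ 2 / 2 @[n --> \oo] --> (0 : R).
  by move/subr_cvg0.
have c0 : x ^+ 4 * (n%:R)^-1 @[n --> \oo] --> (0 : R).
  by rewrite -[X in _ --> X](mulr0 (x ^+ 4)); apply: cvgM; [exact: cvg_cst|exact: cvg_natV].
apply: norm_cvg0; apply: (squeeze_cvgr _ (cvg_cst 0) c0).
near=> n; have n0 : (0 < n)%N by near: n; exact: nbhs_infty_gt.
rewrite normr_ge0/=; have := sqr_div_sqrtn n x; rewrite n0 mul1r => <-.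
rewrite -mulrA -mulrBr normrM ger0_norm//.
apply: le_trans (ler_wpM2l _ (normr_cos_taylor2 _)) _ => //.
rewrite -[4%N]/(2 + 2)%N !exprD mulrA sqr_div_sqrtn n0 mul1r.
by rewrite [in leLHS]exprMn exprVn sqr_sqrtr// mulrA.
Unshelve. all: by end_near. Qed.

(** As [f] is centred, its linear term can be subtracted from the sine. *)
Let cvgs : n%:R * s n @[n --> \oo] --> (0 : R).
Proof.
have if1 := integrable_of_sqr mfX f2.
have ifn n : integrableR P (fun w => f (X 0%N w) / Num.sqrt n%:R).
  by under eq_fun do rewrite mulrC; exact: integrableRZ.
have -> : (fun n => n%:R * s n) =
    (fun n => Ex P (fun w => n%:R * (sin (f (X 0%N w) / Num.sqrt n%:R) - f (X 0%N w) / Num.sqrt n%:R))).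
  apply/funext => n; have bs := bounded_rv_integrable P (bounded_rv_sin (mfXn n)).
  rewrite ExZ; last exact: integrableRB.
  rewrite ExB// (_ : Ex P (fun w => f _ / _) = 0) ?subr0//.
  by under eq_Rintegral do rewrite mulrC; rewrite ExZ// f0 mulr0.
rewrite (_ : 0 = Ex P (fun=> 0)); last by rewrite Ex_cst.
apply: (@dominated_Rintegral _ _ _ _ _ _ (fun w => 2 * f (X 0%N w) ^+ 2)) => //.
- move=> n; apply: measurable_funM => //; apply: measurable_funB => //.
  by case: (bounded_rv_sin (mfXn n)).
- exact: integrableRZ.
- move=> n w; rewrite normrM ger0_norm//.
  apply: le_trans (ler_wpM2l _ (normr_sinB_le2 _)) _ => //.
  rewrite mulrCA sqr_div_sqrtn ler_wpM2l//.
  case: (0 < n)%N; rewrite ?mul1r// mul0r; exact: sqr_ge0.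
move=> w; set x := f _.
have c0 : `|x| ^+ 3 * (Num.sqrt n%:R)^-1 @[n --> \oo] --> (0 : R).
  by rewrite -[X in _ --> X](mulr0 (`|x| ^+ 3)); apply: cvgM; [exact: cvg_cst|exact: cvg_sqrt_natV].
apply: norm_cvg0; apply: (squeeze_cvgr _ (cvg_cst 0) c0).
near=> n; have n0 : (0 < n)%N by near: n; exact: nbhs_infty_gt.
rewrite normr_ge0/= normrM ger0_norm//.
apply: le_trans (ler_wpM2l _ (normr_sinB_le3 _)) _ => //.
rewrite exprSr mulrA -[X in n%:R * X]normrX normrX real_normK ?num_real//.
rewrite sqr_div_sqrtn n0 mul1r normrM normfV (ger0_norm (sqrtr_ge0 _)) mulrA.
by rewrite -(real_normK (num_real x)) -exprSr.
Unshelve. all: by end_near. Qed.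

Let lawc n i : Ex P (fun w => cos (f (X i w) / Num.sqrt n%:R)) = c n.
Proof.
have bc := bounded_rv_cos (mfn n).
apply: (same_law_Ex (lawX i) (h := fun x => cos (f x / Num.sqrt n%:R))); first by case: bc.
by apply: bounded_rv_integrable; exact: (bounded_rv_of (X i) bc).
Qed.

Let laws n i : Ex P (fun w => sin (f (X i w) / Num.sqrt n%:R)) = s n.
Proof.
have bs := bounded_rv_sin (mfn n).
apply: (same_law_Ex (lawX i) (h := fun x => sin (f x / Num.sqrt n%:R))); first by case: bs.
by apply: bounded_rv_integrable; exact: (bounded_rv_of (X i) bs).
Qed.

Let c1 n : `|c n| <= 1.
Proof.
apply: normr_Ex => [|w]; last by rewrite ler_norml cos_geN1 cos_le1.
exact: bounded_rv_integrable _ (bounded_rv_cos (mfXn n)).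
Qed.

Let cvgns : n%:R * `|s n| @[n --> \oo] --> (0 : R).
Proof.
have h : `|n%:R * s n| @[n --> \oo] --> (0 : R) by apply/norm_cvg0P.
apply: cvg_near_eq h; near=> n; rewrite /= normrM ger0_norm//.
Unshelve. all: by end_near. Qed.

Lemma cvg_Ex_cos_sum :
  Ex P (fun w => cos (\sum_(i < n) f (X i w) / Num.sqrt n%:R)) @[n --> \oo] -->
  expR (- (v / 2)).
Proof.
under eq_fun do rewrite (Ex_cos_sum indX (mfn _) (lawc _) (laws _)).
have cn := cvg_expn_expR cvgc.
have d0 : (rotation_power (c n) (s n) n).1 - c n ^+ n @[n --> \oo] --> (0 : R).
  apply: norm_cvg0; apply: (squeeze_cvgr _ (cvg_cst 0) cvgns).
  near=> n; rewrite normr_ge0/=.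
  by have [+ _] := rotation_power_approx indX (mfn n) (lawc n) (laws n) (c1 n) n.
have := cvgnD d0 cn; rewrite add0r; apply: cvg_near_eq.
by near=> n; rewrite /= subrK//.
Unshelve. all: by end_near. Qed.

Lemma cvg_Ex_sin_sum :
  Ex P (fun w => sin (\sum_(i < n) f (X i w) / Num.sqrt n%:R)) @[n --> \oo] --> (0 : R).
Proof.
under eq_fun do rewrite (Ex_sin_sum indX (mfn _) (lawc _) (laws _)).
apply: norm_cvg0; apply: (squeeze_cvgr _ (cvg_cst 0) cvgns).
near=> n; rewrite normr_ge0/=.
by have [_] := rotation_power_approx indX (mfn n) (lawc n) (laws n) (c1 n) n.
Unshelve. all: by end_near. Qed.


End CharacteristicLimit.

(** * Cosine transform of the normal law *)

Section NormalCharacteristic.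
Context {R : realType}.
Notation mu := (@lebesgue_measure R).

(** The fundamental theorem of calculus on [- n, n], with [n] to infinity. This
    stands for integration by parts on the whole line. *)
Lemma Rintegral_derive_eq0 (h dh : R -> R) :
  (forall x, is_derive x (1 : R) h (dh x)) -> continuous dh ->
  integrableR mu dh ->
  h n%:R @[n --> \oo] --> (0 : R) -> h (- n%:R) @[n --> \oo] --> (0 : R) ->
  \int[mu]_x dh x = 0.
Proof.
move=> hdh cdh idh hp hn.
have ch (i : interval R) : {within [set` i], continuous h}.
  by apply: derivable_within_continuous => y _; case: (hdh y).
have FTC n : \int[mu]_(x in `[- n.+1%:R, n.+1%:R]) dh x = h n.+1%:R - h (- n.+1%:R).
  have n1 : - n.+1%:R < n.+1%:R :> R by rewrite -subr_gt0 opprK -natrD ltr0n.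
  rewrite /Rintegral (@continuous_FTC2 _ _ h)//.
  - by apply: continuous_subspaceT.
  - have [_ cl cr] := (continuous_within_itvP _ n1).1 (ch `[- n.+1%:R, n.+1%:R]).
    by split => // x _; case: (hdh x).
  - by move=> x _; rewrite derive1E derive_val.
have c1 : \int[mu]_(x in `[- n.+1%:R, n.+1%:R]) dh x @[n --> \oo] --> \int[mu]_x dh x.
  have -> : (fun n : nat => \int[mu]_(x in `[- n.+1%:R, n.+1%:R]) dh x) =
      (fun n => \int[mu]_x (dh \_ `[- n.+1%:R, n.+1%:R]) x).
    by apply/funext => n; rewrite Rintegral_mkcond.
  have mdh : measurable_fun setT dh by exact: continuous_measurable_fun.
  apply: (@dominated_Rintegral _ _ _ mu (fun n => dh \_ `[- n.+1%:R, n.+1%:R]) dh (fun x => `|dh x|)) => //.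
  - by move=> n; apply/(measurable_restrictT _ _).1 => //; exact: measurable_funTS.
  - by have := integrable_norm idh.
  - by move=> n x; rewrite patchE; case: ifPn => // _; rewrite normr0.
  - move=> x; apply: cvg_near_cst; near=> n.
    rewrite patchE mem_set//= in_itv/= -ler_norml.
    have xn : `|x| <= n%:R by near: n; exact: nbhs_infty_ger.
    by rewrite (le_trans xn)// ler_nat.
have c2 : \int[mu]_(x in `[- n.+1%:R, n.+1%:R]) dh x @[n --> \oo] --> (0 : R).
  under eq_fun do rewrite FTC.
  have := cvgnB hp hn; rewrite subr0 => hpn.
  by move: hpn; rewrite -cvg_shiftS.
exact: cvg_unique c1 c2.
Unshelve. all: by end_near. Qed.

Section Density.
Context (sigma : R) (sigma0 : sigma != 0).
Let phi := normal_pdf 0 sigma.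

Let phiE x : phi x = normal_peak sigma * expR (- x ^+ 2 / (sigma ^+ 2 *+ 2)).
Proof. by rewrite /phi normal_pdfE// /normal_fun subr0. Qed.

Let s2_gt0 : 0 < sigma ^+ 2.
Proof. by rewrite exprn_even_gt0. Qed.

Let s2_neq0 : sigma ^+ 2 != 0.
Proof. by rewrite gt_eqF. Qed.

Let is_derive_phi x : is_derive x (1 : R) phi (- (x / sigma ^+ 2) * phi x).
Proof.
rewrite (_ : phi = fun x => normal_peak sigma * expR (- x ^+ 2 / (sigma ^+ 2 *+ 2))); last first.
  by apply/funext => y; rewrite phiE.
apply: is_derive_eq; rewrite ?scaler1 ?scaler0 add0r /GRing.scale/=.
by field.
Qed.

Let cphi : continuous phi.
Proof. exact: continuous_normal_pdf. Qed.

Let mphi : measurable_fun setT phi.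
Proof. exact: measurable_normal_pdf. Qed.

Let iphi : integrableR mu phi.
Proof. exact: integrable_normal_pdf. Qed.

Let phi_ge0 x : 0 <= phi x.
Proof. exact: normal_pdf_ge0. Qed.

(** One square root of the Gaussian factor absorbs [x ^+ 2], and the other one is
    the Gaussian factor of twice the variance. *)
Let normr_mul_phi x : `|x| * phi x <= phi x +
  sigma ^+ 2 *+ 4 * normal_peak sigma / normal_peak (Num.sqrt 2 * sigma) *
    normal_pdf 0 (Num.sqrt 2 * sigma) x.
Proof.
have s20 : Num.sqrt 2 * sigma != 0 by rewrite mulf_neq0// sqrtr_eq0 -ltNge.
rewrite (normal_pdfE _ s20)/= mulrA divfK ?gt_eqF ?normal_peak_gt0//.
rewrite /normal_fun subr0 exprMn sqr_sqrtr// phiE.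
set k := normal_peak sigma; have k0 : 0 <= k by exact: normal_peak_ge0.
have -> : expR (- x ^+ 2 / (sigma ^+ 2 *+ 2)) = expR (- x ^+ 2 / (2 * sigma ^+ 2 *+ 2)) ^+ 2.
  by rewrite -expRM_natl; congr expR; field.
set e := expR (- x ^+ 2 / (2 * sigma ^+ 2 *+ 2)).
have e0 : 0 < e by exact: expR_gt0.
have xe : x ^+ 2 * e <= sigma ^+ 2 *+ 4.
  have -> : x ^+ 2 = sigma ^+ 2 *+ 4 * (x ^+ 2 / (sigma ^+ 2 *+ 4)) by field.
  have := expR_ge1Dx (x ^+ 2 / (sigma ^+ 2 *+ 4)); set u := x ^+ 2 / _ => eu.
  have -> : e = (expR u)^-1 by rewrite -expRN; congr expR; rewrite /u; field.
  rewrite -mulrA ler_piMr ?mulrn_wge0 ?(ltW s2_gt0)//.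
  by rewrite ler_pdivrMr ?expR_gt0// mul1r; lra.
have x1 : `|x| <= 1 + x ^+ 2.
  rewrite -(real_normK (num_real x)).
  by have := sqr_ge0 (`|x| - 1); have := normr_ge0 x; nra.
have ke : 0 <= k * e by rewrite mulr_ge0// ltW.
have ke2 : 0 <= k * e ^+ 2 by rewrite mulr_ge0// exprn_ge0// ltW.
apply: le_trans (ler_wpM2r ke2 x1) _; rewrite mulrDl mul1r lerD2l.
rewrite (_ : x ^+ 2 * _ = (x ^+ 2 * e) * (k * e)); last by ring.
by rewrite -[leRHS]mulrA ler_wpM2r.
Qed.

Lemma integrable_mul_normal_pdf : integrableR mu (fun x => `|x| * phi x).
Proof.
have iJ : integrableR mu (fun x => phi x + sigma ^+ 2 *+ 4 * normal_peak sigma / normal_peak (Num.sqrt 2 * sigma) *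
    normal_pdf 0 (Num.sqrt 2 * sigma) x).
  have := integrableD measurableT iphi (integrableZl measurableT (sigma ^+ 2 *+ 4 * normal_peak sigma / normal_peak (Num.sqrt 2 * sigma))
    (integrable_normal_pdf 0 (Num.sqrt 2 * sigma))).
  by apply: eq_integrable.
apply: (le_integrable _ _ _ iJ) => //.
  apply/measurable_EFinP; apply: measurable_funM => //; exact: measurableT_comp.
move=> x _ /=; rewrite lee_fin normrM normr_id (ger0_norm (phi_ge0 x)).
by rewrite (le_trans (normr_mul_phi x))// ler_norm.
Qed.

Let cvg_phi (h : R -> R) : (forall x, `|h x| <= phi x) ->
  h n%:R @[n --> \oo] --> (0 : R) /\ h (- n%:R) @[n --> \oo] --> (0 : R).
Proof.
move=> hphi.
have phiN x : phi (- x) = phi x by rewrite !phiE sqrrN.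
have phi_le n : phi n.+1%:R <= normal_peak sigma * (sigma ^+ 2 *+ 2) * n.+1%:R^-1.
  rewrite phiE -mulrA ler_wpM2l ?normal_peak_ge0//.
  have n1 : 1 <= n.+1%:R :> R by rewrite ler1n.
  have n0 : n.+1%:R != 0 :> R by rewrite pnatr_eq0.
  rewrite mulNr expRN -lef_pV2 ?posrE ?invr_gt0 ?expR_gt0 ?mulr_gt0 ?invr_gt0 ?mulrn_wgt0//.
  rewrite invrK; apply: le_trans (expR_ge1Dx _).
  rewrite invfM invrK mulrC.
  have i0 : 0 < (sigma ^+ 2 *+ 2)^-1 by rewrite invr_gt0 mulrn_wgt0.
  by rewrite -[leLHS]add0r lerD// ler_wpM2r ?(ltW i0)//; nra.
have lim0 : normal_peak sigma * (sigma ^+ 2 *+ 2) * n.+1%:R^-1 @[n --> \oo] --> (0 : R).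
  have := cvgnM (@cvgn_cst R (normal_peak sigma * (sigma ^+ 2 *+ 2))) (@cvg_harmonic R).
  by rewrite mulr0.
by split; rewrite -cvg_shiftS; apply: norm_cvg0; apply: (squeeze_cvgr _ (cvg_cst 0) lim0);
  near=> n; rewrite normr_ge0/= (le_trans (hphi _))// ?phiN.
Unshelve. all: by end_near. Qed.

Variable th : R.

Let g (t : R) := \int[mu]_x (cos (t * x + th) * phi x).
Let k (t x : R) := cos (t * x + th) * phi x.

Let ccos t : continuous (fun x : R => cos (t * x + th)).
Proof.
move=> x; apply: (@continuous_comp _ _ _ (fun x => t * x + th) cos); last exact: continuous_cos.
by apply: cvgD; [apply: cvgM; [exact: cvg_cst|exact: cvg_id]|exact: cvg_cst].
Qed.

Let csin t : continuous (fun x : R => sin (t * x + th)).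
Proof.
move=> x; apply: (@continuous_comp _ _ _ (fun x => t * x + th) sin); last exact: continuous_sin.
by apply: cvgD; [apply: cvgM; [exact: cvg_cst|exact: cvg_id]|exact: cvg_cst].
Qed.

Let mcos t : measurable_fun setT (fun x : R => cos (t * x + th)).
Proof. exact: continuous_measurable_fun. Qed.

Let msin t : measurable_fun setT (fun x : R => sin (t * x + th)).
Proof. exact: continuous_measurable_fun. Qed.

Let ibd (u : R -> R) : measurable_fun setT u -> (forall x, `|u x| <= 1) ->
  integrableR mu (fun x => u x * phi x).
Proof.
move=> mu1 u1; apply: (le_integrable _ _ _ iphi) => //.
  by apply/measurable_EFinP; exact: measurable_funM.
by move=> x _ /=; rewrite lee_fin normrM ler_piMl.
Qed.

Let ibdx (u : R -> R) : measurable_fun setT u -> (forall x, `|u x| <= 1) ->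
  integrableR mu (fun x => x * u x * phi x).
Proof.
move=> mu1 u1; apply: (le_integrable _ _ _ integrable_mul_normal_pdf) => //.
  by apply/measurable_EFinP; apply: measurable_funM => //; exact: measurable_funM.
move=> x _ /=; rewrite lee_fin !normrM normr_id ler_wpM2r//.
by rewrite ler_piMr.
Qed.

Let cos1 (x : R) : `|cos x| <= 1.
Proof. by rewrite ler_norml cos_geN1 cos_le1. Qed.

Let sin1 (x : R) : `|sin x| <= 1.
Proof. by rewrite ler_norml sin_geN1 sin_le1. Qed.

Let is_derive_k t x : is_derive t (1 : R) (k ^~ x) (- (x * sin (t * x + th) * phi x)).
Proof.
apply: is_derive_eq; rewrite ?scaler1 ?scaler0 /GRing.scale/=.
by ring.
Qed.

(** Differentiation under the integral sign, dominated by [`|x| * phi x]. *)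
Let is_derive_g t : is_derive t (1 : R) g (- \int[mu]_x (x * sin (t * x + th) * phi x)).
Proof.
have dk s x : partial1of2 k s x = - (x * sin (s * x + th) * phi x).
  rewrite /partial1of2 derive1E; have := is_derive_k s x => H.
  by rewrite derive_val.
have tI : [set` `]t - 1, t + 1[] t by rewrite /= in_itv/=; apply/andP; split; lra.
have ik s : [set` `]t - 1, t + 1[] s -> integrableR mu (k s).
  by move=> _; apply: ibd (mcos s) _ => x; exact: cos1.
have kd s x : [set` `]t - 1, t + 1[] s -> [set: R] x -> derivable (k ^~ x) s 1.
  by move=> _ _; case: (is_derive_k s x).
have kG s x : [set` `]t - 1, t + 1[] s -> [set: R] x -> `|partial1of2 k s x| <= `|x| * phi x.
  move=> _ _; rewrite dk normrN !normrM (ger0_norm (phi_ge0 x)) ler_wpM2r//.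
  by rewrite ler_piMr.
have G0 x : 0 <= `|x| * phi x by rewrite mulr_ge0.
have dg := derivable_under_integral measurableT tI ik kd G0 integrable_mul_normal_pdf kG.
have eg := differentiation_under_integral measurableT tI ik kd G0 integrable_mul_normal_pdf kG.
apply: DeriveDef => //.
rewrite -derive1E eg; under eq_Rintegral do rewrite dk -mulN1r.
rewrite RintegralZl// ?mulN1r//.
by apply: ibdx (msin t) _ => x; exact: sin1.
Qed.

Let by_parts t : \int[mu]_x (x * sin (t * x + th) * phi x) = sigma ^+ 2 * t * g t.
Proof.
pose h x := sin (t * x + th) * phi x.
pose dh x := t * (cos (t * x + th) * phi x) - (sigma ^+ 2)^-1 * (x * sin (t * x + th) * phi x).
have hdh x : is_derive x (1 : R) h (dh x).
  have dphi := is_derive_phi x.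
  apply: is_derive_eq; rewrite ?scaler1 ?scaler0 /GRing.scale/= /dh.
  by field.
have ic := ibd (mcos t) (fun x => cos1 (t * x + th)).
have isn := ibdx (msin t) (fun x => sin1 (t * x + th)).
have cdh : continuous dh.
  move=> x; apply: cvgB; (apply: cvgM; first exact: cvg_cst); apply: cvgM.
  - exact: ccos.
  - exact: cphi.
  - by apply: cvgM; [exact: cvg_id|exact: csin].
  - exact: cphi.
have idh : integrableR mu dh.
  have := integrableB measurableT (integrableZl measurableT t ic) (integrableZl measurableT (sigma ^+ 2)^-1 isn).
  by apply: eq_integrable.
have : \int[mu]_x dh x = 0.
  have [h1 h2] : h n%:R @[n --> \oo] --> (0 : R) /\ h (- n%:R) @[n --> \oo] --> (0 : R).
    by apply: cvg_phi => x; rewrite normrM (ger0_norm (phi_ge0 x)) ler_piMl.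
  exact: (Rintegral_derive_eq0 hdh cdh idh h1 h2).
rewrite RintegralB//; last 2 first.
- by have := integrableZl measurableT t ic; apply: eq_integrable.
- by have := integrableZl measurableT (sigma ^+ 2)^-1 isn; apply: eq_integrable.
rewrite !RintegralZl// => /eqP; rewrite subr_eq0 => /eqP e.
by rewrite -mulrA e mulrA divff ?mul1r.
Qed.

(** By [by_parts] the integral [g] solves [g' = - sigma ^+ 2 * t * g], so that
    [g * E] is constant. *)
Lemma normal_pdf_cos t :
  \int[mu]_x (cos (t * x + th) * normal_pdf 0 sigma x) = cos th * expR (- (sigma ^+ 2 * t ^+ 2 / 2)).
Proof.
pose E (t : R) := expR (sigma ^+ 2 * t ^+ 2 / 2).
have dE s : is_derive s (1 : R) (fun s => g s * E s) 0.
  have := is_derive_g s; rewrite by_parts => dg.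
  apply: is_derive_eq; rewrite ?scaler1 ?scaler0 /GRing.scale/= /E.
  by field.
have g0 : g 0 = cos th.
  rewrite /g; under eq_Rintegral do rewrite mul0r add0r.
  by rewrite RintegralZl// /Rintegral integral_normal_pdf mulr1.
have [y _] := mean_value_from0 t dE.
rewrite mul0r g0 /E expr0n/= mulr0 mul0r expR0 mulr1 => /eqP; rewrite subr_eq0 => /eqP gE.
by rewrite expRN -gE mulfK// gt_eqF// expR_gt0.
Qed.

End Density.

Lemma integral_normal_prob_pdf (m sigma : R) (f : R -> \bar R) :
  (normal_prob m sigma).-integrable setT f ->
  (\int[normal_prob m sigma]_x f x = \int[mu]_x (f x * (normal_pdf m sigma x)%:E))%E.
Proof.
move=> intf; have mf := measurable_int _ intf.
rewrite -(Radon_Nikodym_change_of_variables (normal_prob_dominates m sigma))//=.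
apply: ae_eq_integral => //.
- apply: emeasurable_funM => //; apply: (measurable_int mu).
  by apply: Radon_Nikodym_integrable; exact: normal_prob_dominates.
- apply: emeasurable_funM => //=; apply/measurableT_comp => //=.
  exact: measurable_normal_pdf.
- apply: ae_eqe_mul2l => /=.
  rewrite Radon_NikodymE//=; first exact: normal_prob_dominates.
  move=> nmu; case: cid => /= h [h1 h2 h3].
  apply: integral_ae_eq => //=.
  + by apply/measurableT_comp => //; exact: measurable_normal_pdf.
  + by move=> E E01 mE; rewrite -h3.
Qed.

Context d (T : measurableType d) (P : probability T R).

Lemma integral_of_law (nu : {measure set (measurableTypeR R) -> \bar R}) (Z : {RV P >-> R})
    (f : R -> \bar R) :
  measurable_fun [set: measurableTypeR R] (f : measurableTypeR R -> \bar R) ->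
  P.-integrable setT (f \o Z) ->
  (forall A : set R, measurable A -> P [set w | A (Z w)] = nu A) ->
  (\int[P]_w f (Z w) = \int[nu]_x f x)%E.
Proof.
move=> mf iZ ZE.
have mZ : @measurable_fun _ _ T (measurableTypeR R) setT Z by exact: (measurable_funPT Z).
have := @integral_pushforward _ _ T (measurableTypeR R) R Z mZ P setT f mf iZ measurableT.
rewrite preimage_setT => <-.
by apply: eq_measure_integral => A mA _; exact: ZE.
Qed.

Lemma normal_law_cos (Z : {RV P >-> R}) (v th : R) : 0 <= v ->
  (forall A : set R, measurable A -> P [set w | A (Z w)] = normal_law 0 v A) ->
  Ex P (fun w => cos (Z w + th)) = cos th * expR (- (v / 2)).
Proof.
move=> v0 ZE.
have bc : bounded_rv (fun x : R => cos (x + th)).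
  by apply: bounded_rv_cos; exact: measurable_funD.
have bc' : bounded_rv (fun x : measurableTypeR R => cos (x + th)) by exact: bc.
have mc' : measurable_fun [set: measurableTypeR R] (EFin \o (fun x => cos (x + th))).
  by case: bc' => mc _; exact/measurable_EFinP.
have ic := bounded_rv_integrable P (bounded_rv_of Z bc).
move: ZE; rewrite /normal_law; case: ifPn => [/eqP ->|vn0] ZE.
  rewrite /Rintegral (integral_of_law (nu := \d_(0 : measurableTypeR R)) mc' ic ZE).
  by rewrite integral_dirac// /dirac indicT mul1e /= add0r mul0r oppr0 expR0 mulr1.
have s0 : Num.sqrt v != 0 by rewrite sqrtr_eq0 -ltNge lt_neqAle eq_sym vn0.
rewrite /Rintegral (integral_of_law (nu := normal_prob 0 (Num.sqrt v)) mc' ic ZE).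
rewrite integral_normal_prob_pdf//; last exact: bounded_rv_integrable.
have := normal_pdf_cos s0 th 1.
rewrite /Rintegral expr1n mulr1 sqr_sqrtr// => <-; congr fine.
by apply: eq_integral => x _; rewrite mul1r.
Qed.

Lemma normal_law_point (Z : T -> R) (v : R) (x : R) : 0 < v ->
  (forall A : set R, measurable A -> P [set w | A (Z w)] = normal_law 0 v A) ->
  P [set w | Z w = x] = 0%E.
Proof.
move=> v0 ZE; rewrite (ZE [set x])// /normal_law gt_eqF//.
have /null_content_dominatesP := normal_prob_dominates (0 : R) (Num.sqrt v).
apply; [exact: measurable_set1|exact: lebesgue_measure_set1].
Qed.

End NormalCharacteristic.

(** * Approximation by polynomials *)

Lemma compact_unif_cont (R : realType) (U : pseudoMetricType R) (f : U -> R) (K : set U) (e : R) :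
  compact K -> continuous f -> 0 < e ->
  exists2 d : R, 0 < d & forall x y, K x -> ball x d y -> `|f x - f y| < e.
Proof.
move=> /compact_near_coveringP cK cf e0.
have /= := cK R (0 : R)^'+ (fun d x => forall y, ball x d y -> `|f x - f y| < e) _.
have cov : forall x, K x -> \forall x' \near x & d \near (0 : R)^'+,
    forall y, ball x' d y -> `|f x' - f y| < e.
  move=> x Kx.
  have : \forall y \near x, `|f x - f y| < e / 2.
    by have /cvgrPdist_lt := cf x; apply; rewrite divr_gt0.
  move=> /nbhs_ballP[r /= r0 rf].
  near=> x' d => y x'y.
  have dr : d <= r / 2 by near: d; apply: nbhs_right_le; rewrite divr_gt0.
  have fx' : `|f x - f x'| < e / 2.
    apply: rf; apply: (le_ball (e1 := r / 2)); first by lra.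
    by near: x'; apply: nbhsx_ballx; rewrite divr_gt0.
  have fy : `|f x - f y| < e / 2.
    apply: rf; rewrite [r]splitr; apply: (@ball_triangle _ _ x').
      by near: x'; apply: nbhsx_ballx; rewrite divr_gt0.
    exact: le_ball x'y.
  rewrite (_ : _ - _ = (f x - f y) - (f x - f x')); last by ring.
  by rewrite (le_lt_trans (ler_normB _ _))// [e]splitr ltrD.
move=> /(_ _ cov) H.
have [d [d0 Hd]] : exists d, 0 < d /\ (forall x, K x -> forall y, ball x d y -> `|f x - f y| < e).
  near (0 : R)^'+ => d; exists d; split; near: d; [exact: nbhs_right_gt|exact: H].
by exists d => // x y Kx; exact: Hd.
Unshelve. all: by end_near. Qed.

Section DeCasteljau.
Context {R : realType}.

(** Evaluating [n] steps of this scheme at [0] gives the Bernstein polynomial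
    of degree [n] of [k |-> f k]. *)
Fixpoint de_casteljau n (f : nat -> R) (k : nat) : {poly R} :=
  if n is m.+1 then
    (1 - 'X) * de_casteljau m f k + 'X * de_casteljau m f k.+1
  else (f k)%:P.

Lemma de_casteljauS n f k t : (de_casteljau n.+1 f k).[t] =
  (1 - t) * (de_casteljau n f k).[t] + t * (de_casteljau n f k.+1).[t].
Proof. by rewrite /= !hornerE. Qed.

Lemma de_casteljau_le n f g k t : 0 <= t <= 1 -> (forall k, f k <= g k) ->
  (de_casteljau n f k).[t] <= (de_casteljau n g k).[t].
Proof.
move=> /andP[t0 t1] fg; elim: n k => [|n IH] k; first by rewrite /= !hornerE.
by rewrite !de_casteljauS lerD// ler_wpM2l// subr_ge0.
Qed.

(** Each step moves the mean by [t] and adds [t (1 - t)] to the variance. *)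
Lemma de_casteljau_quadratic n (c b : R) (m : R) k t :
  (de_casteljau n (fun k => c + b * (k%:R - m) ^+ 2) k).[t] =
  c + b * ((k%:R - m + n%:R * t) ^+ 2 + n%:R * (t * (1 - t))).
Proof.
elim: n k => [|n IH] k; first by rewrite /= !hornerE/=; ring.
by rewrite de_casteljauS !IH -!natr1; ring.
Qed.

(** Deviations of [f (k / n)] from [f t] are at most [e / 2] plus a multiple
    of the squared distance, whose Bernstein average is [t (1 - t) / n]. *)
Lemma weierstrass_approximation (f : R -> R) (M e : R) : continuous f ->
  (forall x, `|f x| <= M) -> 0 < e ->
  exists p : {poly R}, forall t, 0 <= t <= 1 -> `|f t - p.[t]| <= e.
Proof.
move=> cf fM e0.
have e20 : 0 < e / 2 by rewrite divr_gt0.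
have [d d0 fd] := compact_unif_cont (segment_compact (a := 0) (b := 1)) cf e20.
have M0 : 0 <= M := le_trans (normr_ge0 _) (fM 0).
have dev t x : 0 <= t <= 1 -> `|f t - f x| <= e / 2 + 2 * M / d ^+ 2 * (x - t) ^+ 2.
  move=> t01; have B0 : 0 <= 2 * M / d ^+ 2 by apply: divr_ge0; [exact: mulr_ge0|exact: sqr_ge0].
  have [xt|xt] := ltP `|x - t| d.
    have h : `|f t - f x| < e / 2.
      by apply: fd; [rewrite /= in_itv|rewrite /ball/= distrC].
    by rewrite (le_trans (ltW h))// lerDl mulr_ge0// sqr_ge0.
  rewrite (le_trans (ler_normB _ _))// (le_trans (lerD (fM t) (fM x)))//.
  have h1 : 1 <= (x - t) ^+ 2 / d ^+ 2.
    rewrite ler_pdivlMr ?exprn_gt0// mul1r -(real_normK (num_real (x - t))).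
    by rewrite lerXn2r ?nnegrE// ltW.
  have h2 : 2 * M <= 2 * M * ((x - t) ^+ 2 / d ^+ 2).
    by rewrite -[leLHS]mulr1 ler_wpM2l// mulr_ge0.
  by rewrite mulrAC -mulrA; lra.
pose n := (Num.trunc (2 * M / d ^+ 2 / (e / 2))).+1.
pose h k : R := f (k%:R / n%:R).
have n0 : 0 < n%:R :> R by rewrite ltr0n.
have nM : 2 * M / d ^+ 2 / n%:R <= e / 2.
  rewrite ler_pdivrMr// [leRHS]mulrC -ler_pdivrMr//.
  by rewrite ltW// truncnS_gt.
exists (de_casteljau n h 0) => t t01; have /andP[t0 t1] := t01.
set b := 2 * M / d ^+ 2 in dev nM.
have b0 : 0 <= b by apply: divr_ge0; [exact: mulr_ge0|exact: sqr_ge0].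
have hb k : `|f t - h k| <= e / 2 + b / n%:R ^+ 2 * (k%:R - n%:R * t) ^+ 2.
  apply: le_trans (dev _ _ t01) _; rewrite lerD2l -[leRHS]mulrA ler_wpM2l//.
  rewrite (_ : _ - t = (k%:R - n%:R * t) / n%:R); last by field; rewrite gt_eqF.
  by rewrite exprMn exprVn mulrC.
pose q := b / n%:R ^+ 2 * ((0%:R - n%:R * t + n%:R * t) ^+ 2 + n%:R * (t * (1 - t))).
have res : e / 2 + q <= e.
  rewrite /q.
  rewrite addrNK expr0n/= add0r [leRHS]splitr lerD2l.
  apply: le_trans nM.
  rewrite (_ : _ * _ = b / n%:R * (t * (1 - t))); last by field; rewrite gt_eqF.
  by rewrite ler_piMr ?divr_ge0 ?(ltW n0)//; nra.
rewrite ler_distlC; apply/andP; split.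
  have : (de_casteljau n (fun k => (f t - e / 2) + - (b / n%:R ^+ 2) * (k%:R - n%:R * t) ^+ 2) 0).[t] <= (de_casteljau n h 0).[t].
    apply: de_casteljau_le => // k; have := hb k; rewrite ler_distlC => /andP[]; lra.
  by rewrite de_casteljau_quadratic (mulNr (b / _)) -/q; lra.
have : (de_casteljau n h 0).[t] <= (de_casteljau n (fun k => (f t + e / 2) + (b / n%:R ^+ 2) * (k%:R - n%:R * t) ^+ 2) 0).[t].
  apply: de_casteljau_le => // k; have := hb k; rewrite ler_distlC => /andP[]; lra.
by rewrite de_casteljau_quadratic -/q; lra.
Qed.

End DeCasteljau.

(** * Approximation by polynomials in a sine *)

Section SinePolynomials.
Context {R : realType}.

Definition unit_sine (L x : R) := (1 + sin (x / L)) / 2.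

Lemma unit_sine01 L x : 0 <= unit_sine L x <= 1.
Proof. by rewrite /unit_sine; have := sin_geN1 (x / L); have := sin_le1 (x / L); lra. Qed.

(** The truncation of [u] to [- c, c], in a form that is visibly continuous. *)
Let clamp (c u : R) := (`|u + c| - `|u - c|) / 2.

Let clamp_id c u : `|u| <= c -> clamp c u = u.
Proof.
rewrite ler_norml /clamp => /andP[u1 u2].
by rewrite ger0_norm ?ler0_norm; [field|lra|lra].
Qed.

Let clamp_le c u : 0 <= c -> `|clamp c u| <= c.
Proof.
move=> c0; rewrite /clamp ler_norml.
have h1 := ler_distD (u + c) 0 (u - c); have h2 := ler_normD (u + c) (- (u - c)); 
have h3 := ler_normD (u - c) (c + c); have h4 := ler_normD (u + c) (- (c + c)).
have e1 : (u - c) + (c + c) = u + c by ring.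
have e2 : (u + c) - (c + c) = u - c by ring.
rewrite e1 (ger0_norm (addr_ge0 c0 c0)) in h3; rewrite e2 normrN (ger0_norm (addr_ge0 c0 c0)) in h4.
by apply/andP; split; lra.
Qed.

(** On [- K, K] the map [x |-> sin (x / 2K)] is injective with an inverse
    continuous up to the boundary, so a continuous function is there a
    continuous function of the sine; Weierstrass makes it a polynomial, which
    stays bounded off the interval because the sine does. *)
Lemma sine_polynomial_approximation (f : R -> R) (M K e : R) : continuous f ->
  (forall x, `|f x| <= M) -> 0 < K -> 0 < e ->
  exists p : {poly R}, forall x, (`|x| <= K -> `|f x - p.[unit_sine (2 * K) x]| <= e) /\
    `|p.[unit_sine (2 * K) x]| <= M + e.
Proof.
move=> cf fM K0 e0; pose c := sin (2^-1 : R).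
have pi2 := pihalf_ge1 R.
have h01 : 2^-1 \in `[- (pi / 2), pi / 2 : R] by rewrite in_itv/=; apply/andP; split; lra.
have c0 : 0 < c by apply: sin2_gt0; apply/andP; split; lra.
have c1 : c < 1.
  by rewrite /c -[ltRHS]sin_pihalf ltr_sin//; [lra|rewrite in_itv/=; apply/andP; split; lra].
pose g (t : R) : R := f (2 * K * asin (clamp c (2 * t - 1))).
have cg : continuous g.
  have c1' : continuous (fun t : R => clamp c (2 * t - 1)).
    move=> t; apply: cvgM; last exact: cvg_cst.
    by apply: cvgB; apply: cvg_norm; first apply: cvgD; try exact: cvg_cst;
      apply: cvgB; try exact: cvg_cst; try (apply: cvgB; try exact: cvg_cst); apply: cvgM; try exact: cvg_cst; exact: cvg_id.
  have c2 : continuous (fun t : R => asin (clamp c (2 * t - 1))).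
    move=> t; apply: (@continuous_comp _ _ _ (fun t : R => clamp c (2 * t - 1)) asin); first exact: c1'.
    apply: continuous_asin; rewrite -ltr_norml.
    by rewrite (le_lt_trans (clamp_le _ (ltW c0))).
  have c3 : continuous (fun t : R => 2 * K * asin (clamp c (2 * t - 1))).
    by move=> t; apply: cvgM; [exact: cvg_cst|exact: c2].
  by move=> t; exact: (@continuous_comp _ _ _ (fun t : R => 2 * K * asin (clamp c (2 * t - 1))) f t (c3 t) (cf _)).
have [p gp] := weierstrass_approximation cg (fun t => fM _) e0.
exists p => x; have gpx := gp _ (unit_sine01 (2 * K) x); split; last first.
  rewrite -[p.[_]](subrK (g (unit_sine (2 * K) x))).
  by rewrite (le_trans (ler_normD _ _))// addrC lerD ?fM// distrC.
move=> xK; suff <- : g (unit_sine (2 * K) x) = f x by [].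
rewrite /g /unit_sine (_ : 2 * _ - 1 = sin (x / (2 * K))); last by field.
have xK2 : `|x / (2 * K)| <= 2^-1.
  rewrite normrM normfV (ger0_norm (ltW (mulr_gt0 _ K0)))// ler_pdivrMr ?mulr_gt0//.
  by lra.
have xKi : x / (2 * K) \in `[- (pi / 2), pi / 2].
  by rewrite in_itv/= -ler_norml (le_trans xK2)//; lra.
have sc : `|sin (x / (2 * K))| <= c.
  move: xK2; rewrite !ler_norml /c -sinN => /andP[x1 x2].
  have h02 : - 2^-1 \in `[- (pi / 2), pi / 2 : R] by rewrite in_itv/=; apply/andP; split; lra.
  by apply/andP; split; rewrite leNgt ltr_sin// -leNgt.
by rewrite clamp_id// sinK//; congr f; field; rewrite gt_eqF.
Qed.

End SinePolynomials.

(** * From cosines to products of test functions *)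

Section Tails.
Context {R : realType} {d} {T : measurableType d} (P : probability T R).

Lemma bounded_rv_tail (f : T -> R) (K : R) : measurable_fun setT f ->
  bounded_rv (fun w => (K < `|f w|)%R%:R : R).
Proof.
move=> mf; apply: bounded_rv_bool; apply: measurable_fun_ltr => //.
exact: measurableT_comp.
Qed.

Lemma markov_sqr (f : T -> R) (K : R) : measurable_fun setT f ->
  integrableR P (fun w => f w ^+ 2) -> 0 < K ->
  Ex P (fun w => (K < `|f w|)%R%:R) <= Ex P (fun w => f w ^+ 2) / K ^+ 2.
Proof.
move=> mf f2 K0; rewrite [leRHS]mulrC -ExZ//; apply: le_Ex => //.
- exact/bounded_rv_integrable/bounded_rv_tail.
- exact: integrableRZ.
move=> w; rewrite mulrC; case: ltP => /= Kf; last by rewrite divr_ge0 ?sqr_ge0.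
rewrite ler_pdivlMr ?exprn_gt0// mul1r -(real_normK (num_real (f w))).
by rewrite lerXn2r ?nnegrE// ltW.
Qed.

Lemma cvg_tail (f : T -> R) : measurable_fun setT f ->
  Ex P (fun w => (n%:R < `|f w|)%R%:R : R) @[n --> \oo] --> (0 : R).
Proof.
move=> mf; rewrite (_ : 0 = Ex P (fun=> 0)); last by rewrite Ex_cst.
apply: (@dominated_Rintegral _ _ _ _ _ _ (fun=> 1)) => //.
- by move=> n; case: (bounded_rv_tail n%:R mf).
- exact/bounded_rv_integrable/bounded_rv_cst.
- by move=> n w; case: (_ < _); rewrite ?normr1 ?normr0.
move=> w; apply: cvg_near_cst; near=> n; rewrite ltNge.
suff -> : `|f w| <= n%:R by [].
by near: n; exact: nbhs_infty_ger.
Unshelve. all: by end_near. Qed.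

End Tails.

Section JointConvergence.
Context {R : realType} {d d'} {T : measurableType d} {T' : measurableType d'}.
Context (P : probability T R) (Q : probability T' R).
Context (U V : nat -> T -> R) (U0 V0 : T' -> R).
Hypotheses (mU : forall n, measurable_fun setT (U n)) (mV : forall n, measurable_fun setT (V n)).
Hypotheses (mU0 : measurable_fun setT U0) (mV0 : measurable_fun setT V0).
Hypothesis cvg_cos : forall s t th : R,
  Ex P (fun w => cos (s * U n w + t * V n w + th)) @[n --> \oo] -->
  Ex Q (fun w => cos (s * U0 w + t * V0 w + th)).

Let bi {e} {S : measurableType e} (O : probability S R) (f : S -> R) := @bounded_rv_integrable _ _ _ O f.

Let bounded (f : R -> R -> R) := (forall n, bounded_rv (fun w => f (U n w) (V n w))) /\
  bounded_rv (fun w => f (U0 w) (V0 w)).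

Let boundedM f g : bounded f -> bounded g -> bounded (fun u v => f u v * g u v).
Proof. by move=> [bf bf0] [bg bg0]; split => [n|]; exact: bounded_rvM. Qed.

Let bounded_cos s t th : bounded (fun u v => cos (s * u + t * v + th)).
Proof.
by split => [n|]; apply: bounded_rv_cos; do 2 apply: measurable_funD => //; exact: measurable_funM.
Qed.

Let cvg_law (f : R -> R -> R) := Ex P (fun w => f (U n w) (V n w)) @[n --> \oo] -->
  Ex Q (fun w => f (U0 w) (V0 w)).

Let cvg_lawD f g : bounded f -> bounded g -> cvg_law f -> cvg_law g ->
  cvg_law (fun u v => f u v + g u v).
Proof.
move=> [bf bf0] [bg bg0] cf cg; rewrite /cvg_law ExD; try exact: bi.
under eq_fun do rewrite (ExD (bi P (bf _)) (bi P (bg _))).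
exact: cvgnD cf cg.
Qed.

Let cvg_lawZ c f : bounded f -> cvg_law f -> cvg_law (fun u v => c * f u v).
Proof.
move=> [bf bf0] cf; rewrite /cvg_law ExZ; last exact: bi.
under eq_fun do rewrite (ExZ _ (bi P (bf _))).
exact: cvgnM (@cvgn_cst R c) cf.
Qed.

(** Test functions whose expectation converges even after multiplication by
    any sinusoid; the extra factor makes the class stable under products. *)
Definition trig_stable (f : R -> R -> R) := bounded f /\
  forall s t th : R, cvg_law (fun u v => f u v * cos (s * u + t * v + th)).

Lemma trig_stable_cst c : trig_stable (fun _ _ => c).
Proof.
split=> [|s t th]; first by split=> [n|]; exact: bounded_rv_cst.
by apply: cvg_lawZ => //; exact: cvg_cos.
Qed.

Lemma trig_stableD f g : trig_stable f -> trig_stable g ->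
  trig_stable (fun u v => f u v + g u v).
Proof.
move=> [bf cf] [bg cg]; split=> [|s t th].
  by split=> [n|]; apply: bounded_rvD; case: bf bg => ? ? [].
rewrite (_ : (fun u v => _) = fun u v => f u v * cos (s * u + t * v + th) +
    g u v * cos (s * u + t * v + th)); first by apply: cvg_lawD => //; exact: boundedM.
by apply/funext => u; apply/funext => v; rewrite mulrDl.
Qed.

Lemma trig_stableZ c f : trig_stable f -> trig_stable (fun u v => c * f u v).
Proof.
move=> [bf cf]; split=> [|s t th]; first by apply: boundedM => //; case: (trig_stable_cst c).
rewrite (_ : (fun u v => _) = fun u v => c * (f u v * cos (s * u + t * v + th))).
  by apply: cvg_lawZ => //; exact: boundedM.
by apply/funext => u; apply/funext => v; rewrite mulrA.
Qed.

(** A product of two cosines is the half sum of two cosines. *)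
Lemma trig_stableM_cos f (s t th : R) : trig_stable f ->
  trig_stable (fun u v => f u v * cos (s * u + t * v + th)).
Proof.
move=> [bf cf]; split=> [|s' t' th']; first exact: boundedM.
rewrite (_ : (fun u v => _) = fun u v =>
    2^-1 * (f u v * cos ((s + s') * u + (t + t') * v + (th + th')) +
            f u v * cos ((s - s') * u + (t - t') * v + (th - th')))).
  have b x y z : bounded (fun u v => f u v * cos (x * u + y * v + z)) by exact: boundedM.
  apply: cvg_lawZ; last exact: cvg_lawD.
  by split=> [n|]; apply: bounded_rvD; case: (b (s + s') (t + t') (th + th'));
    case: (b (s - s') (t - t') (th - th')).
apply/funext => u; apply/funext => v.
rewrite (_ : (s + s') * u + _ + _ = (s * u + t * v + th) + (s' * u + t' * v + th')); last by ring.
rewrite (_ : (s - s') * u + _ + _ = (s * u + t * v + th) - (s' * u + t' * v + th')); last by ring.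
by move: (s * u + _ + _) (s' * u + _ + _) => A B; rewrite cosD cosB; field.
Qed.

Lemma unit_sineE (L x : R) : unit_sine L x = 2^-1 + 2^-1 * cos (L^-1 * x + - (pi / 2)).
Proof. by rewrite cosBpihalf /unit_sine mulrC mulrDr mulr1 (mulrC x). Qed.

Lemma trig_stableM_poly f (a b L : R) (p : {poly R}) : trig_stable f ->
  trig_stable (fun u v => f u v * p.[unit_sine L (a * u + b * v)]).
Proof.
move=> tf; elim/poly_ind: p => [|p c IH].
  rewrite (_ : (fun u v => _) = (fun _ _ => 0)); first exact: trig_stable_cst.
  by apply/funext => u; apply/funext => v; rewrite horner0 mulr0.
rewrite (_ : (fun u v => _) = (fun u v =>
  (2^-1 * (f u v * p.[unit_sine L (a * u + b * v)]) +
   2^-1 * (f u v * p.[unit_sine L (a * u + b * v)] *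
     cos (L^-1 * a * u + L^-1 * b * v + - (pi / 2)))) + c * f u v)).
  apply: trig_stableD; last exact: trig_stableZ.
  apply: trig_stableD; first exact: trig_stableZ.
  by apply: trig_stableZ; exact: trig_stableM_cos.
apply/funext => u; apply/funext => v.
rewrite hornerMXaddC [X in p.[_] * X]unit_sineE.
by rewrite (mulrDr L^-1) !(mulrA L^-1); ring.
Qed.

Lemma trig_stable_cvg f : trig_stable f ->
  Ex P (fun w => f (U n w) (V n w)) @[n --> \oo] --> Ex Q (fun w => f (U0 w) (V0 w)).
Proof.
move=> [_ /(_ 0 0 0)]; rewrite /cvg_law.
have e1 (x u v : R) : x * cos (0 * u + 0 * v + 0) = x by rewrite !mul0r !addr0 cos0 mulr1.
under eq_fun do under eq_Rintegral do rewrite e1.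
by under [X in _ --> X -> _]eq_Rintegral do rewrite e1.
Qed.

Context (C : R).
Hypotheses (U2 : forall n, integrableR P (fun w => U n w ^+ 2))
           (V2 : forall n, integrableR P (fun w => V n w ^+ 2)).
Hypotheses (UC : forall n, Ex P (fun w => U n w ^+ 2) <= C)
           (VC : forall n, Ex P (fun w => V n w ^+ 2) <= C).

Let C0 : 0 <= C.
Proof. by apply: le_trans (UC 0); apply: Rintegral_ge0 => w _; exact: sqr_ge0. Qed.

(** Second moments make both families tight, so [f] and [g] only need to be
    approximated by polynomials in a sine on a large interval. *)
Lemma cvg_Ex_product (f g : R -> R) (M : R) : continuous f -> continuous g ->
  (forall x, `|f x| <= M) -> (forall x, `|g x| <= M) ->
  Ex P (fun w => f (U n w) * g (V n w)) @[n --> \oo] --> Ex Q (fun w => f (U0 w) * g (V0 w)).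
Proof.
move=> cf cg fM gM; have M0 : 0 <= M := le_trans (normr_ge0 _) (fM 0).
have mf : measurable_fun setT f by exact: continuous_measurable_fun.
have mg : measurable_fun setT g by exact: continuous_measurable_fun.
apply/cvgrPdist_le => e e0.
pose D := (2 * M + 1) + 4 * (M + 1) ^+ 2.
have D0 : 0 < D by rewrite /D; nra.
pose h := Num.min 1 (e / (2 * D + 1)).
have h0 : 0 < h by rewrite lt_min ltr01/= divr_gt0//; lra.
have h1 : h <= 1 by rewrite ge_min lexx.
have he : 2 * (h * D) + h <= e.
  have : h <= e / (2 * D + 1) by rewrite ge_min lexx orbT.
  by rewrite ler_pdivlMr; lra.
have tU : \forall K \near \oo, Ex Q (fun w => (K%:R < `|U0 w|)%R%:R) <= h.
  exact: (cvgr_le 0 (cvg_tail Q mU0)).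
have tV : \forall K \near \oo, Ex Q (fun w => (K%:R < `|V0 w|)%R%:R) <= h.
  exact: (cvgr_le 0 (cvg_tail Q mV0)).
have [K [K0 KU KV KC]] : exists K : nat, [/\ 0 < K%:R :> R,
    Ex Q (fun w => (K%:R < `|U0 w|)%R%:R) <= h,
    Ex Q (fun w => (K%:R < `|V0 w|)%R%:R) <= h & C / K%:R ^+ 2 <= h].
  near \oo => K; exists K; split; [|by near: K|by near: K|].
    by rewrite ltr0n; near: K; exact: nbhs_infty_gt.
  have K1 : 1 <= K%:R :> R by rewrite ler1n; near: K; exact: nbhs_infty_gt.
  have K2 : C / h <= K%:R by near: K; exact: nbhs_infty_ger.
  rewrite ler_pdivrMr ?exprn_gt0 ?(lt_le_trans ltr01 K1)//.
  rewrite ler_pdivrMr// in K2; rewrite (le_trans K2)// mulrC ler_wpM2l ?(ltW h0)//.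
  by rewrite expr2 ler_peMl// (le_trans ler01).
have [p hp] := sine_polynomial_approximation cf fM K0 h0.
have [r hr] := sine_polynomial_approximation cg gM K0 h0.
pose L := 2 * K%:R : R.
pose psi u v := p.[unit_sine L u] * r.[unit_sine L v].
have tpsi : trig_stable psi.
  rewrite (_ : psi = fun u v => 1 * p.[unit_sine L (1 * u + 0 * v)] * r.[unit_sine L (0 * u + 1 * v)]).
    by do 2 apply: trig_stableM_poly; exact: trig_stable_cst.
  by apply/funext => u; apply/funext => v; rewrite !mul0r !mul1r addr0 add0r.
have err u v : `|f u * g v - psi u v| <= h * (2 * M + 1) +
    2 * (M + 1) ^+ 2 * ((K%:R < `|u|)%R%:R + (K%:R < `|v|)%R%:R).
  have [pu1 pu2] := hp u; have [rv1 rv2] := hr v.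
  have hM : 0 <= h * (2 * M + 1) by rewrite mulr_ge0 ?(ltW h0)//; lra.
  have M2 : 0 <= 2 * (M + 1) ^+ 2 by rewrite mulr_ge0// sqr_ge0.
  have far : `|f u * g v - psi u v| <= 2 * (M + 1) ^+ 2.
    rewrite (le_trans (ler_normB _ _))// !normrM.
    have a1 : `|f u| * `|g v| <= M * M by rewrite ler_pM.
    have a2 : `|p.[unit_sine L u]| * `|r.[unit_sine L v]| <= (M + h) * (M + h) by rewrite ler_pM.
    have a3 : (M + h) * (M + h) <= (M + 1) * (M + 1) by rewrite ler_pM ?lerD2l ?addr_ge0 ?(ltW h0).
    nra.
  have [Ku|uK] := ltP K%:R `|u|; first by case: (_ < _) => /=; lra.
  have [Kv|vK] := ltP K%:R `|v|; first by rewrite /=; lra.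
  rewrite addr0 mulr0 addr0 /psi.
  rewrite (_ : _ - _ = (f u - p.[unit_sine L u]) * g v + p.[unit_sine L u] * (g v - r.[unit_sine L v])); last by ring.
  rewrite (le_trans (ler_normD _ _))// !normrM.
  have a1 : `|f u - p.[unit_sine L u]| * `|g v| <= h * M by rewrite ler_pM// pu1.
  have a2 : `|p.[unit_sine L u]| * `|g v - r.[unit_sine L v]| <= (M + h) * h by rewrite ler_pM// rv1.
  nra.
have errP e' (S : measurableType e') (O : probability S R) (A B : S -> R) :
    measurable_fun setT A -> measurable_fun setT B ->
    bounded_rv (fun w => psi (A w) (B w)) ->
    Ex O (fun w => (K%:R < `|A w|)%R%:R) <= h -> Ex O (fun w => (K%:R < `|B w|)%R%:R) <= h ->
    `|Ex O (fun w => f (A w) * g (B w)) - Ex O (fun w => psi (A w) (B w))| <= h * D.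
  move=> mA mB bpsi hA hB.
  have bfA : bounded_rv (fun w => f (A w)) by apply: bounded_rv_comp => //; exists M.
  have bgB : bounded_rv (fun w => g (B w)) by apply: bounded_rv_comp => //; exists M.
  have btA := bounded_rv_tail K%:R mA; have btB := bounded_rv_tail K%:R mB.
  have bh : bounded_rv (fun w => h * (2 * M + 1) +
      2 * (M + 1) ^+ 2 * ((K%:R < `|A w|)%R%:R + (K%:R < `|B w|)%R%:R)).
    apply: bounded_rvD; first exact: bounded_rv_cst.
    by apply: bounded_rvM; [exact: bounded_rv_cst|exact: bounded_rvD].
  apply: le_trans (normr_ExB _ _ (bounded_rv_integrable O bh) (fun w => err _ _)) _.
  - by apply: bi; exact: bounded_rvM.
  - exact: bi.
  rewrite ExD; last 2 first.
  - by apply: bi; exact: bounded_rv_cst.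
  - by apply: bi; apply: bounded_rvM; [exact: bounded_rv_cst|exact: bounded_rvD].
  rewrite ExZ; last by apply: bi; exact: bounded_rvD.
  rewrite ExD; try exact: bi.
  rewrite Ex_cst /D [leRHS]mulrDr lerD2l [leRHS](_ : _ = 2 * (M + 1) ^+ 2 * (h + h)); last by ring.
  by apply: ler_wpM2l; [apply: mulr_ge0 => //; exact: sqr_ge0|exact: lerD].
have cpsi : \forall n \near \oo, `|Ex Q (fun w => psi (U0 w) (V0 w)) - Ex P (fun w => psi (U n w) (V n w))| <= h.
  by have /cvgrPdist_le := trig_stable_cvg tpsi; exact.
have [[bpsi bpsi0] _] := tpsi.
near=> n; have cn : `|Ex Q (fun w => psi (U0 w) (V0 w)) - Ex P (fun w => psi (U n w) (V n w))| <= h by near: n.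
have eQ := errP _ _ Q U0 V0 mU0 mV0 bpsi0 KU KV.
have eP : `|Ex P (fun w => f (U n w) * g (V n w)) - Ex P (fun w => psi (U n w) (V n w))| <= h * D.
  apply: errP => //.
    by apply: le_trans (markov_sqr _ _ K0) (le_trans _ KC) => //; rewrite ler_wpM2r// invr_ge0 sqr_ge0.
  by apply: le_trans (markov_sqr _ _ K0) (le_trans _ KC) => //; rewrite ler_wpM2r// invr_ge0 sqr_ge0.
by apply: le_trans (ler_dist_chain eQ eP cn) (le_trans _ he); rewrite mulr_natl mulr2n.
Unshelve. all: by end_near. Qed.

End JointConvergence.

(** * Minimizers of the empirical score *)

Section Estimator.
Context {R : realType}.

Lemma derive1_gt0_increasing (g : R -> R) : (forall x, derivable g x 1) ->
  (forall x, 0 < derive1 g x) -> forall x y, x < y -> g x < g y.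
Proof.
move=> dg g0 x y xy.
have [z _ gE] : exists2 z, z \in `]x, y[%R & g y - g x = derive1 g z * (y - x).
  apply: MVT xy _ _ => [z _|]; first by rewrite derive1E; exact: derivableP.
  by apply: derivable_within_continuous => z _.
by rewrite -subr_gt0 gE mulr_gt0 ?subr_gt0.
Qed.

Section Potential.
Context (G cG : R -> R) (hcG : continuously_differentiable 3 cG).
Hypothesis hG : forall x : R, derive1 cG x = G x.
Hypothesis hG' : forall x : R, 0 < derive1 G x.
Hypothesis hGlim : G x @[x --> -oo%R] --> (0 : R).

Let dcG x : derivable cG x 1.
Proof. by case: hcG => /(_ 0%N isT x). Qed.

Let dG x : derivable G x 1.
Proof.
have -> : G = derive1n 1 cG by apply/funext => y; rewrite /= hG.
by case: hcG => /(_ 1%N isT x).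
Qed.

Let G_incr x y : x < y -> G x < G y.
Proof. exact: derive1_gt0_increasing. Qed.

(** [G] increases from its limit [0] at minus infinity. *)
Lemma potential_gt0 x : 0 < G x.
Proof.
apply: le_lt_trans (G_incr (_ : x - 1 < x)); last by lra.
rewrite leNgt; apply/negP => Gx.
have near_gt : \forall y \near -oo%R, G (x - 1) < G y by exact: (cvgr_gt 0 hGlim).
near (-oo%R : set_system R) => y.
have y1 : y < x - 1 by near: y; apply: nbhs_ninfty_lt; exact: num_real.
have y2 : G (x - 1) < G y by near: y.
by have := lt_trans y2 (G_incr y1); rewrite ltxx.
Unshelve. all: by end_near. Qed.

(** Strict convexity of [cG], by the mean value theorem. *)
Lemma potential_tangent x y : x != y -> cG x + G x * (y - x) < cG y.
Proof.
move=> xy; have dd z : is_derive z (1 : R) cG (G z).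
  by rewrite -hG derive1E; exact: derivableP.
have cc (i : interval R) : {within [set` i], continuous cG}.
  by apply: derivable_within_continuous => z _.
case: (ltgtP x y) xy => // [xy|yx] _.
  have [z] := MVT xy (fun z _ => dd z) (cc _).
  rewrite in_itv/= => /andP[xz _] E.
  by rewrite -ltrBrDl E ltr_pM2r ?subr_gt0// G_incr.
have [z] := MVT yx (fun z _ => dd z) (cc _).
rewrite in_itv/= => /andP[_ zx] E.
have : G z * (x - y) < G x * (x - y) by rewrite ltr_pM2r ?subr_gt0// G_incr.
by rewrite -E; lra.
Qed.

Context (alpha : R) (alpha0 : 0 < alpha) (n : nat) (n0 : (0 < n)%N) (X : nat -> R).

Definition count_le t : R := \sum_(i < n) (X i <= t)%R%:R.
Definition shortfall_sum t : R := \sum_(i < n) (X i <= t)%R%:R * (t - X i).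

(** The sum over the sample of [(1_{X i <= t} - alpha) * (t - X i)], whose
    minimizers are the empirical quantiles. *)
Let check_loss t := shortfall_sum t - alpha * (n%:R * t - \sum_(i < n) X i).

(** [x1] enters through the check loss only, with a positive factor. *)
Lemma sum_score x1 x2 : \sum_(i < n) score alpha G cG x1 x2 (X i) =
  (1 + G x2 / alpha) * check_loss x1 + G x2 * (n%:R * x2 - \sum_(i < n) X i) - n%:R * cG x2.
Proof.
have -> : check_loss x1 = \sum_(i < n) ((X i <= x1)%R%:R - alpha) * (x1 - X i).
  rewrite /check_loss /shortfall_sum.
  have -> : n%:R * x1 - \sum_(i < n) X i = \sum_(i < n) (x1 - X i).
    by rewrite sumrB sumr_const card_ord mulr_natl.
  by rewrite mulr_sumr -sumrB; apply: eq_bigr => i _; rewrite mulrBl.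
have -> : n%:R * x2 - \sum_(i < n) X i = \sum_(i < n) (x2 - X i).
  by rewrite sumrB sumr_const card_ord mulr_natl.
have -> : n%:R * cG x2 = \sum_(i < n) cG x2 by rewrite sumr_const card_ord mulr_natl.
rewrite !mulr_sumr -big_split -sumrB/=; apply: eq_bigr => i _.
by rewrite /score; ring.
Qed.

(** [count_le s] is a subgradient at [s] of a convex function. *)
Lemma shortfall_sum_tangent s t : shortfall_sum s + count_le s * (t - s) <= shortfall_sum t.
Proof.
rewrite /shortfall_sum /count_le mulr_suml -big_split/=; apply: ler_sum => i _.
by have [Xs|Xs] := leP (X i) s; have [Xt|Xt] := leP (X i) t; rewrite /= ?mul1r ?mul0r ?addr0; lra.
Qed.

(** No observation lies strictly between [s] and a suitable [s'], where the
    empirical distribution function is constant. *)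
Lemma shortfall_sum_flat s : exists2 s', s < s' &
  shortfall_sum s' = shortfall_sum s + count_le s * (s' - s) /\
  forall t, shortfall_sum s' + count_le s * (t - s') <= shortfall_sum t.
Proof.
have [s' ss' gap] : exists2 s', s < s' & forall i : 'I_n, X i <= s \/ s' <= X i.
  exists (\big[Num.min/s + 1]_(i < n | s < X i) X i).
    elim/big_ind: _ => // [|x y]; first by lra.
    by rewrite lt_min => -> ->.
  move=> i; have [|sX] := leP (X i) s; first by left.
  by right; rewrite (bigD1 i)//= ge_min lexx.
exists s' => //; split=> [|t].
  rewrite /shortfall_sum /count_le mulr_suml -big_split/=; apply: eq_bigr => i _.
  by have [Xs|Xs] := gap i; have [?|?] := leP (X i) s; have [?|?] := leP (X i) s'; rewrite /= ?mul1r ?mul0r ?addr0; lra.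
rewrite /shortfall_sum /count_le mulr_suml -big_split/=; apply: ler_sum => i _.
by have [Xs|Xs] := gap i; have [?|?] := leP (X i) s; have [?|?] := leP (X i) s'; have [?|?] := leP (X i) t; rewrite /= ?mul1r ?mul0r ?addr0; lra.
Qed.

Context (qhat eshat : R).
Hypothesis hmin : argmin (fun z : R * R => \sum_(i < n) score alpha G cG z.1 z.2 (X i)) (qhat, eshat).

Let check_loss_min t : check_loss qhat <= check_loss t.
Proof.
have := hmin (t, eshat); rewrite /= !sum_score lerD2r lerD2r ler_pM2l//.
by rewrite addr_gt0// divr_gt0// potential_gt0.
Qed.

Lemma argmin_quantile_le t : alpha * n%:R < count_le t -> qhat <= t.
Proof.
move=> Nt; rewrite leNgt; apply/negP => tq.
have := check_loss_min t; rewrite /check_loss; have := shortfall_sum_tangent t qhat.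
have : 0 < (count_le t - alpha * n%:R) * (qhat - t) by rewrite mulr_gt0 ?subr_gt0.
by move=> *; lra.
Qed.

(** As [count_le t] is the right derivative of [shortfall_sum] at [t], the
    minimality of [qhat] is tested at a point [s] of the linear piece to the right
    of [t]. *)
Lemma argmin_quantile_gt t : count_le t < alpha * n%:R -> t < qhat.
Proof.
move=> Nt; rewrite ltNge; apply/negP => qt.
have [s ts [_ /(_ qhat) h]] := shortfall_sum_flat t.
have := check_loss_min s; rewrite /check_loss.
have : 0 < (alpha * n%:R - count_le t) * (s - qhat).
  by rewrite mulr_gt0 ?subr_gt0// (le_lt_trans qt).
by move: h => *; lra.
Qed.

Let n_gt0 : 0 < n%:R :> R.
Proof. by rewrite ltr0n. Qed.

Definition shortfall_functional t := t - shortfall_sum t / (alpha * n%:R).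

(** At [x1 = qhat] the sum of the scores is, up to a constant, [n] times the
    Bregman divergence of [cG] from [x2] to [shortfall_functional qhat]. *)
Lemma argmin_shortfall : eshat = shortfall_functional qhat.
Proof.
apply/eqP/negPn/negP => ne.
have an0 : 0 < alpha * n%:R by rewrite mulr_gt0.
have := hmin (qhat, shortfall_functional qhat); rewrite /= !sum_score.
set c := shortfall_functional qhat in ne *.
have lossE : check_loss qhat = alpha * (\sum_(i < n) X i - n%:R * c).
  by rewrite /check_loss /c /shortfall_functional; field; rewrite !gt_eqF.
rewrite lossE.
have := potential_tangent ne; have a1 : alpha != 0 by rewrite gt_eqF.
have -> : (1 + G eshat / alpha) * (alpha * (\sum_(i < n) X i - n%:R * c)) +
    G eshat * (n%:R * eshat - \sum_(i < n) X i) - n%:R * cG eshat =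
  alpha * (\sum_(i < n) X i - n%:R * c) - n%:R * (cG eshat + G eshat * (c - eshat)).
  by field.
have -> : (1 + G c / alpha) * (alpha * (\sum_(i < n) X i - n%:R * c)) +
    G c * (n%:R * c - \sum_(i < n) X i) - n%:R * cG c =
  alpha * (\sum_(i < n) X i - n%:R * c) - n%:R * cG c by field.
by move=> lt1; rewrite lerD2l lerN2 ler_pM2l// leNgt lt1.
Qed.

(** [shortfall_functional] is a constant minus [check_loss / (alpha * n)]. *)
Lemma shortfall_functional_max t : 0 <= shortfall_functional qhat - shortfall_functional t.
Proof.
have an0 : 0 < alpha * n%:R by rewrite mulr_gt0.
have := check_loss_min t; rewrite /check_loss => h.
rewrite /shortfall_functional -(pmulr_rge0 _ an0).
have -> : alpha * n%:R * (qhat - shortfall_sum qhat / (alpha * n%:R) - (t - shortfall_sum t / (alpha * n%:R))) =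
    (alpha * n%:R) * (qhat - t) - (shortfall_sum qhat - shortfall_sum t).
  by field; rewrite !gt_eqF.
by move: h => *; lra.
Qed.

(** The subgradient at [t] controls the increment from [t] to [qhat]. With
    [shortfall_functional_max] the increment is a product of two deviations,
    hence of second order. *)
Lemma shortfall_functional_flat t :
  shortfall_functional qhat - shortfall_functional t <=
  `|qhat - t| * (`|alpha * n%:R - count_le t| / (alpha * n%:R)).
Proof.
have an0 : 0 < alpha * n%:R by rewrite mulr_gt0.
rewrite mulrA ler_pdivlMr// -normrM; apply: le_trans (ler_norm _).
have := shortfall_sum_tangent t qhat.
rewrite /shortfall_functional (_ : _ * (alpha * n%:R) = (alpha * n%:R) * (qhat - t) - (shortfall_sum qhat - shortfall_sum t)); last first.
  by field; rewrite !gt_eqF.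
by move=> *; lra.
Qed.

End Potential.
End Estimator.

(** * Quantiles and the expected shortfall *)

Section Quantile.
Context {R : realType} {d} {T : measurableType d} (P : probability T R).
Context (Y : {RV P >-> R}) (F : R -> R) (hF : forall x : R, cdf Y x = (F x)%:E).

Lemma cdf_nd x y : x <= y -> F x <= F y.
Proof. by move=> xy; rewrite -lee_fin -!hF; exact: cdf_nondecreasing. Qed.

Lemma cdf_01 x : 0 <= F x <= 1.
Proof. by rewrite -!lee_fin -hF cdf_ge0 cdf_le1. Qed.

Let FE : (fun y => (F y)%:E) = cdf Y.
Proof. by apply/funext => y; rewrite hF. Qed.

Lemma cdf_rc x : F y @[y --> x^'+] --> F x.
Proof.
have H : (F y)%:E @[y --> x^'+] --> (F x)%:E by rewrite FE -hF; exact: cdf_right_continuous.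
exact: fine_cvg H.
Qed.

Lemma cdf_cvgNy : F y @[y --> -oo%R] --> (0 : R).
Proof.
have H : (F y)%:E @[y --> -oo%R] --> (0%R)%:E by rewrite FE; exact: cvg_cdfNy0.
exact: fine_cvg H.
Qed.

Lemma cdf_cvgy : F y @[y --> +oo%R] --> (1 : R).
Proof.
have H : (F y)%:E @[y --> +oo%R] --> (1%R)%:E by rewrite FE; exact: cvg_cdfy1.
exact: fine_cvg H.
Qed.

(** As [F] is right continuous, the infimum in [quantile] is attained. *)
Lemma quantile_le u x : 0 < u < 1 -> (quantile F u <= x) = (u <= F x).
Proof.
move=> /andP[u0 u1].
have lbF : has_lbound [set x | u <= F x].
  have : \forall y \near -oo%R, F y < u by exact: (cvgr_lt 0 cdf_cvgNy).
  move=> [M [_ hM]]; exists (M - 1) => y /= uy; rewrite leNgt; apply/negP => yM.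
  have yM' : y < M by lra.
  by have /= := hM y yM'; rewrite ltNge uy.
have neF : [set x | u <= F x] !=set0.
  have : \forall y \near +oo%R, u < F y by exact: (cvgr_gt 1 cdf_cvgy).
  by move=> [M [_ hM]]; exists (M + 1); apply/ltW/hM; lra.
apply/idP/idP => [Qx|ux]; last exact: ge_inf.
rewrite leNgt; apply/negP => Fu.
have : \forall y \near x^'+, F y < u by exact: (cvgr_lt _ (@cdf_rc x) _ Fu).
move=> H; near x^'+ => y.
have xy : x < y by near: y; exact: nbhs_right_gt.
have yu : F y < u by near: y.
have [z uz zy] : exists2 z, u <= F z & z < y.
  have := @inf_adherent _ [set x | u <= F x] (y - quantile F u).
  rewrite subr_gt0 (le_lt_trans Qx)// => /(_ isT)[//|z uz]; rewrite -/(quantile F u).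
  by rewrite addrC subrK; exists z.
by have := lt_le_trans yu (le_trans uz (cdf_nd (ltW zy))); rewrite ltxx.
Unshelve. all: by end_near. Qed.

(** Outside of ]0, 1[ the infimum defining the quantile is a junk value. *)
Let Q (u : R) : R := if (0 < u < 1)%R then quantile F u else 0.

Let mQ : measurable_fun setT Q.
Proof.
apply: (measurability _ (RGenOInfty.measurableE R)) => _ [_ [x ->] <-].
rewrite setTI (_ : Q @^-1` _ = (`]0, 1[ `&` `]F x, +oo[) `|` (~` `]0, 1[ `&` [set u : R | x < 0])).
  apply: measurableU; apply: measurableI => //; first exact: measurableC.
  by case: (x < 0); rewrite ?set_true ?set_false.
apply/seteqP; split => u; rewrite /Q /= !in_itv/= !andbT.
  case: ifPn => u01; last by right.
  by rewrite ltNge quantile_le// -ltNge; left.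
case: ifPn => u01; last by case=> [[]|[]].
by rewrite [x < quantile _ _]ltNge quantile_le// -ltNge; case=> [[]|[]].
Qed.

Let uni := uniform_prob (@ltr01 R).

Let uniE (A : set R) : measurable A -> uni A = lebesgue_measure (A `&` `[0, 1]).
Proof.
move=> mA; rewrite /uni /uniform_prob integral_uniform_pdf.
rewrite (eq_integral (fun=> 1%:E)).
  by rewrite integral_cst//= ?mul1e//; exact: measurableI.
move=> u; rewrite inE/= in_itv/= => -[_ u01].
by rewrite /uniform_pdf u01 subr0 invr1.
Qed.

(** Both sides are the length of the interval [0, F x], up to endpoints. *)
Let law_Q x : uni (Q @^-1` `]-oo, x]) = P (Y @^-1` `]-oo, x]).
Proof.
have mA : measurable (Q @^-1` `]-oo, x]).
  by rewrite -[X in measurable X]setTI; exact: mQ.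
have /andP[F0 F1] := cdf_01 x.
have leb_cc : lebesgue_measure (`[0, F x] : set R) = (F x)%:E.
  rewrite lebesgue_measure_itv/= lte_fin; case: ltP => [_|F00]; first by rewrite oppr0 adde0.
  by congr EFin; apply/eqP; rewrite eq_le F0 F00.
have leb_oo : lebesgue_measure (`]0, F x[ : set R) = (F x)%:E.
  rewrite lebesgue_measure_itv/= lte_fin; case: ltP => [_|F00]; first by rewrite oppr0 adde0.
  by congr EFin; apply/eqP; rewrite eq_le F0 F00.
rewrite uniE// (_ : P _ = (F x)%:E); last by rewrite -hF.
apply/eqP; rewrite eq_le; apply/andP; split.
  apply: (@le_trans _ _ (lebesgue_measure (`[0, F x] `|` [set 1]))).
    apply: le_measure; rewrite ?inE; [exact: measurableI|exact: measurableU|].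
    move=> u; rewrite /Q /= !in_itv/= => -[Qu /andP[u0 u1]].
    have [->|un1] := eqVneq u 1; first by right.
    left; rewrite u0/=; move: u0; rewrite le_eqVlt => /predU1P[<-//|u0].
    by move: Qu; rewrite ifT ?quantile_le// ?u0/= lt_neqAle un1.
  apply: le_trans (measureU2 _ _ _) _ => //.
  rewrite [X in (_ + X)%E](_ : _ = 0%E); last exact: lebesgue_measure_set1.
  by rewrite adde0 -leb_cc.
apply: (@le_trans _ _ (lebesgue_measure `]0, F x[)).
  by rewrite -leb_oo.
apply: le_measure; rewrite ?inE//; first exact: measurableI.
move=> u; rewrite /Q /= !in_itv/= => /andP[u0 uF].
have u1 : u < 1 by exact: lt_le_trans uF F1.
by rewrite u0 u1/= quantile_le ?u0 ?u1// (ltW uF) (ltW u0) (ltW u1).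
Qed.

Let integral_Q (h : R -> \bar R) : measurable_fun setT h -> (forall y, 0 <= h y)%E ->
  (\int[P]_w h (Y w) = \int[lebesgue_measure]_(u in `[0%R, 1%R]) h (Q u))%E.
Proof.
move=> mh h0.
have mQ' : @measurable_fun _ _ (measurableTypeR R) R setT Q by exact: mQ.
pose Qm : {mfun (measurableTypeR R) >-> R} := HB.pack Q (isMeasurableFun.Build _ _ (measurableTypeR R) R Q mQ').
have cdfE x : cdf Y x = @cdf _ (measurableTypeR R) R (uniform_prob (@ltr01 R)) Qm x.
  by rewrite /cdf /distribution /pushforward -law_Q.
rewrite (same_law_ge0_integral (same_law_cdf cdfE) mh h0).
rewrite integral_uniform//=; last exact: measurableT_comp.
by rewrite subr0 invr1 mul1e.
Qed.

(** The quantile transform turns the shortfall [(q - Y)^+] into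
    [q - quantile F u] for [u < alpha] and into [0] for [u > alpha]. *)
Lemma lower_expected_shortfallE (alpha q : R) : 0 < alpha < 1 ->
  q = quantile F alpha -> F q = alpha ->
  integrableR P (fun w => (Y w <= q)%R%:R * (q - Y w)) ->
  lower_expected_shortfall F alpha =
  q - alpha^-1 * Ex P (fun w => (Y w <= q)%R%:R * (q - Y w)).
Proof.
move=> a01 qE Fq iY; have /andP[a0 a1] := a01.
pose h (y : R) : R := (y <= q)%R%:R * (q - y).
have mh : measurable_fun setT h.
  apply: measurable_funM; last exact: measurable_funB.
  by apply: (measurableT_comp (f := fun c : bool => c%:R : R)) => //; exact: measurable_fun_ler.
have h0 y : 0 <= h y.
  by rewrite /h; case: (leP y q) => yq; rewrite ?mul0r// mulr_ge0// subr_ge0.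
have mh' : measurable_fun setT (EFin \o h) by exact/measurable_EFinP.
have := integral_Q mh' (fun y => h0 y : (0 <= (EFin \o h) y)%E).
have mhQ D : measurable_fun D ((EFin \o h) \o Q).
  by apply: measurable_funTS; apply: measurableT_comp => //; exact: mQ.
have hQ u : 0 < u < alpha -> h (Q u) = q - quantile F u.
  move=> /andP[u0 ua]; have u01 : 0 < u < 1 by rewrite u0 (lt_trans ua).
  by rewrite /Q u01 /h quantile_le// Fq (ltW ua) mul1r.
have -> : (\int[lebesgue_measure]_(u in `[0%R, 1%R]) (EFin \o h) (Q u) =
    \int[lebesgue_measure]_(u in `]0%R, alpha[) (q - quantile F u)%:E)%E.
  transitivity (\int[lebesgue_measure]_(u in `]0%R, alpha[) ((EFin \o h) \o Q) u)%E; last first.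
    by apply: eq_integral => u; rewrite inE/= in_itv/= => ua; rewrite hQ.
  rewrite -integral_itv_obnd_cbnd//.
  rewrite -integral_itv_bndo_bndc//.
  rewrite [RHS]integral_itv_bndo_bndc//.
  rewrite [LHS]integral_mkcond [RHS]integral_mkcond; apply: eq_integral => u _.
  rewrite !patchE !mem_setE !in_itv/=.
  have [u0|u0] /= := ltP 0 u; last by [].
  have [ua|ua] := leP u alpha; first by rewrite (le_lt_trans ua).
  case: ifPn => // u1; rewrite /Q u0 u1/= /h quantile_le ?u0// Fq leNgt ua/=.
  by rewrite mul0r.
move=> hE.
have iq : lebesgue_measure.-integrable `]0, alpha[ (EFin \o (fun u => q - quantile F u)).
  apply/integrableP; split.
    have := mhQ `]0, alpha[%classic; apply: eq_measurable_fun => u.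
    by rewrite inE/= in_itv/= => ua; rewrite hQ.
  rewrite (_ : (\int[_]_(u in _) _ = \int[lebesgue_measure]_(u in `]0%R, alpha[) (q - quantile F u)%:E)%E).
    rewrite -hE; have := integrable_fin_num measurableT iY.
    by rewrite ge0_fin_numE//; apply: integral_ge0 => w _; rewrite lee_fin; exact: h0.
  apply: eq_integral => u; rewrite inE/= in_itv/= => ua.
  by rewrite ger0_norm// -hQ.
have iqc : lebesgue_measure.-integrable `]0, alpha[ (EFin \o (fun=> q)).
  apply: measurable_bounded_integrable => //.
    by rewrite [X in (X < _)%E]lebesgue_measure_itv/= lte_fin a0 -EFinB ltry.
  by exists `|q|; split; rewrite ?num_real// => M qM u _; exact: ltW.
rewrite /lower_expected_shortfall.
have -> : \int[lebesgue_measure]_(u in `]0, alpha[) quantile F u =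
    \int[lebesgue_measure]_(u in `]0, alpha[) (q - (q - quantile F u)).
  by apply: eq_Rintegral => u _; rewrite subKr.
rewrite RintegralB//.
rewrite Rintegral_cst//= lebesgue_measure_itv/= lte_fin a0 oppr0 adde0/=.
rewrite mulrBr mulrCA mulVf ?gt_eqF// mulr1; congr (_ - _ * _).
by rewrite /Rintegral -hE.
Qed.

End Quantile.

(** * The inverse of the limit function *)

Section PsiInverse.
Context {R : realType} (psi : R -> \bar R).
Hypothesis psi_nd : forall s t, s <= t -> (psi s <= psi t)%E.
Hypothesis psi0 : psi 0 = 0%E.
Hypothesis psi_pinfty : psi t @[t --> +oo%R] --> (+oo)%E.
Hypothesis psi_ninfty : psi t @[t --> -oo%R] --> (-oo)%E.

Lemma psi_unbounded x : exists t, (x%:E < psi t)%E.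
Proof.
have : \forall t \near +oo%R, ((x + 1)%:E <= psi t)%E by exact: cvgey_ge.
move=> H; near (+oo%R : set_system R) => t; exists t.
by apply: (@lt_le_trans _ _ (x + 1)%:E); [rewrite lte_fin; lra|near: t].
Unshelve. all: by end_near. Qed.

Lemma psi_unbounded_below x : exists t, (psi t < x%:E)%E.
Proof.
have : \forall t \near -oo%R, (psi t <= (x - 1)%:E)%E by exact: cvgeNy_le.
move=> H; near (-oo%R : set_system R) => t; exists t.
by apply: (@le_lt_trans _ _ (x - 1)%:E); [near: t|rewrite lte_fin; lra].
Unshelve. all: by end_near. Qed.

Let psi_lt s t : (psi s < psi t)%E -> s < t.
Proof. by move=> st; rewrite ltNge; apply/negP => /psi_nd; rewrite leNgt st. Qed.

Let up x := [set t | 0 <= t /\ (psi t <= x%:E)%E].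
Let dn x := [set t | t <= 0 /\ (x%:E <= psi t)%E].

Let has_sup_up x : 0 < x -> has_sup (up x).
Proof.
move=> x0; split; first by exists 0; split => //; rewrite psi0 lee_fin ltW.
have [t xt] := psi_unbounded x; exists t => s [_ sx].
by rewrite ltW// psi_lt// (le_lt_trans sx).
Qed.

Let has_inf_dn x : x < 0 -> has_inf (dn x).
Proof.
move=> x0; split; first by exists 0; split => //; rewrite psi0 lee_fin ltW.
have [t xt] := psi_unbounded_below x; exists t => s [_ sx].
by rewrite ltW// psi_lt// (lt_le_trans xt).
Qed.

(** The infimum and the supremum in [psi_inv] are different one-sided inverses
    of [psi]. Away from [0] this strict comparison and the next one hold for
    both of them. *)
Lemma psi_inv_le x t : x != 0 -> (x%:E < psi t)%E -> psi_inv psi x <= t.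
Proof.
rewrite /psi_inv => x0 xt; case: ifPn => [xn|]; last first.
  rewrite -leNgt le_eqVlt eq_sym (negbTE x0)/= => xp; rewrite xp.
  apply: ge_sup; first by case: (has_sup_up xp).
  by move=> s [_ sx]; rewrite ltW// psi_lt// (le_lt_trans sx).
have [t0|t0] := leP t 0.
  by apply: ge_inf; [case: (has_inf_dn xn)|split => //; exact: ltW].
apply: (@le_trans _ _ 0); last exact: ltW.
by apply: ge_inf; [case: (has_inf_dn xn)|split => //; rewrite psi0 lee_fin ltW].
Qed.

Lemma psi_inv_ge x t : x != 0 -> (psi t < x%:E)%E -> t <= psi_inv psi x.
Proof.
rewrite /psi_inv => x0 tx; case: ifPn => [xn|].
  apply: lb_le_inf; first by case: (has_inf_dn xn).
  by move=> s [_ sx]; rewrite ltW// psi_lt// (lt_le_trans tx).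
rewrite -leNgt le_eqVlt eq_sym (negbTE x0)/= => xp; rewrite xp.
have [t0|t0] := leP 0 t.
  by apply: ub_le_sup; [case: (has_sup_up xp)|split => //; exact: ltW].
apply: (@le_trans _ _ 0); first exact: ltW.
by apply: ub_le_sup; [case: (has_sup_up xp)|split => //; rewrite psi0 lee_fin ltW].
Qed.

Let psi_inv0 : psi_inv psi 0 = 0.
Proof. by rewrite /psi_inv ltxx. Qed.

Lemma psi_inv_nd x y : x <= y -> psi_inv psi x <= psi_inv psi y.
Proof.
rewrite le_eqVlt => /predU1P[->//|xy].
have [xE|x0] := eqVneq x 0.
  rewrite xE psi_inv0; apply: psi_inv_ge; first by rewrite gt_eqF// -xE.
  by rewrite psi0 lte_fin -xE.
have [yE|y0] := eqVneq y 0.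
  by rewrite yE psi_inv0; apply: psi_inv_le => //; rewrite psi0 lte_fin -yE.
rewrite leNgt; apply/negP => yx.
pose t := (psi_inv psi x + psi_inv psi y) / 2.
have tx : t < psi_inv psi x by rewrite /t; lra.
have yt : psi_inv psi y < t by rewrite /t; lra.
have := psi_inv_le x0; have := psi_inv_ge y0; move=> /(_ t) h1 /(_ t) h2.
have : (psi t <= x%:E)%E by rewrite leNgt; apply/negP => /h2; rewrite leNgt tx.
have : (y%:E <= psi t)%E by rewrite leNgt; apply/negP => /h1; rewrite leNgt yt.
by move=> /le_trans /[apply]; rewrite lee_fin leNgt xy.
Qed.

Lemma measurable_psi_inv : measurable_fun setT (psi_inv psi).
Proof. by apply: nondecreasing_measurable => //; exact: psi_inv_nd. Qed.

End PsiInverse.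

(** * Functions of pairs, and sums over the jumps of a step function *)

Section ContinuousPair.
Context {R : realType} {d} {T : measurableType d}.

Lemma cvg_pairR (S : Type) (F : set_system S) (FF : Filter F) (f g : S -> R) (a b : R) :
  f x @[x --> F] --> a -> g x @[x --> F] --> b ->
  (f x, g x) @[x --> F] --> ((a, b) : R * R).
Proof. by move=> fa gb; exact: (@cvg_pair _ _ _ F (nbhs a) (nbhs b) _ _ _ f g fa gb). Qed.

(** The first coordinate is replaced by a discrete approximation [am m], on
    each value of which only the second coordinate varies. *)
Lemma measurable_fun_continuous_pair (f : R * R -> R) (A B : T -> R) : continuous f ->
  measurable_fun setT A -> measurable_fun setT B ->
  measurable_fun setT (fun w => f (A w, B w)).
Proof.
move=> cf mA mB.
pose k m w := Num.trunc ((A w + m.+1%:R) * m.+1%:R).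
pose am m w : R := (k m w)%:R / m.+1%:R - m.+1%:R.
have cvgA w : am m w @[m --> \oo] --> A w.
  apply/cvgrPdist_le => e e0; near=> m.
  have m0 : 0 < m.+1%:R :> R by rewrite ltr0n.
  have Am : 0 <= (A w + m.+1%:R) * m.+1%:R.
    rewrite mulr_ge0//; have : - A w <= m%:R by near: m; exact: nbhs_infty_ger.
    by rewrite -natr1; lra.
  have /andP[k1 k2] := truncn_itv Am.
  rewrite -ler_pdivrMr// in k1; rewrite -ltr_pdivlMr// -[(Num.trunc _).+1%:R]natr1 mulrDl div1r in k2.
  have me : m.+1%:R^-1 <= e by rewrite ltW//; near: m; exact: near_infty_natSinv_lt (PosNum e0).
  rewrite /am; move: k1 k2 me; rewrite -/(k m w).
  move: (_ / _) => u; move: (_^-1) => v k1 k2 me.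
  by rewrite ler_norml; apply/andP; split; lra.
have mam m : measurable_fun setT (fun w => f (am m w, B w)).
  have -> : [set: T] = \bigcup_l [set w | k m w = l].
    by apply/seteqP; split => // w _; exists (k m w).
  have mk l : measurable [set w | k m w = l].
    apply: measurable_trunc_fiber; apply: measurable_funM => //.
    exact: measurable_funD.
  apply/measurable_fun_bigcup => // l.
  apply: (eq_measurable_fun (fun w => f (l%:R / m.+1%:R - m.+1%:R, B w))).
    by move=> w; rewrite inE /am /= => ->.
  apply: measurable_funTS.
  apply: (@measurableT_comp _ _ _ _ _ _ (fun b => f (l%:R / m.+1%:R - m.+1%:R, b))) => //.
  apply: continuous_measurable_fun => b.
  have h : (l%:R / m.+1%:R - m.+1%:R : R, b') @[b' --> b] --> (l%:R / m.+1%:R - m.+1%:R : R, b).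
    by apply: cvg_pairR; [exact: cvg_cst|exact: cvg_id].
  exact: (cvg_comp _ _ h (cf _)).
apply: (measurable_fun_cvg mam) => w _.
have h : (am m w, B w) @[m --> \oo] --> (A w, B w).
  by apply: cvg_pairR; [exact: cvgA|exact: cvg_cst].
exact: (cvg_comp _ _ h (cf (A w, B w))).
Unshelve. all: by end_near. Qed.

End ContinuousPair.

Section StepSum.
Context {R : realType}.

Definition step_sum N (b : nat -> bool) (f : nat -> R) : R :=
  \sum_(j < N) ((b j.+1)%:R - (b j)%:R) * f j.+1.

(** [step_sum] is a partial average of [f]: its nonnegative weights sum to
    [b N - b 0] and only charge the jumps of [b]. *)
Lemma step_sum_approx N (b : nat -> bool) (f : nat -> R) (y e M : R) :
  (forall j, b j -> b j.+1) -> 0 <= e -> `|y| <= M ->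
  (forall j, (j < N)%N -> ~~ b j -> b j.+1 -> `|f j.+1 - y| <= e) ->
  `|step_sum N b f - y| <= e + M * (1 - (b N)%:R + (b 0%N)%:R).
Proof.
move=> bS e0 yM fy.
have w0 j : 0 <= (b j.+1)%:R - (b j)%:R :> R.
  by have := bS j; case: (b j) => [->//|_]; rewrite ?subrr// subr0.
have tel : \sum_(j < N) ((b j.+1)%:R - (b j)%:R) = (b N)%:R - (b 0%N)%:R :> R.
  by rewrite -(big_mkord xpredT (fun j => (b j.+1)%:R - (b j)%:R)) telescope_sumr.
have b0N : (b 0%N)%:R <= (b N)%:R :> R by rewrite -subr_ge0 -tel sumr_ge0.
have bN1 : (b N)%:R <= 1 :> R by case: (b N).
have b00 : 0 <= (b 0%N)%:R :> R by case: (b 0%N).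
rewrite (_ : _ - y = \sum_(j < N) ((b j.+1)%:R - (b j)%:R) * (f j.+1 - y) - (1 - (b N)%:R + (b 0%N)%:R) * y); last first.
  under [in RHS]eq_bigr do rewrite mulrBr.
  by rewrite sumrB -mulr_suml tel /step_sum; ring.
rewrite (le_trans (ler_normB _ _))// lerD//; last first.
  rewrite normrM ger0_norm; last by lra.
  by rewrite mulrC ler_wpM2r//; lra.
apply: le_trans (ler_norm_sum _ _ _) _.
apply: (@le_trans _ _ (\sum_(j < N) ((b j.+1)%:R - (b j)%:R) * e)).
  apply: ler_sum => j _; rewrite normrM (ger0_norm (w0 j)).
  case bj: (b j); first by rewrite (bS _ bj) subrr !mul0r.
  case bj1: (b j.+1); last by rewrite subrr !mul0r.
  by rewrite ler_wpM2l// ?subr_ge0//; apply: fy => //; rewrite bj.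
by rewrite -mulr_suml tel ler_piMl//; lra.
Qed.

Lemma step_sum_le N (b : nat -> bool) (f : nat -> R) (M : R) :
  (forall j, b j -> b j.+1) -> (forall j, `|f j| <= M) -> `|step_sum N b f| <= M.
Proof.
move=> bS fM; have M0 : 0 <= M := le_trans (normr_ge0 _) (fM 0%N).
have := @step_sum_approx N b f 0 M 0 bS M0; rewrite normr0 subr0 mul0r addr0.
by apply => // j _ _ _; rewrite subr0.
Qed.

End StepSum.

(** * Ramps and bumps *)

Section Ramps.
Context {R : realType}.

(** The projection onto [0, 1], in a form that is visibly continuous. *)
Definition clamp01 (x : R) : R := (1 + `|x| - `|x - 1|) / 2.

Lemma clamp01_ge1 x : 1 <= x -> clamp01 x = 1.
Proof. by move=> x1; rewrite /clamp01 !ger0_norm; lra. Qed.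

Lemma clamp01_le0 x : x <= 0 -> clamp01 x = 0.
Proof. by move=> x0; rewrite /clamp01 !ler0_norm; lra. Qed.

Lemma clamp01_itv x : 0 <= clamp01 x <= 1.
Proof.
have [x0|x0] := leP x 0; first by rewrite clamp01_le0// lexx ler01.
have [x1|x1] := leP 1 x; first by rewrite clamp01_ge1// lexx ler01.
by rewrite /clamp01 ger0_norm ?ler0_norm; lra.
Qed.

Lemma continuous_clamp01 (f : R -> R) : continuous f ->
  continuous (fun u => clamp01 (f u)).
Proof.
move=> cf u; apply: cvgM; last exact: cvg_cst.
apply: cvgB.
  by apply: cvgD; [exact: cvg_cst|apply: cvg_norm; exact: cf].
by apply: cvg_norm; apply: cvgB; [exact: cf|exact: cvg_cst].
Qed.

(** It is [1] below [c - 2 e], [0] above [c + 2 e], and affine in between. *)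
Definition ramp (c e u : R) : R := clamp01 ((c + 2 * e - u) / (4 * e)).

(** It is [1] within [2 e] of [c] and [0] at distance [3 e] and more. *)
Definition bump (c e u : R) : R := clamp01 (3 - `|u - c| / e).

Lemma continuous_ramp c e : continuous (ramp c e).
Proof.
apply: continuous_clamp01 => u; apply: cvgM; last exact: cvg_cst.
by apply: cvgB; [exact: cvg_cst|exact: cvg_id].
Qed.

Lemma continuous_bump c e : continuous (bump c e).
Proof.
apply: continuous_clamp01 => u; apply: cvgB; first exact: cvg_cst.
apply: cvgM; last exact: cvg_cst.
by apply: cvg_norm; apply: cvgB; [exact: cvg_id|exact: cvg_cst].
Qed.

Lemma clamp01_normr x : `|clamp01 x| <= 1.
Proof. by have /andP[? ?] := clamp01_itv x; rewrite ger0_norm. Qed.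

Lemma bump_ge0 c e u : 0 <= bump c e u.
Proof. by have /andP[] := clamp01_itv (3 - `|u - c| / e). Qed.

Lemma bool_ramp_le1 (b : bool) (c e u : R) : `|b%:R - ramp c e u| <= 1.
Proof.
have /andP[r0 r1] := clamp01_itv ((c + 2 * e - u) / (4 * e)); rewrite -/(ramp c e u) in r0 r1.
by rewrite ler_norml; case: b => /=; apply/andP; split; lra.
Qed.

(** Outside of [c - 2 e, c + 2 e] the ramp equals [b], and inside the bump is [1]. *)
Lemma bool_ramp_bump (b : bool) (c e u : R) : 0 < e ->
  (u < c - 2 * e -> b) -> (c + 2 * e < u -> ~~ b) ->
  `|b%:R - ramp c e u| <= bump c e u.
Proof.
move=> e0 h1 h2.
have [uc|uc] := leP `|u - c| (2 * e).
  apply: le_trans (bool_ramp_le1 _ _ _ _) _; rewrite /bump clamp01_ge1//.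
  by rewrite lerBrDr -lerBrDl ler_pdivrMr//; lra.
apply: le_trans (bump_ge0 c e u).
move: uc; rewrite ltr_normr => /orP[uc|uc].
  have /negbTE -> := h2 (ltac:(lra)).
  rewrite /ramp clamp01_le0 ?subrr ?normr0// pmulr_lle0 ?invr_gt0; lra.
have -> := h1 (ltac:(lra)).
by rewrite /ramp clamp01_ge1 ?subrr ?normr0// ler_pdivlMr; lra.
Qed.

End Ramps.

(** * Convergence of the events below a level *)

Section EventsBelowLevel.
Context {R : realType} {d d'} {T : measurableType d} {T' : measurableType d'}.
Context (P : probability T R) (Q : probability T' R).
Context (A U V : nat -> T -> R) (W0 W1 : T' -> R).
Hypotheses (mA : forall n, measurable_fun setT (A n)).
Hypotheses (mU : forall n, measurable_fun setT (U n)) (mV : forall n, measurable_fun setT (V n)).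
Hypotheses (mW0 : measurable_fun setT W0) (mW1 : measurable_fun setT W1).
Hypothesis cvg_UV : forall (f g : R -> R) (M : R), continuous f -> continuous g ->
  (forall x, `|f x| <= M) -> (forall x, `|g x| <= M) ->
  Ex P (fun w => f (U n w) * g (V n w)) @[n --> \oo] --> Ex Q (fun w => f (W0 w) * g (W1 w)).
Context (C : R).
Hypothesis U2 : forall n, integrableR P (fun w => U n w ^+ 2).
Hypothesis UC : forall n, Ex P (fun w => U n w ^+ 2) <= C.
Hypothesis W0_atomless : forall c, Ex Q (fun w => (W0 w == c)%:R) = 0.
Context (psi : R -> \bar R).

Let bi {e} {S : measurableType e} (O : probability S R) (f : S -> R) := @bounded_rv_integrable _ _ _ O f.

Let C0 : 0 <= C.
Proof. by apply: le_trans (UC 0); apply: Rintegral_ge0 => w _; exact: sqr_ge0. Qed.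

(** Up to an error [D] negligible in mean square, [A n <= t] is decided by the
    sign of [r n - U n], where [r n] tends to [psi t]. *)
Definition sign_criterion (t : R) := exists (D : nat -> T -> R) (r : nat -> R),
  [/\ forall n, measurable_fun setT (D n),
      forall n, integrableR P (fun w => D n w ^+ 2),
      Ex P (fun w => D n w ^+ 2) @[n --> \oo] --> (0 : R),
      (r n)%:E @[n --> \oo] --> psi t &
      \forall n \near \oo, forall w,
        (0 < D n w + r n - U n w -> A n w <= t) /\
        (D n w + r n - U n w < 0 -> t < A n w)].

Hypothesis criterion : forall t, sign_criterion t.

Let bA n t : bounded_rv (fun w => (A n w <= t)%R%:R : R).
Proof. by apply: bounded_rv_bool; exact: measurable_fun_ler. Qed.

Let mW t : measurable_fun setT (fun w => ((W0 w)%:E <= psi t)%E).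
Proof. exact: measurable_fun_le_ereal. Qed.

Let bW t : bounded_rv (fun w => ((W0 w)%:E <= psi t)%E%:R : R).
Proof. exact: bounded_rv_bool. Qed.

Let cvg_V (g : R -> R) (M : R) : continuous g -> (forall x, `|g x| <= M) ->
  Ex P (fun w => g (V n w)) @[n --> \oo] --> Ex Q (fun w => g (W1 w)).
Proof.
move=> cg gM.
have c1 : continuous (fun _ : R => 1 : R) by move=> x; exact: cvg_cst.
have M1 (x : R) : `|1 : R| <= Num.max 1 M by rewrite normr1 le_max lexx.
have Mg x : `|g x| <= Num.max 1 M by rewrite le_max gM orbT.
have := cvg_UV c1 cg M1 Mg.
under eq_fun do under eq_Rintegral do rewrite mul1r.
by under [X in _ --> X -> _]eq_Rintegral do rewrite mul1r.
Qed.

Let cvg_U (g : R -> R) (M : R) : continuous g -> (forall x, `|g x| <= M) ->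
  Ex P (fun w => g (U n w)) @[n --> \oo] --> Ex Q (fun w => g (W0 w)).
Proof.
move=> cg gM.
have c1 : continuous (fun _ : R => 1 : R) by move=> x; exact: cvg_cst.
have M1 (x : R) : `|1 : R| <= Num.max 1 M by rewrite normr1 le_max lexx.
have Mg x : `|g x| <= Num.max 1 M by rewrite le_max gM orbT.
have := cvg_UV cg c1 Mg M1.
under eq_fun do under eq_Rintegral do rewrite mulr1.
by under [X in _ --> X -> _]eq_Rintegral do rewrite mulr1.
Qed.

Lemma tail_level (e : R) : 0 < e -> exists2 L, 0 < L & C / L ^+ 2 <= e.
Proof.
move=> e0; exists (1 + C / e); first by rewrite ltr_wpDr// divr_ge0// ltW.
have L1 : 1 <= 1 + C / e by rewrite lerDl divr_ge0// ltW.
rewrite ler_pdivrMr ?exprn_gt0 ?(lt_le_trans ltr01 L1)//.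
have : e * (1 + C / e) <= e * (1 + C / e) ^+ 2.
  by rewrite ler_wpM2l ?(ltW e0)// expr2 ler_peMl// (le_trans ler01).
apply: le_trans; rewrite mulrDr mulr1 mulrCA divff ?gt_eqF// mulr1.
by rewrite lerDr ltW.
Qed.

(** The event [b n] forces [D n] or [U n] to be large, while [D n] is negligible
    and the second moments of [U n] are bounded. *)
Lemma cvg_mismatch (b : nat -> T -> bool) (D : nat -> T -> R) (r : nat -> R) :
  (forall n, measurable_fun setT (b n)) -> (forall n, measurable_fun setT (D n)) ->
  (forall n, integrableR P (fun w => D n w ^+ 2)) ->
  Ex P (fun w => D n w ^+ 2) @[n --> \oo] --> (0 : R) ->
  (forall L, \forall n \near \oo, L <= r n) ->
  (\forall n \near \oo, forall w, b n w -> r n <= `|D n w| + `|U n w|) ->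
  Ex P (fun w => (b n w)%:R) @[n --> \oo] --> (0 : R).
Proof.
move=> mb mD D2 cD roo bD; apply/cvgr0Pnorm_le => e e0.
have e20 : 0 < e / 2 by rewrite divr_gt0.
have [L L0 CL] := tail_level e20.
have nD : \forall n \near \oo, Ex P (fun w => D n w ^+ 2) <= e / 2 by exact: (cvgr_le 0 cD).
have nr := roo (L + 1).
near=> n.
have rn : L + 1 <= r n by near: n.
have Dn : Ex P (fun w => D n w ^+ 2) <= e / 2 by near: n.
have bn : forall w, b n w -> r n <= `|D n w| + `|U n w| by near: n.
rewrite ger0_norm; last by apply: Rintegral_ge0 => w _.
have ib := bi P (bounded_rv_bool (mb n)).
apply: (@le_trans _ _ (Ex P (fun w => D n w ^+ 2 + (L ^+ 2)^-1 * U n w ^+ 2))).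
  apply: le_Ex => //; first by apply: integrableRD => //; exact: integrableRZ.
  move=> w; have D0 := sqr_ge0 (D n w).
  have Ui : 0 <= (L ^+ 2)^-1 * U n w ^+ 2 by rewrite mulr_ge0 ?sqr_ge0// invr_ge0 sqr_ge0.
  case bw : (b n w); last by rewrite addr_ge0.
  have [D1|D1] := leP 1 `|D n w|.
    have : 1 <= D n w ^+ 2 by rewrite -(real_normK (num_real (D n w))) expr_ge1.
    by move=> *; rewrite /=; lra.
  have LU : L <= `|U n w| by have := bn _ bw; lra.
  have : 1 <= (L ^+ 2)^-1 * U n w ^+ 2.
    rewrite mulrC ler_pdivlMr ?exprn_gt0// mul1r -(real_normK (num_real (U n w))).
    by rewrite lerXn2r ?nnegrE// ltW.
  by move=> *; rewrite /=; lra.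
rewrite ExD//; last exact: integrableRZ.
rewrite ExZ// [leRHS]splitr lerD//; apply: le_trans CL.
by rewrite mulrC ler_wpM2r// invr_ge0 sqr_ge0.
Unshelve. all: by end_near. Qed.

Lemma cvg_bump_atom (c : R) : Ex Q (fun w => bump c m.+1%:R^-1 (W0 w)) @[m --> \oo] --> (0 : R).
Proof.
rewrite -(W0_atomless c).
apply: (@dominated_Rintegral _ _ _ _ _ _ (fun=> 1)) => //.
- move=> m; apply: measurableT_comp => //; apply: continuous_measurable_fun.
  exact: continuous_bump.
- by have [] := @bounded_rv_bool _ _ R (fun w => W0 w == c) (measurable_fun_eqr mW0 (measurable_cst _)).
- exact/bi/bounded_rv_cst.
- by move=> m w; exact: clamp01_normr.
move=> w; have [->|Wc] := eqVneq (W0 w) c.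
  apply: cvg_near_cst; near=> m.
  by rewrite /bump subrr normr0 mul0r subr0 clamp01_ge1//; lra.
have Wc0 : 0 < `|W0 w - c| by rewrite normr_gt0 subr_eq0.
apply: cvg_near_cst; near=> m; rewrite /bump invrK clamp01_le0//.
have h : 3 / `|W0 w - c| <= m%:R by near: m; exact: nbhs_infty_ger.
have : 3 / `|W0 w - c| <= m.+1%:R by rewrite -natr1; lra.
by rewrite ler_pdivrMr// mulrC; lra.
Unshelve. all: by end_near. Qed.

(** The sign of [r n - U n] and the event [W0 <= c] are both replaced by the
    same ramp at [c], at the price of a bump around [c]. In the limit the bump
    has small expectation because [c] is not an atom. *)
Let cvg_indicator_fin t (c : R) (g : R -> R) (M : R) : psi t = c%:E -> continuous g ->
  (forall x, `|g x| <= M) ->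
  Ex P (fun w => (A n w <= t)%R%:R * g (V n w)) @[n --> \oo] -->
  Ex Q (fun w => ((W0 w)%:E <= psi t)%E%:R * g (W1 w)).
Proof.
move=> tc cg gM; have M0 : 0 <= M := le_trans (normr_ge0 _) (gM 0).
have [D [r [mD D2 cD]]] := criterion t; rewrite tc => cr crit.
have {}cr : r n @[n --> \oo] --> c by exact: fine_cvg cr.
apply/cvgrPdist_le => e e0; pose h := e / (4 * M + 1).
have h0 : 0 < h by rewrite divr_gt0//; lra.
have [m km] : exists m : nat, Ex Q (fun w => bump c m.+1%:R^-1 (W0 w)) <= h.
  have H : \forall m \near \oo, Ex Q (fun w => bump c m.+1%:R^-1 (W0 w)) <= h.
    exact: (cvgr_le 0 (cvg_bump_atom c)).
  by near \oo => m; exists m; near: m.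
set k := m.+1%:R^-1 in km; have k0 : 0 < k by rewrite invr_gt0 ltr0n.
have ck := @continuous_bump R c k; have cr' := @continuous_ramp R c k.
have k1 x : `|bump c k x| <= 1 by exact: clamp01_normr.
have r1 x : `|ramp c k x| <= 1 by exact: clamp01_normr.
have brU n := bounded_rv_continuous (mU n) cr' r1; have bkU n := bounded_rv_continuous (mU n) ck k1.
have brW := bounded_rv_continuous mW0 cr' r1; have bkW := bounded_rv_continuous mW0 ck k1.
have bgV n := bounded_rv_continuous (mV n) cg gM; have bgW := bounded_rv_continuous mW1 cg gM.
have nk : \forall n \near \oo, Ex P (fun w => bump c k (U n w)) <= 2 * h.
  by apply: (cvgr_le _ (cvg_U ck k1)); lra.
have nD : \forall n \near \oo, Ex P (fun w => D n w ^+ 2) <= h * k ^+ 2.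
  by apply: (cvgr_le 0 cD); rewrite mulr_gt0 ?exprn_gt0.
have nr : \forall n \near \oo, `|c - r n| <= k by move/cvgrPdist_le : cr; exact.
have nUV : \forall n \near \oo, `|Ex Q (fun w => ramp c k (W0 w) * g (W1 w)) -
    Ex P (fun w => ramp c k (U n w) * g (V n w))| <= h.
  have r1' x : `|ramp c k x| <= Num.max 1 M by rewrite le_max r1.
  have Mg x : `|g x| <= Num.max 1 M by rewrite le_max gM orbT.
  by have /cvgrPdist_le := cvg_UV cr' cg r1' Mg; exact.
have eQ : `|Ex Q (fun w => ((W0 w)%:E <= c%:E)%E%:R * g (W1 w)) -
    Ex Q (fun w => ramp c k (W0 w) * g (W1 w))| <= M * h.
  apply: le_trans (normr_ExB (h := fun w => M * bump c k (W0 w)) _ _ _ _) _.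
  - by apply: bi; apply: bounded_rvM => //; have := bW t; rewrite tc.
  - by apply: bi; exact: bounded_rvM.
  - by apply: bi; apply: bounded_rvM => //; exact: bounded_rv_cst.
  - move=> w; rewrite -mulrBl normrM mulrC ler_pM//.
    apply: bool_ramp_bump => //; rewrite lee_fin; first by move=> *; lra.
    by move=> *; rewrite -ltNge; lra.
  by rewrite ExZ ?ler_wpM2l//; exact: bi.
near=> n.
have kn : Ex P (fun w => bump c k (U n w)) <= 2 * h by near: n.
have Dn : Ex P (fun w => D n w ^+ 2) <= h * k ^+ 2 by near: n.
have rn : `|c - r n| <= k by near: n.
have UVn : `|Ex Q (fun w => ramp c k (W0 w) * g (W1 w)) -
    Ex P (fun w => ramp c k (U n w) * g (V n w))| <= h by near: n.
have cn : forall w, (0 < D n w + r n - U n w -> A n w <= t) /\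
        (D n w + r n - U n w < 0 -> t < A n w) by near: n.
have eP : `|Ex P (fun w => (A n w <= t)%R%:R * g (V n w)) -
    Ex P (fun w => ramp c k (U n w) * g (V n w))| <= M * (3 * h).
  have iD : integrableR P (fun w => (k ^+ 2)^-1 * D n w ^+ 2) by exact: integrableRZ.
  have ib : integrableR P (fun w => (k ^+ 2)^-1 * D n w ^+ 2 + bump c k (U n w)).
    by apply: integrableRD => //; exact: bi.
  apply: le_trans (normr_ExB (h := fun w => M * ((k ^+ 2)^-1 * D n w ^+ 2 + bump c k (U n w))) _ _ _ _) _.
  - by apply: bi; exact: bounded_rvM.
  - by apply: bi; exact: bounded_rvM.
  - exact: integrableRZ.
  - move=> w; rewrite -mulrBl normrM mulrC ler_pM//.
    have D0 : 0 <= (k ^+ 2)^-1 * D n w ^+ 2.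
      by apply: mulr_ge0; [rewrite invr_ge0 sqr_ge0|exact: sqr_ge0].
    have [Dk|kD] := leP `|D n w| k.
      apply: (@le_trans _ _ (bump c k (U n w))); last by rewrite lerDr.
      have /andP[? ?] : - k <= D n w <= k by rewrite -ler_norml.
      have /andP[? ?] : - k <= c - r n <= k by rewrite -ler_norml.
      have [c1 c2] := cn w.
      apply: bool_ramp_bump => // uc; first by apply: c1; lra.
      by rewrite -ltNge; apply: c2; lra.
    apply: le_trans (bool_ramp_le1 _ _ _ _) _.
    have : 1 <= (k ^+ 2)^-1 * D n w ^+ 2.
      rewrite mulrC ler_pdivlMr ?exprn_gt0// mul1r -(real_normK (num_real (D n w))).
      by rewrite lerXn2r ?nnegrE// ltW.
    by have := bump_ge0 c k (U n w); lra.
  rewrite ExZ// ler_wpM2l// ExD//; last exact: bi.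
  rewrite ExZ//; have : (k ^+ 2)^-1 * Ex P (fun w => D n w ^+ 2) <= h.
    by rewrite mulrC ler_pdivrMr ?exprn_gt0.
  by move=> *; lra.
have he : (4 * M + 1) * h <= e by rewrite /h mulrCA divff ?mulr1// gt_eqF//; lra.
by apply: le_trans (ler_dist_chain eQ eP UVn) (le_trans _ he); lra.
Unshelve. all: by end_near. Qed.

Let cvg_negligible (b : nat -> T -> bool) (g : R -> R) (M : R) :
  (forall n, measurable_fun setT (b n)) -> continuous g -> (forall x, `|g x| <= M) ->
  Ex P (fun w => (b n w)%:R) @[n --> \oo] --> (0 : R) ->
  Ex P (fun w => (b n w)%:R * g (V n w)) @[n --> \oo] --> (0 : R).
Proof.
move=> mb cg gM cb; have M0 : 0 <= M := le_trans (normr_ge0 _) (gM 0).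
have bb n := bounded_rv_bool (R := R) (mb n).
have c0 : M * Ex P (fun w => (b n w)%:R) @[n --> \oo] --> (0 : R).
  by have := cvgnM (@cvgn_cst R M) cb; rewrite mulr0.
apply: norm_cvg0; apply: (squeeze_cvgr _ (cvg_cst 0) c0).
near=> n; rewrite normr_ge0/= -ExZ; last exact: bi.
have bM : bounded_rv (fun w => M * (b n w)%:R) by apply: bounded_rvM => //; exact: bounded_rv_cst.
have bbg : bounded_rv (fun w => (b n w)%:R * g (V n w)) by apply: bounded_rvM => //; exact: bounded_rv_continuous cg gM.
have := normr_ExB (bi P bbg) (bi P (bounded_rv_cst 0)) (bi P bM); rewrite Ex_cst subr0; apply => w.
rewrite subr0 normrM mulrC ler_pM//.
by case: (b n w); rewrite ?normr1 ?normr0.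
Unshelve. all: by end_near. Qed.

(** When [psi t] is infinite, the event [A n <= t] or its complement is
    negligible. *)
Lemma cvg_indicator t (g : R -> R) (M : R) : continuous g -> (forall x, `|g x| <= M) ->
  Ex P (fun w => (A n w <= t)%R%:R * g (V n w)) @[n --> \oo] -->
  Ex Q (fun w => ((W0 w)%:E <= psi t)%E%:R * g (W1 w)).
Proof.
move=> cg gM; have M0 : 0 <= M := le_trans (normr_ge0 _) (gM 0).
have bgV n := bounded_rv_continuous (mV n) cg gM.
have [D [r [mD D2 cD cr crit]]] := criterion t.
case tc : (psi t) => [c||].
- by rewrite -tc; exact: cvg_indicator_fin tc cg gM.
- have nr L : \forall n \near \oo, L <= r n.
    rewrite tc in cr; have H : \forall n \near \oo, (L%:E <= (r n)%:E)%E by exact: cvgey_ge.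
    by apply: filterS H => n; rewrite lee_fin.
  have c0 : Ex P (fun w => (t < A n w)%R%:R) @[n --> \oo] --> (0 : R).
    apply: (cvg_mismatch (b := fun n w => (t < A n w)%R) _ mD D2 cD nr).
      by move=> n; exact: measurable_fun_ltr.
    apply: filterS crit => n cn w tA; have [c1 _] := cn w.
    rewrite leNgt; apply/negP => h; move: tA; rewrite ltNge => /negP; apply; apply: c1.
    have := ler_norm (- D n w); have := ler_norm (U n w); rewrite normrN; lra.
  have mtA n : measurable_fun setT (fun w => (t < A n w)%R) by exact: measurable_fun_ltr.
  have cb := cvg_negligible mtA cg gM c0.
  under [X in _ --> X]eq_Rintegral do rewrite leey mul1r.
  have := cvgnB (cvg_V cg gM) cb; rewrite subr0; apply: cvg_near_eq; near=> n.
  rewrite -ExB; last 2 first.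
  - exact: bi.
  - by apply: bi; apply: bounded_rvM => //; exact: bounded_rv_bool.
  by apply: eq_Rintegral => w _; rewrite leNgt; case: (t < A n w); rewrite /= ?mul1r ?mul0r ?subrr ?subr0.
- have nr L : \forall n \near \oo, L <= - r n.
    rewrite tc in cr; have H : \forall n \near \oo, ((r n)%:E <= (- L)%:E)%E by exact: cvgeNy_le.
    by apply: filterS H => n; rewrite lee_fin lerNr.
  have mtA n : measurable_fun setT (fun w => (A n w <= t)%R) by exact: measurable_fun_ler.
  have c0 : Ex P (fun w => (A n w <= t)%R%:R) @[n --> \oo] --> (0 : R).
    apply: (cvg_mismatch (b := fun n w => (A n w <= t)%R) mtA mD D2 cD nr).
    apply: filterS crit => n cn w tA; have [_ c1] := cn w.
    rewrite leNgt; apply/negP => h; move: tA; rewrite leNgt => /negP; apply; apply: c1.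
    have := ler_norm (D n w); have := ler_norm (- U n w); rewrite normrN; lra.
  under [X in _ --> X]eq_Rintegral do rewrite mul0r.
  by rewrite Ex_cst; exact: cvg_negligible mtA cg gM c0.
Unshelve. all: by end_near. Qed.

End EventsBelowLevel.

(** * The joint limit *)

Section Grid.
Context {R : realType} (f : R * R -> R) (T0 : R) (N : nat).

Definition grid (j : nat) : R := - T0 + 2 * T0 / N%:R * j%:R.

(** When [b] jumps at a point [x] within the grid, this is [f] at [v] and the
    next grid point. It is affine in the values of [b], so that its expectation
    only involves those of products [b t * f (s, v)]. *)
Definition grid_sum (b : R -> bool) (v : R) : R :=
  step_sum N (fun j => b (grid j)) (fun j => f (grid j, v)).

(** For a nondecreasing [b] it is [0] if [b] jumps between [- T0] and [T0], and [1]
    otherwise. *)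
Definition outside (b : R -> bool) : R := 1 - (b T0)%:R + (b (- T0))%:R.

Context (h M : R) (h0 : 0 <= h) (fM : forall p, `|f p| <= M).
Hypotheses (T00 : 0 < T0) (N0 : (0 < N)%N).

Lemma outside_ge0 (b : R -> bool) : (forall s t, s <= t -> b s -> b t) -> 0 <= outside b.
Proof.
move=> bS; rewrite /outside; case bN : (b (- T0)); last by case: (b T0); rewrite /=; lra.
by rewrite (bS (- T0) T0)//= (le_trans _ (ltW T00))// oppr_le0 ltW.
Qed.

Let gridN : grid N = T0.
Proof. by rewrite /grid divfK ?pnatr_eq0 ?gt_eqF//; lra. Qed.

Lemma gridS j : grid j.+1 = grid j + 2 * T0 / N%:R.
Proof. by rewrite /grid -[j.+1%:R]natr1 mulrDr mulr1 addrA. Qed.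

Lemma grid_le j : grid j <= grid j.+1.
Proof. by rewrite gridS lerDl divr_ge0 ?mulr_ge0 ?(ltW T00). Qed.

Let grid_box j : (j < N)%N -> `|grid j.+1| <= T0.
Proof.
move=> jN; rewrite ler_norml; apply/andP; split.
  by rewrite /grid lerDl mulr_ge0// divr_ge0 ?mulr_ge0 ?(ltW T00).
rewrite -[leRHS]gridN /grid lerD2l ler_wpM2l ?ler_nat//.
by rewrite divr_ge0 ?mulr_ge0 ?(ltW T00).
Qed.

Lemma normr_grid_sum (b : R -> bool) v : (forall s t, s <= t -> b s -> b t) ->
  `|grid_sum b v| <= M.
Proof. by move=> bS; apply: step_sum_le => // j; apply: bS; exact: grid_le. Qed.

Lemma grid_sum_approx (K e : R) (b : R -> bool) (v x y : R) :
  (forall p p', `|p.1| <= T0 -> `|p.2| <= K -> ball p e p' -> `|f p - f p'| < h) ->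
  2 * T0 / N%:R < e -> (forall s t, s <= t -> b s -> b t) ->
  (forall j, ~~ b (grid j) -> b (grid j.+1) -> (j < N)%N -> grid j <= x <= grid j.+1) ->
  `|v| <= K -> `|v - y| < e ->
  `|grid_sum b v - f (x, y)| <= h + M * outside b.
Proof.
move=> fe Ne bS bx vK vy.
rewrite /outside -[X in b X]gridN (_ : - T0 = grid 0); last by rewrite /grid mulr0 addr0.
apply: (step_sum_approx (b := fun j => b (grid j))) => // [j|j jN bj bjS].
  by apply: bS; exact: grid_le.
apply/ltW/fe => //=; first exact: grid_box.
have /andP[jx xj] := bx j bj bjS jN; rewrite gridS in xj *.
by split => //=; rewrite /ball/= ger0_norm; lra.
Qed.

End Grid.

Section GridExpectation.
Context {R : realType} {d} {T : measurableType d} (P : probability T R).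
Context (f : R * R -> R) (M : R) (cf : continuous f) (fM : forall p, `|f p| <= M).
Context (b : T -> R -> bool) (V : T -> R) (T0 : R) (N : nat).
Hypotheses (mb : forall t, measurable_fun setT (b ^~ t)) (mV : measurable_fun setT V).

Lemma continuous_section c : continuous (fun x => f (c, x)).
Proof.
move=> x; apply: (continuous_comp (f := fun x => (c, x))); last exact: cf.
by apply: cvg_pairR; [exact: cvg_cst|exact: cvg_id].
Qed.

Let bf c : bounded_rv (fun w => f (c, V w)).
Proof. by apply: (bounded_rv_continuous (M := M) mV (@continuous_section c)). Qed.

Lemma bounded_rv_grid_sum : bounded_rv (fun w => grid_sum f T0 N (b w) (V w)).
Proof.
apply: bounded_rv_sum => j _; apply: bounded_rvM => //.
by apply: bounded_rvB; exact: bounded_rv_bool.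
Qed.

Lemma Ex_grid_sum : Ex P (fun w => grid_sum f T0 N (b w) (V w)) =
  \sum_(j < N) (Ex P (fun w => (b w (grid T0 N j.+1))%:R * f (grid T0 N j.+1, V w)) -
               Ex P (fun w => (b w (grid T0 N j))%:R * f (grid T0 N j.+1, V w))).
Proof.
have bb s t : integrableR P (fun w => (b w s)%:R * f (t, V w)).
  by apply/bounded_rv_integrable/bounded_rvM => //; exact: bounded_rv_bool.
rewrite Ex_sum => [|j].
  apply: eq_bigr => j _; rewrite -ExB//.
  by apply: eq_Rintegral => w _; rewrite mulrBl.
by under eq_fun do rewrite mulrBl; exact: integrableRB.
Qed.

End GridExpectation.

Section JointLimit.
Context {R : realType} {d d'} {T : measurableType d} {T' : measurableType d'}.
Context (P : probability T R) (Q : probability T' R).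
Context (A B U V : nat -> T -> R) (W0 W1 : T' -> R).
Hypotheses (mA : forall n, measurable_fun setT (A n)) (mB : forall n, measurable_fun setT (B n)).
Hypotheses (mU : forall n, measurable_fun setT (U n)) (mV : forall n, measurable_fun setT (V n)).
Hypotheses (mW0 : measurable_fun setT W0) (mW1 : measurable_fun setT W1).
Context (C : R).
Hypotheses (U2 : forall n, integrableR P (fun w => U n w ^+ 2))
           (V2 : forall n, integrableR P (fun w => V n w ^+ 2)).
Hypotheses (UC : forall n, Ex P (fun w => U n w ^+ 2) <= C)
           (VC : forall n, Ex P (fun w => V n w ^+ 2) <= C).
Hypothesis W0_atomless : forall c, Ex Q (fun w => (W0 w == c)%:R) = 0.
Context (psi : R -> \bar R).
Hypothesis psi_nd : forall s t, s <= t -> (psi s <= psi t)%E.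
Hypothesis psi0 : psi 0 = 0%E.
Hypothesis psi_pinfty : psi t @[t --> +oo%R] --> (+oo)%E.
Hypothesis psi_ninfty : psi t @[t --> -oo%R] --> (-oo)%E.

Let belowA n w t : bool := A n w <= t.
Let belowW w t : bool := ((W0 w)%:E <= psi t)%E.

Hypothesis cvg_below : forall (t : R) (g : R -> R) (M : R), continuous g -> (forall x, `|g x| <= M) ->
  Ex P (fun w => (A n w <= t)%R%:R * g (V n w)) @[n --> \oo] -->
  Ex Q (fun w => ((W0 w)%:E <= psi t)%E%:R * g (W1 w)).
Context (k : nat -> R).
Hypothesis cvg_k : k n @[n --> \oo] --> (0 : R).
Hypothesis BV : \forall n \near \oo, forall w, `|B n w - V n w| <= k n * (`|A n w| * `|U n w|).

Let bi {e} {S : measurableType e} (O : probability S R) (g : S -> R) := @bounded_rv_integrable _ _ _ O g.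

Let meq (c : \bar R) : measurable_fun setT (fun w => (W0 w)%:E == c).
Proof.
case: c => [c||].
- apply: (eq_measurable_fun (fun w => W0 w == c)) => //; exact: measurable_fun_eqr.
- by apply: (eq_measurable_fun (fun=> false)).
- by apply: (eq_measurable_fun (fun=> false)).
Qed.

Let atom (c : \bar R) : Ex Q (fun w => ((W0 w)%:E == c)%:R) = 0.
Proof.
case: c => [c||]; first exact: W0_atomless.
- exact: Ex_cst.
- exact: Ex_cst.
Qed.

Let mbA n t : measurable_fun setT (belowA n ^~ t).
Proof. exact: measurable_fun_ler. Qed.

Let mbW t : measurable_fun setT (belowW ^~ t).
Proof. exact: measurable_fun_le_ereal. Qed.

Let bA_mono n w s t : s <= t -> belowA n w s -> belowA n w t.
Proof. by move=> st /le_trans; exact. Qed.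

Let bW_mono w s t : s <= t -> belowW w s -> belowW w t.
Proof. by move=> /psi_nd st /le_trans; exact. Qed.

Let bA t n : bounded_rv (fun w => (belowA n w t)%:R : R).
Proof. exact: bounded_rv_bool. Qed.

Let bW t : bounded_rv (fun w => (belowW w t)%:R : R).
Proof. exact: bounded_rv_bool. Qed.

Let boutA t n : bounded_rv (fun w => outside t (belowA n w)).
Proof. by apply: bounded_rvD => //; apply: bounded_rvB => //; exact: bounded_rv_cst. Qed.

Let boutW t : bounded_rv (fun w => outside t (belowW w)).
Proof. by apply: bounded_rvD => //; apply: bounded_rvB => //; exact: bounded_rv_cst. Qed.

Let cvg_below1 t : Ex P (fun w => (belowA n w t)%:R) @[n --> \oo] --> Ex Q (fun w => (belowW w t)%:R).
Proof.
have c1 : continuous (fun _ : R => 1 : R) by move=> x; exact: cvg_cst.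
have M1 (x : R) : `|1 : R| <= 1 by rewrite normr1.
have := @cvg_below t _ _ c1 M1.
under eq_fun do under eq_Rintegral do rewrite mulr1.
by under [X in _ --> X -> _]eq_Rintegral do rewrite mulr1.
Qed.

Let cvg_outside t : Ex P (fun w => outside t (belowA n w)) @[n --> \oo] -->
  Ex Q (fun w => outside t (belowW w)).
Proof.
have EA n : Ex P (fun w => outside t (belowA n w)) =
    1 - Ex P (fun w => (belowA n w t)%:R) + Ex P (fun w => (belowA n w (- t))%:R).
  have b1 := @bounded_rv_cst _ T R 1.
  by rewrite ExD ?ExB ?Ex_cst//; apply: bi => //; exact: bounded_rvB.
have -> : Ex Q (fun w => outside t (belowW w)) =
    1 - Ex Q (fun w => (belowW w t)%:R) + Ex Q (fun w => (belowW w (- t))%:R).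
  have b1 := @bounded_rv_cst _ T' R 1.
  by rewrite ExD ?ExB ?Ex_cst//; apply: bi => //; exact: bounded_rvB.
under eq_fun do rewrite EA.
exact: cvgnD (cvgnB (@cvgn_cst R 1) (@cvg_below1 t)) (@cvg_below1 (- t)).
Qed.

(** No mass of the limit escapes, because [psi] tends to both infinities. *)
Let cvg_outsideW : Ex Q (fun w => outside n%:R (belowW w)) @[n --> \oo] --> (0 : R).
Proof.
rewrite (_ : 0 = Ex Q (fun=> 0)); last by rewrite Ex_cst.
apply: (@dominated_Rintegral _ _ _ _ _ _ (fun=> 2)) => //.
- by move=> n; case: (boutW n%:R).
- exact/bi/bounded_rv_cst.
- move=> n w; rewrite /outside; case: (belowW _ _); case: (belowW _ _) => /=;
    rewrite ?subrr ?add0r ?subr0 ?addr0 ?normr1 ?normr0//; try lra.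
  by rewrite ger0_norm; lra.
move=> w; apply: cvg_near_cst.
have h1 : \forall n \near \oo, ((W0 w)%:E <= psi n%:R)%E.
  have h : \forall t \near +oo%R, ((W0 w)%:E <= psi t)%E by exact: cvgey_ge.
  exact: (cvgr_idn h).
have h2 : \forall n \near \oo, (psi (- n%:R) <= (W0 w - 1)%:E)%E.
  have h : \forall t \near -oo%R, (psi t <= (W0 w - 1)%:E)%E by exact: cvgeNy_le.
  have [L [_ hL]] := h; near=> n; apply: hL; rewrite ltrNl.
  apply: (@lt_le_trans _ _ (1 - L)); first lra.
  by near: n; exact: nbhs_infty_ger.
near=> n; rewrite /outside /belowW (_ : (_ <= psi n%:R)%E); last by near: n.
rewrite leNgt (_ : (psi (- n%:R) < _)%E); first by rewrite subrr addr0.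
apply: (@le_lt_trans _ _ (W0 w - 1)%:E); last by rewrite lte_fin; lra.
by near: n.
Unshelve. all: by end_near. Qed.

Section Discretization.
Context (f : R * R -> R) (M : R) (cf : continuous f) (fM : forall p, `|f p| <= M).

Let M0 : 0 <= M := le_trans (normr_ge0 _) (fM (0, 0)).

Lemma cvg_Ex_grid_sum T0 N :
  Ex P (fun w => grid_sum f T0 N (belowA n w) (V n w)) @[n --> \oo] -->
  Ex Q (fun w => grid_sum f T0 N (belowW w) (W1 w)).
Proof.
rewrite (Ex_grid_sum Q cf fM T0 N mbW mW1).
under eq_fun do rewrite (Ex_grid_sum P cf fM T0 N (mbA _) (mV _)).
pose u n s t := Ex P (fun w => (belowA n w s)%:R * f (t, V n w)).
pose l s t := Ex Q (fun w => (belowW w s)%:R * f (t, W1 w)).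
have ul s t : u n s t @[n --> \oo] --> l s t.
  exact: (@cvg_below s _ M (continuous_section cf (c := t)) (fun=> fM _)).
exact: (cvgn_sum (u := fun j n => u n (grid T0 N j.+1) (grid T0 N j.+1) - u n (grid T0 N j) (grid T0 N j.+1))
  (l := fun j => l (grid T0 N j.+1) (grid T0 N j.+1) - l (grid T0 N j) (grid T0 N j.+1))
  (fun j => cvgnB (@ul _ _) (@ul _ _))).
Qed.

Context (h T0 K e : R) (N : nat).
Hypotheses (h0 : 0 < h) (T00 : 0 < T0) (K0 : 0 < K) (N0 : (0 < N)%N) (Ne : 2 * T0 / N%:R < e).
Hypothesis fe : forall p p', `|p.1| <= T0 -> `|p.2| <= K -> ball p e p' -> `|f p - f p'| < h.

Let bcst (c : R) {e'} {S : measurableType e'} (O : probability S R) : integrableR O (fun=> c).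
Proof. exact/bi/bounded_rv_cst. Qed.

Let far (x y : R) : `|x| <= M -> `|y| <= M -> `|x - y| <= 2 * M.
Proof. by move=> xM yM; rewrite mulr_natl mulr2n (le_trans (ler_normB _ _))// lerD. Qed.

(** Off the null events where [W0] is [0] or a value of [psi] on the grid, the jump
    of [belowW w] locates [psi_inv psi (W0 w)] between two grid points. *)
Lemma grid_sum_error_limit :
  `|Ex Q (fun w => grid_sum f T0 N (belowW w) (W1 w)) - Ex Q (fun w => f (psi_inv psi (W0 w), W1 w))| <=
  h + M * Ex Q (fun w => outside T0 (belowW w)) + 2 * M * Ex Q (fun w => (K < `|W1 w|)%R%:R).
Proof.
have h_gt0 := h0; have M_ge0 := M0.
pose Z w : R := (W0 w == 0)%:R + \sum_(j < N) ((W0 w)%:E == psi (grid T0 N j.+1))%:R.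
have S0 w : 0 <= \sum_(j < N) ((W0 w)%:E == psi (grid T0 N j.+1))%:R :> R by exact: sumr_ge0.
have b0 : bounded_rv (fun w => (W0 w == 0)%:R : R).
  by apply: bounded_rv_bool; exact: measurable_fun_eqr.
have bj j : bounded_rv (fun w => ((W0 w)%:E == psi (grid T0 N j))%:R : R) by exact: bounded_rv_bool.
have bS : bounded_rv (fun w => \sum_(j < N) ((W0 w)%:E == psi (grid T0 N j.+1))%:R : R).
  exact: bounded_rv_sum.
have Z0 : Ex Q Z = 0.
  rewrite ExD ?W0_atomless ?add0r; try exact: bi.
  by rewrite Ex_sum => [|j]; [rewrite big1|exact: bi].
have io := integrableRZ M (bi Q (boutW T0)).
have ih := integrableRD (bcst h Q) io.
have it := integrableRZ (2 * M) (bi Q (bounded_rv_tail K mW1)).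
have iZ : integrableR Q (fun w => 2 * M * Z w) by exact/integrableRZ/bi/bounded_rvD.
have i3 := integrableRD ih it.
have bg := bounded_rv_grid_sum cf fM T0 N mbW mW1.
have bfW : bounded_rv (fun w => f (psi_inv psi (W0 w), W1 w)).
  split; last by exists M.
  apply: measurable_fun_continuous_pair => //; apply: measurableT_comp => //.
  exact: measurable_psi_inv.
apply: le_trans (normr_ExB (bi Q bg) (bi Q bfW) (integrableRD i3 iZ) _) _; last first.
  rewrite (ExD i3 iZ) (ExD ih it) (ExD (bcst h Q) io).
  rewrite Ex_cst !ExZ; try (apply: bi => //; exact: bounded_rv_tail); last exact/bi/bounded_rvD.
  by rewrite Z0 mulr0 addr0.
move=> w /=; have big : `|grid_sum f T0 N (belowW w) (W1 w) - f (psi_inv psi (W0 w), W1 w)| <= 2 * M.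
  by apply: far => //; apply: normr_grid_sum => //; exact: bW_mono.
have Mo : 0 <= M * outside T0 (belowW w) by rewrite mulr_ge0 ?outside_ge0//; exact: bW_mono.
have Mt : 0 <= 2 * M * (K < `|W1 w|)%R%:R by rewrite !mulr_ge0.
have Mz : 0 <= 2 * M * Z w by rewrite !mulr_ge0 ?addr_ge0.
have [WK|KW] := boolP (K < `|W1 w|); first by rewrite [X in _ + X + _]mulr1; lra.
rewrite [X in _ + X + _]mulr0 addr0.
have [Z1|Z1] := leP 1 (Z w).
  have : 2 * M <= 2 * M * Z w by rewrite ler_peMr ?mulr_ge0.
  by lra.
have W00 : W0 w != 0.
  by apply/negP => W00; move: Z1; rewrite /Z W00 ltNge /= lerDl S0.
have Wj j : (j < N)%N -> (W0 w)%:E != psi (grid T0 N j.+1).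
  move=> jN; apply/negP => Wj; move: Z1; rewrite /Z (bigD1 (Ordinal jN))//= Wj ltNge => /negP; apply.
  by rewrite addrCA lerDl addr_ge0// sumr_ge0.
rewrite -[X in X <= _]addr0 lerD//.
apply: (grid_sum_approx (ltW h0) fM T00 N0 fe Ne); [exact: bW_mono| |by rewrite leNgt|].
  move=> j; rewrite /belowW -ltNge => jW Wj' jN; apply/andP; split; first exact: psi_inv_ge.
  by apply: psi_inv_le => //; rewrite lt_neqAle Wj' Wj.
by rewrite subrr normr0 (le_lt_trans _ Ne)// divr_ge0 ?mulr_ge0 ?(ltW T00).
Qed.

(** [B n] and [V n] are closer than [e] unless [A n] or [U n] is large. *)
Lemma grid_sum_error n : `|k n| < e / (T0 * K) ->
  (forall w, `|B n w - V n w| <= k n * (`|A n w| * `|U n w|)) ->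
  `|Ex P (fun w => grid_sum f T0 N (belowA n w) (V n w)) - Ex P (fun w => f (A n w, B n w))| <=
  h + 3 * M * Ex P (fun w => outside T0 (belowA n w)) +
  2 * M * Ex P (fun w => (K < `|V n w|)%R%:R) + 2 * M * Ex P (fun w => (K < `|U n w|)%R%:R).
Proof.
move=> kn BVn; have h_gt0 := h0; have M_ge0 := M0; have T0_gt0 := T00.
have io := integrableRZ (3 * M) (bi P (boutA T0 n)).
have ih := integrableRD (bcst h P) io.
have iV := integrableRZ (2 * M) (bi P (bounded_rv_tail K (mV n))).
have iU := integrableRZ (2 * M) (bi P (bounded_rv_tail K (mU n))).
have i3 := integrableRD ih iV.
have bg := bounded_rv_grid_sum cf fM T0 N (mbA n) (mV n).
have bfA : bounded_rv (fun w => f (A n w, B n w)).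
  by split; [exact: measurable_fun_continuous_pair|exists M].
apply: le_trans (normr_ExB (bi P bg) (bi P bfA) (integrableRD i3 iU) _) _; last first.
  rewrite (ExD i3 iU) (ExD ih iV) (ExD (bcst h P) io).
  by rewrite Ex_cst !ExZ//; apply: bi => //; exact: bounded_rv_tail.
move=> w /=; have big : `|grid_sum f T0 N (belowA n w) (V n w) - f (A n w, B n w)| <= 2 * M.
  by apply: far => //; apply: normr_grid_sum => //; exact: bA_mono.
have Mo : 0 <= M * outside T0 (belowA n w) by rewrite mulr_ge0 ?outside_ge0//; exact: bA_mono.
have MV : 0 <= 2 * M * (K < `|V n w|)%R%:R by rewrite !mulr_ge0.
have MU : 0 <= 2 * M * (K < `|U n w|)%R%:R by rewrite !mulr_ge0.
have [VK|VK] := ltP K `|V n w|; first by rewrite [X in _ + X + _]mulr1; lra.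
rewrite [X in _ + X + _]mulr0 addr0.
have [VB|VB] := ltP `|V n w - B n w| e.
  suff : `|grid_sum f T0 N (belowA n w) (V n w) - f (A n w, B n w)| <= h + M * outside T0 (belowA n w) by lra.
  apply: (grid_sum_approx (ltW h0) fM T00 N0 fe Ne) => //; first exact: bA_mono.
  by move=> j; rewrite /belowA -ltNge => /ltW ->.
have [UK|UK] := ltP K `|U n w|; first by rewrite [X in _ <= _ + X]mulr1; lra.
rewrite mulr0 addr0.
suff o1 : 1 <= outside T0 (belowA n w).
  by have : M * 1 <= M * outside T0 (belowA n w); [rewrite ler_wpM2l|lra].
have TA : T0 < `|A n w|.
  rewrite ltNge; apply/negP => AT; move: VB; rewrite leNgt distrC => /negP; apply.
  apply: le_lt_trans (BVn w) _; apply: (@le_lt_trans _ _ (`|k n| * (T0 * K))).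
    apply: le_trans (ler_wpM2r _ (ler_norm _)) _; first exact: mulr_ge0.
    by rewrite ler_wpM2l// ler_pM.
  by rewrite -ltr_pdivlMr// mulr_gt0.
rewrite /outside /belowA; case: (leP (A n w) (- T0)) => [AT|TA'].
  by rewrite (le_trans AT) ?subrr ?add0r//; lra.
rewrite (leNgt (A n w)); have -> : T0 < A n w; last by rewrite subr0 addr0.
by move: TA; rewrite lter_normr => /orP[//|]; lra.
Qed.

End Discretization.

(** Discretizing the first coordinate of a test function on a large box reduces
    the joint law to the events [A n <= t] and functions of [V n]. *)
Lemma cvg_joint (f : R * R -> R) (M : R) : continuous f -> (forall p, `|f p| <= M) ->
  Ex P (fun w => f (A n w, B n w)) @[n --> \oo] -->
  Ex Q (fun w => f (psi_inv psi (W0 w), W1 w)).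
Proof.
move=> cf fM; have M0 : 0 <= M := le_trans (normr_ge0 _) (fM (0, 0)).
apply/cvgrPdist_le => e e0.
(* [13 * M + 3] adds up the errors of the two discretizations, [10 * M + 1] and
   [3 * M + 1], and of the convergence of the discretized expectations. *)
pose h := e / (13 * M + 3).
have h0 : 0 < h by rewrite divr_gt0//; lra.
have he : (13 * M + 3) * h = e by rewrite /h mulrC divfK// gt_eqF//; lra.
have [T0 T00 outT] : exists2 T0 : R, 0 < T0 & Ex Q (fun w => outside T0 (belowW w)) <= h.
  have H : \forall n \near \oo, Ex Q (fun w => outside n%:R (belowW w)) <= h.
    exact: (cvgr_le 0 cvg_outsideW).
  near \oo => n; exists n%:R; last by near: n.
  by rewrite ltr0n; near: n; exact: nbhs_infty_gt.
have [K K0 [tailW tailC]] : exists2 K : R, 0 < K &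
    Ex Q (fun w => (K < `|W1 w|)%R%:R) <= h /\ C / K ^+ 2 <= h.
  have [L L0 CL] := tail_level UC h0.
  have H : \forall n \near \oo, Ex Q (fun w => (n%:R < `|W1 w|)%R%:R) <= h.
    exact: (cvgr_le 0 (cvg_tail Q mW1)).
  near \oo => n; have Ln : L <= n%:R by near: n; exact: nbhs_infty_ger.
  have n0 : 0 < n%:R :> R := lt_le_trans L0 Ln.
  exists n%:R => //.
  split; first by near: n.
  apply: le_trans CL; rewrite ler_wpM2l//.
    by apply: le_trans (UC 0); apply: Rintegral_ge0 => w _; exact: sqr_ge0.
  by rewrite lef_pV2 ?posrE ?exprn_gt0// lerXn2r ?nnegrE// ltW.
have cbox : compact (`[- T0, T0] `*` `[- K, K] : set (R * R)).
  by apply: compact_setX; exact: segment_compact.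
have [r r0 fr'] := compact_unif_cont cbox cf h0.
have fr p p' : `|p.1| <= T0 -> `|p.2| <= K -> ball p r p' -> `|f p - f p'| < h.
  by rewrite !ler_norml => pT pK; apply: fr'; split; rewrite /= in_itv.
have [N N0 Nr] : exists2 N, (0 < N)%N & 2 * T0 / N%:R < r.
  near \oo => N; have N0 : (0 < N)%N by near: N; exact: nbhs_infty_gt.
  exists N => //; rewrite ltr_pdivrMr ?ltr0n// -ltr_pdivrMl//.
  by near: N; exact: nbhs_infty_gtr.
have nout : \forall n \near \oo, Ex P (fun w => outside T0 (belowA n w)) <= 2 * h.
  by apply: (cvgr_le _ (@cvg_outside T0)); lra.
have nk : \forall n \near \oo, `|k n| < r / (T0 * K).
  by move/cvgr0Pnorm_lt : cvg_k; apply; rewrite divr_gt0// mulr_gt0.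
have nstep : \forall n \near \oo, `|Ex Q (fun w => grid_sum f T0 N (belowW w) (W1 w)) -
    Ex P (fun w => grid_sum f T0 N (belowA n w) (V n w))| <= h.
  by have /cvgrPdist_le := @cvg_Ex_grid_sum f M cf fM T0 N; exact.
have eQ := grid_sum_error_limit cf fM h0 T00 N0 Nr fr.
have tail (Z : T -> R) : measurable_fun setT Z -> integrableR P (fun w => Z w ^+ 2) ->
    Ex P (fun w => Z w ^+ 2) <= C -> Ex P (fun w => (K < `|Z w|)%R%:R) <= h.
  move=> mZ Z2 ZC; apply: le_trans (markov_sqr mZ Z2 K0) _; apply: le_trans tailC.
  by rewrite ler_wpM2r// invr_ge0 sqr_ge0.
near=> n.
have kn : `|k n| < r / (T0 * K) by near: n.
have BVn : forall w, `|B n w - V n w| <= k n * (`|A n w| * `|U n w|) by near: n.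
have eP := grid_sum_error cf fM h0 T00 K0 N0 Nr fr kn BVn.
have sn : `|Ex Q (fun w => grid_sum f T0 N (belowW w) (W1 w)) -
    Ex P (fun w => grid_sum f T0 N (belowA n w) (V n w))| <= h by near: n.
have bound (c x y : R) : 0 <= c -> x <= y -> c * M * x <= c * M * y.
  by move=> c0 xy; rewrite ler_wpM2l// mulr_ge0.
have outn : 3 * M * Ex P (fun w => outside T0 (belowA n w)) <= 3 * M * (2 * h).
  by apply: bound => //; near: n.
have tU := bound 2 _ _ (ler0n _ _) (tail _ (mU n) (U2 n) (UC n)).
have tV := bound 2 _ _ (ler0n _ _) (tail _ (mV n) (V2 n) (VC n)).
have tW := bound 2 _ _ (ler0n _ _) tailW.
have oW := bound 1 _ _ (ler01) outT; rewrite mul1r in oW.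
rewrite distrC in eQ; rewrite distrC in eP.
by apply: le_trans (ler_dist_chain eQ eP sn) _; rewrite -he; lra.
Unshelve. all: by end_near. Qed.

End JointLimit.

(** * Normalized sums and normal pairs *)

Section SquareIntegrable.
Context {R : realType} {d} {T : measurableType d} (P : probability T R).

Lemma sqr_integrableD (f g : T -> R) : measurable_fun setT f -> measurable_fun setT g ->
  integrableR P (fun w => f w ^+ 2) -> integrableR P (fun w => g w ^+ 2) ->
  integrableR P (fun w => (f w + g w) ^+ 2).
Proof.
move=> mf mg f2 g2.
have fg2 := integrableRD (integrableRZ 2 f2) (integrableRZ 2 g2).
apply: integrableR_dom fg2 _ => [|w]; first by apply: measurable_funX; exact: measurable_funD.
rewrite ger0_norm ?sqr_ge0//.
have := sqr_ge0 (f w - g w); rewrite sqrrB sqrrD; lra.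
Qed.

Lemma sqr_integrableZ (c : R) (f : T -> R) :
  integrableR P (fun w => f w ^+ 2) -> integrableR P (fun w => (c * f w) ^+ 2).
Proof. by move=> f2; under eq_fun do rewrite exprMn; exact: integrableRZ. Qed.

Lemma sqr_integrable_sum n (f : nat -> T -> R) : (forall i, measurable_fun setT (f i)) ->
  (forall i, integrableR P (fun w => f i w ^+ 2)) ->
  integrableR P (fun w => (\sum_(i < n) f i w) ^+ 2).
Proof.
move=> mf f2; elim: n => [|n IH].
  by under eq_fun do rewrite big_ord0 expr0n/=; exact/bounded_rv_integrable/bounded_rv_cst.
under eq_fun do rewrite big_ord_recr/=.
by apply: sqr_integrableD => //; exact: measurable_sum.
Qed.

End SquareIntegrable.

Section BivariateCLT.
Context {R : realType} {d} {T : measurableType d} (P : probability T R).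
Context (X : nat -> {RV P >-> R}) (indX : mutually_independent X).
Hypothesis lawX : forall i, same_law (X i) (X 0%N).

Definition normalized_sum (f : R -> R) (n : nat) (w : T) : R :=
  \sum_(i < n) f (X i w) / Num.sqrt n%:R.

Section OneFunction.
Context (f : R -> R) (mf : measurable_fun setT f).

Lemma measurable_normalized_sum n : measurable_fun setT (normalized_sum f n).
Proof.
apply: measurable_sum => i; apply: measurable_funM => //.
exact: measurableT_comp.
Qed.

Hypothesis f2 : integrableR P (fun w => f (X 0%N w) ^+ 2).

Let f2i i : integrableR P (fun w => f (X i w) ^+ 2).
Proof.
have m2 : measurable_fun setT (fun x => f x ^+ 2) by exact: measurable_funX.
apply: (same_law_integrable (X := X 0%N) _ m2 f2) => B mB; symmetry; exact: lawX.
Qed.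

Let f2n n i : integrableR P (fun w => (f (X i w) / Num.sqrt n%:R) ^+ 2).
Proof. by under eq_fun do rewrite mulrC; exact: sqr_integrableZ. Qed.

Lemma sqr_integrable_normalized_sum n : integrableR P (fun w => normalized_sum f n w ^+ 2).
Proof.
apply: (@sqr_integrable_sum _ _ _ P n (fun i w => f (X i w) / Num.sqrt n%:R)) => // i.
by apply: measurable_funM => //; exact: measurableT_comp.
Qed.

Hypothesis f0 : Ex P (fun w => f (X 0%N w)) = 0.

Lemma Ex_sqr_normalized_sum n :
  Ex P (fun w => normalized_sum f n w ^+ 2) = (0 < n)%N%:R * Ex P (fun w => f (X 0%N w) ^+ 2).
Proof.
have m2 : measurable_fun setT (fun x => f x ^+ 2) by exact: measurable_funX.
have i1 i : integrableR P (fun w => f (X i w)).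
  by apply: integrable_of_sqr => //; exact: measurableT_comp.
rewrite (Ex_sqr_sum indX n (f := fun x => f x / Num.sqrt n%:R))//; last 2 first.
- exact: measurable_funM.
- move=> i; under eq_Rintegral do rewrite mulrC; rewrite ExZ//.
  by rewrite (same_law_Ex (lawX i) mf)// f0 mulr0.
rewrite (eq_bigr (fun=> Ex P (fun w => f (X 0%N w) ^+ 2) * ((Num.sqrt n%:R)^-1) ^+ 2)); last first.
  move=> i _; under eq_Rintegral do rewrite exprMn mulrC; rewrite ExZ//.
  by rewrite (same_law_Ex (lawX i) m2)// mulrC.
rewrite sumr_const card_ord -[LHS]mulr_natl.
case: n => [|n]; first by rewrite !mul0r.
by rewrite exprVn sqr_sqrtr// mulrCA mulfV ?pnatr_eq0// mulr1 mul1r.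
Qed.

Lemma Ex_sqr_normalized_sum_le n :
  Ex P (fun w => normalized_sum f n w ^+ 2) <= Ex P (fun w => f (X 0%N w) ^+ 2).
Proof.
rewrite Ex_sqr_normalized_sum; case: n => [|n]; rewrite ?mul1r// mul0r.
by apply: Rintegral_ge0 => w _; exact: sqr_ge0.
Qed.

End OneFunction.

Context (f g : R -> R) (mf : measurable_fun setT f) (mg : measurable_fun setT g).
Hypothesis f2 : integrableR P (fun w => f (X 0%N w) ^+ 2).
Hypothesis g2 : integrableR P (fun w => g (X 0%N w) ^+ 2).
Hypothesis f0 : Ex P (fun w => f (X 0%N w)) = 0.
Hypothesis g0 : Ex P (fun w => g (X 0%N w)) = 0.

(** The Cramer-Wold device: a linear combination of normalized sums is again a
    normalized sum. *)
Lemma cvg_Ex_cos_normalized_sums s t th :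
  Ex P (fun w => cos (s * normalized_sum f n w + t * normalized_sum g n w + th)) @[n --> \oo] -->
  cos th * expR (- (Ex P (fun w => (s * f (X 0%N w) + t * g (X 0%N w)) ^+ 2) / 2)).
Proof.
pose h x := s * f x + t * g x.
have mh : measurable_fun setT h by apply: measurable_funD; exact: measurable_funM.
have mX (k : R -> R) : measurable_fun setT k -> measurable_fun setT (fun w => k (X 0%N w)).
  by move=> mk; exact: measurableT_comp.
have i1 (k : R -> R) : measurable_fun setT k -> integrableR P (fun w => k (X 0%N w) ^+ 2) ->
    integrableR P (fun w => k (X 0%N w)).
  by move=> mk k2; apply: integrable_of_sqr => //; exact: mX.
have h2 : integrableR P (fun w => h (X 0%N w) ^+ 2).
  apply: sqr_integrableD; try exact: sqr_integrableZ.
    by apply: measurable_funM => //; exact: mX.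
  by apply: measurable_funM => //; exact: mX.
have h0 : Ex P (fun w => h (X 0%N w)) = 0.
  rewrite ExD ?ExZ ?f0 ?g0 ?mulr0 ?addr0//; try exact: i1.
    by apply: integrableRZ; exact: i1.
  by apply: integrableRZ; exact: i1.
have E n w : cos (s * normalized_sum f n w + t * normalized_sum g n w + th) =
    cos th * cos (normalized_sum h n w) - sin th * sin (normalized_sum h n w).
  rewrite -cosD addrC /normalized_sum !mulr_sumr -big_split/=; congr (cos (_ + _)).
  by apply: eq_bigr => i _; rewrite !mulrA -mulrDl.
have bc n : integrableR P (fun w => cos (normalized_sum h n w)).
  by apply: bounded_rv_integrable; apply: bounded_rv_cos; exact: measurable_normalized_sum.
have bs n : integrableR P (fun w => sin (normalized_sum h n w)).
  by apply: bounded_rv_integrable; apply: bounded_rv_sin; exact: measurable_normalized_sum.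
have EE n : Ex P (fun w => cos (s * normalized_sum f n w + t * normalized_sum g n w + th)) =
    cos th * Ex P (fun w => cos (normalized_sum h n w)) -
    sin th * Ex P (fun w => sin (normalized_sum h n w)).
  under eq_Rintegral do rewrite E.
  by rewrite ExB ?ExZ//; exact: integrableRZ.
under eq_fun do rewrite EE.
have := cvgnB (cvgnM (@cvgn_cst R (cos th)) (cvg_Ex_cos_sum indX lawX mh h2 h0))
  (cvgnM (@cvgn_cst R (sin th)) (cvg_Ex_sin_sum indX lawX mh h2 h0)).
by rewrite mulr0 subr0.
Qed.

End BivariateCLT.

Section NormalPair.
Context {R : realType} {d} {T : measurableType d} (P : probability T R).
Context (W : 'I_2 -> {RV P >-> R}) (a b c : R).
Hypothesis hW : jointly_normal W 0 (mx22 a b b c).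

Lemma mx22_quadratic (s t : R) (r := \row_(i < 2) (if i == 0 then s else t)) :
  (r *m mx22 a b b c *m r^T) 0 0 = s ^+ 2 * a + 2 * (s * t) * b + t ^+ 2 * c.
Proof.
rewrite !mxE !big_ord_recl big_ord0 !mxE !big_ord_recl !big_ord0 !mxE/=.
by rewrite /mx22; ring.
Qed.

Lemma jointly_normal_combination (s t : R) :
  0 <= s ^+ 2 * a + 2 * (s * t) * b + t ^+ 2 * c /\
  forall A, measurable A ->
    P [set w | A (s * W 0 w + t * W 1 w)] =
    normal_law 0 (s ^+ 2 * a + 2 * (s * t) * b + t ^+ 2 * c) A.
Proof.
have [_ H0 H1] := hW; rewrite -mx22_quadratic; split => // A mA.
have := H1 (\row_(i < 2) (if i == 0 then s else t)) A mA.
have -> : ((0 : 'rV[R]_2) *m (\row_(i < 2) (if i == 0 then s else t))^T) 0 0 = 0 :> R by rewrite mul0mx mxE.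
move=> <-; congr (P _); apply/seteqP; have -> : (1 : 'I_2) = lift ord0 ord0 by exact/val_inj.
by split => w /=; rewrite !big_ord_recl big_ord0 addr0 !mxE.
Qed.

Lemma jointly_normal_cos (s t th : R) :
  Ex P (fun w => cos (s * W 0 w + t * W 1 w + th)) =
  cos th * expR (- ((s ^+ 2 * a + 2 * (s * t) * b + t ^+ 2 * c) / 2)).
Proof.
have [v0 H] := jointly_normal_combination s t.
have mZ : measurable_fun setT (fun w => s * W 0 w + t * W 1 w).
  by apply: measurable_funD; exact: measurable_funM.
pose Z : {RV P >-> R} := HB.pack (fun w => s * W 0 w + t * W 1 w) (isMeasurableFun.Build _ _ _ _ _ mZ).
exact: (normal_law_cos (Z := Z) th v0 H).
Qed.

Lemma jointly_normal_atomless x : 0 < a -> Ex P (fun w => (W 0 w == x)%:R) = 0.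
Proof.
move=> a0; have [_ H] := jointly_normal_combination 1 0.
have v0 : 0 < 1 ^+ 2 * a + 2 * (1 * 0) * b + 0 ^+ 2 * c by rewrite expr1n expr0n/=; lra.
have := normal_law_point x v0 H => Hx.
have mE : measurable_fun setT (fun w => W 0 w == x) by exact: measurable_fun_eqr.
apply/EFin_inj; rewrite Ex_bool//; apply: etrans Hx; congr (P _).
by apply/seteqP; split => w /=; rewrite mul1r mul0r addr0 => /eqP.
Qed.

End NormalPair.

(** * Influence functions and the limit function *)

Section Population.
Context {R : realType} {d} {T : measurableType d} (P : probability T R).
Context (Y : {RV P >-> R}) (F : R -> R) (hF : forall x : R, cdf Y x = (F x)%:E).
Context (alpha q : R).
Hypotheses (alpha0 : 0 < alpha) (alpha1 : alpha < 1).
Hypothesis hq : q = quantile F alpha.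
Hypothesis hFcont : {for q, continuous F}.

(** [F] is at least [alpha] at [q] and less than [alpha] to the left of [q], where
    it tends to [F q]. *)
Lemma quantile_value : F q = alpha.
Proof.
have a01 : 0 < alpha < 1 by rewrite alpha0.
apply/eqP; rewrite eq_le -(quantile_le hF _ a01) -hq lexx andbT leNgt.
apply/negP => Fq.
have H : F x @[x --> q^'-] --> F q by apply: cvg_at_left_filter; exact: hFcont.
have near_gt : \forall x \near q^'-, alpha < F x by exact: (cvgr_gt _ H).
near q^'- => x; have xq : x < q by near: x; exact: nbhs_left_lt.
have : alpha <= F x by apply: ltW; near: x.
by rewrite -(quantile_le hF _ a01) -hq leNgt xq.
Unshelve. all: by end_near. Qed.

Lemma Ex_le_cdf x : Ex P (fun w => (Y w <= x)%R%:R) = F x.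
Proof.
apply/EFin_inj; rewrite Ex_bool -?hF//; exact: measurable_fun_ler.
Qed.

Hypothesis hB : ('E_P[fun w => ((Y w <= 0)%R%:R * Y w ^+ 2)%R] < +oo)%E.

Let mI x : measurable_fun setT (fun y : R => (y <= x)%R%:R : R).
Proof.
have [] // : bounded_rv (fun y : R => (y <= x)%R%:R : R).
by apply: bounded_rv_bool; exact: measurable_fun_ler.
Qed.

Let mS : measurable_fun setT (fun y : R => (y <= q)%R%:R * (q - y)).
Proof. by apply: measurable_funM => //; exact: measurable_funB. Qed.

(** The shortfall only sees the lower tail of [Y]. *)
Lemma sqr_integrable_shortfall : integrableR P (fun w => ((Y w <= q)%R%:R * (q - Y w)) ^+ 2).
Proof.
have mY (h : R -> R) : measurable_fun setT h -> measurable_fun setT (fun w => h (Y w)).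
  by move=> mh; exact: measurableT_comp.
have i2 : integrableR P (fun w => (Y w <= 0)%R%:R * Y w ^+ 2).
  apply/integrableP; split.
    apply/measurable_EFinP; apply: (mY (fun y => (y <= 0)%R%:R * y ^+ 2)).
    by apply: measurable_funM => //; exact: measurable_funX.
  apply: le_lt_trans hB; rewrite unlock; rewrite le_eqVlt; apply/orP; left; apply/eqP; apply: eq_integral => w _ /=.
  by rewrite ger0_norm// mulr_ge0// sqr_ge0.
have i4 := integrableRD (bounded_rv_integrable P (bounded_rv_cst (4 * q ^+ 2))) (integrableRZ 2 i2).
apply: integrableR_dom i4 _ => [|w].
  by apply: (mY (fun y => ((y <= q)%R%:R * (q - y)) ^+ 2)); exact: measurable_funX.
rewrite ger0_norm ?sqr_ge0//.
have q2 := sqr_ge0 q; have Y2 := sqr_ge0 (Y w); have qY := sqr_ge0 (q + Y w).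
case: (leP (Y w) q) => Yq /=; last by rewrite mul0r expr0n/=; case: (Y w <= 0); rewrite /= ?mul1r ?mul0r; lra.
rewrite mul1r; case: (leP (Y w) 0) => Y0 /=; rewrite ?mul1r ?mul0r; first by nra.
by nra.
Qed.

Lemma integrable_shortfall : integrableR P (fun w => (Y w <= q)%R%:R * (q - Y w)).
Proof.
apply: integrable_of_sqr sqr_integrable_shortfall.
exact: (measurableT_comp mS).
Qed.

Context (es : R).
Hypothesis hes : es = lower_expected_shortfall F alpha.

Lemma Ex_shortfall : Ex P (fun w => (Y w <= q)%R%:R * (q - Y w) / alpha) = q - es.
Proof.
rewrite hes (lower_expected_shortfallE hF _ hq quantile_value) ?alpha0//; last exact: integrable_shortfall.
rewrite opprB addrC subrK; under eq_Rintegral do rewrite mulrC.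
by rewrite ExZ//; exact: integrable_shortfall.
Qed.

(** The summands of the linear expansions of the two estimators. The first one
    is not divided by a density at [q], which need not exist. *)
Definition quantile_influence (x : R) : R := alpha - (x <= q)%R%:R.
Definition shortfall_influence (x : R) : R := q - es - (x <= q)%R%:R * (q - x) / alpha.

Lemma measurable_quantile_influence : measurable_fun setT quantile_influence.
Proof. exact: measurable_funB. Qed.

Lemma measurable_shortfall_influence : measurable_fun setT shortfall_influence.
Proof. by apply: measurable_funB => //; exact: measurable_funM. Qed.

Let I w : R := (Y w <= q)%R%:R.
Let S w : R := (Y w <= q)%R%:R * (q - Y w) / alpha.

Let iI : integrableR P I.
Proof. by apply/bounded_rv_integrable/bounded_rv_bool; exact: measurable_fun_ler. Qed.

Let iS : integrableR P S.
Proof.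
apply: eq_integrable (integrableRZ alpha^-1 integrable_shortfall) => // w _.
by rewrite /= mulrC.
Qed.

Let iS2 : integrableR P (fun w => S w ^+ 2).
Proof.
apply: eq_integrable (integrableRZ (alpha^-1 ^+ 2) sqr_integrable_shortfall) => // w _.
by rewrite /= /S [in RHS]exprMn mulrC.
Qed.

Let icst c : integrableR P (fun=> c).
Proof. exact/bounded_rv_integrable/bounded_rv_cst. Qed.

Lemma Ex_quantile_influence : Ex P (fun w => quantile_influence (Y w)) = 0.
Proof. by rewrite ExB// Ex_cst Ex_le_cdf quantile_value subrr. Qed.

Lemma Ex_shortfall_influence : Ex P (fun w => shortfall_influence (Y w)) = 0.
Proof. by rewrite ExB// Ex_cst Ex_shortfall subrr. Qed.

Lemma sqr_integrable_quantile_influence :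
  integrableR P (fun w => quantile_influence (Y w) ^+ 2).
Proof.
have b : bounded_rv (fun w => quantile_influence (Y w)).
  apply: bounded_rvB; first exact: bounded_rv_cst.
  by apply: bounded_rv_bool; exact: measurable_fun_ler.
exact: bounded_rv_integrable (bounded_rvM b b).
Qed.

Lemma sqr_integrable_shortfall_influence :
  integrableR P (fun w => shortfall_influence (Y w) ^+ 2).
Proof.
have E w : shortfall_influence (Y w) ^+ 2 = (q - es) ^+ 2 - 2 * (q - es) * S w + S w ^+ 2.
  by rewrite /shortfall_influence -/(S w); ring.
apply: eq_integrable (integrableRD (integrableRB (icst _) (integrableRZ _ iS)) iS2) => // w _.
by rewrite /= E.
Qed.

(** The square is a combination of [1], [I], [S] and [S ^+ 2], because
    [I ^+ 2 = I] and [I * S = S]. *)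
Lemma Ex_influence_sqr (s t : R) :
  Ex P (fun w => (s * quantile_influence (Y w) + t * shortfall_influence (Y w)) ^+ 2) =
  s ^+ 2 * (alpha * (1 - alpha)) + 2 * (s * t) * ((1 - alpha) * (q - es)) +
  t ^+ 2 * fine 'V_P[fun w => ((Y w <= q)%R%:R * (q - Y w) / alpha)%R].
Proof.
have ES : Ex P S = q - es by exact: Ex_shortfall.
have EI : Ex P I = alpha by rewrite Ex_le_cdf quantile_value.
have -> : fine 'V_P[fun w => ((Y w <= q)%R%:R * (q - Y w) / alpha)%R] =
    Ex P (fun w => S w ^+ 2) - (q - es) ^+ 2.
  have -> : 'V_P[fun w => ((Y w <= q)%R%:R * (q - Y w) / alpha)%R] =
      'E_P[fun w => ((S w - (q - es)) * (S w - (q - es)))%R]%E.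
    by rewrite /variance covariance.unlock unlock; congr (integral _ _ _); apply/funext => w;
      rewrite /= -ES.
  rewrite unlock -[LHS]/(Ex P (fun w => (S w - (q - es)) * (S w - (q - es)))).
  have E w : (S w - (q - es)) * (S w - (q - es)) = S w ^+ 2 - 2 * (q - es) * S w + (q - es) ^+ 2.
    by ring.
  under eq_Rintegral do rewrite E.
  rewrite ExD// ?ExB// ?ExZ// ?Ex_cst ?ES; try exact: integrableRZ.
    by ring.
  by apply: integrableRB => //; exact: integrableRZ.
pose k := s * alpha + t * (q - es).
have E w : (s * quantile_influence (Y w) + t * shortfall_influence (Y w)) ^+ 2 =
    k ^+ 2 + (s ^+ 2 - 2 * k * s) * I w + (2 * (s * t) - 2 * k * t) * S w + t ^+ 2 * S w ^+ 2.
  rewrite /quantile_influence /shortfall_influence /I /S /k.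
  by case: (Y w <= q); rewrite /= ?mul1r ?mul0r; ring.
under eq_Rintegral do rewrite E.
rewrite ExD ?ExD ?ExD ?ExZ//; try exact: integrableRZ.
- rewrite Ex_cst EI ES /k; ring.
- by apply: integrableRD => //; exact: integrableRZ.
- by apply: integrableRD; [apply: integrableRD => //|]; exact: integrableRZ.
Qed.

End Population.

Section LimitFunction.
Context {R : realType} {d} {T : measurableType d} (P : probability T R).
Context (Y : {RV P >-> R}) (F : R -> R) (hF : forall x : R, cdf Y x = (F x)%:E).
Context (q : R) (a : nat -> R) (psi : R -> \bar R).
Hypothesis ha0 : forall n : nat, (0 < n)%N -> 0 < a n.
Hypothesis hpsi : forall t : R,
  (Num.sqrt n%:R * (F (q + t / a n) - F q))%:E @[n --> \oo] --> psi t.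

Lemma psi_nondecreasing s t : s <= t -> (psi s <= psi t)%E.
Proof.
move=> st; apply: (lee_cvg_to (@hpsi s) (@hpsi t)).
near=> n; rewrite lee_fin ler_wpM2l// lerD2r; apply: (cdf_nd hF).
rewrite lerD2l ler_wpM2r// invr_ge0 ltW// ha0//.
by near: n; exact: nbhs_infty_gt.
Unshelve. all: by end_near. Qed.

Lemma psi_at0 : psi 0 = 0%E.
Proof.
have := @hpsi 0.
under eq_fun do rewrite mul0r addr0 subrr mulr0.
have H0 : (0 : R)%:E @[n --> \oo] --> (0 : R)%:E by exact: cvg_cst.
by move=> H; exact: (cvg_unique (@ereal_hausdorff R) H H0).
Qed.

End LimitFunction.

(** * Linearization of the estimator *)

Section Estimator.
Context {R : realType} (alpha : R) (alpha0 : 0 < alpha) (alpha1 : alpha < 1).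
Context {d} {T : measurableType d} (P : probability T R) (X : nat -> {RV P >-> R}).
Hypothesis hXindep : mutually_independent X.
Context (F : R -> R) (hXF : forall (i : nat) (x : R), cdf (X i) x = (F x)%:E).
Context (q : R) (Fq : F q = alpha) (hFcont : {for q, continuous F}).
Context (es : R).
Context (G cG : R -> R) (hcG : continuously_differentiable 3 cG).
Hypothesis hG : forall x : R, derive1 cG x = G x.
Hypothesis hG' : forall x : R, 0 < derive1 G x.
Hypothesis hGlim : G x @[x --> -oo%R] --> (0 : R).
Context (qhat eshat : nat -> {RV P >-> R}).
Hypothesis hhat : forall n : nat, (0 < n)%N -> forall w : T,
     argmin (fun z : R * R => \sum_(i < n) score alpha G cG z.1 z.2 (X i w))
       (qhat n w, eshat n w).
Context (a : nat -> R).
Hypothesis ha0 : forall n : nat, (0 < n)%N -> 0 < a n.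
Hypothesis ha : a n @[n --> \oo] --> +oo%R.

Let lawX i : same_law (X i) (X 0%N).
Proof. by apply: same_law_cdf => x; rewrite !hXF. Qed.

Let sqrtn_gt0 n : (0 < n)%N -> 0 < Num.sqrt n%:R :> R.
Proof. by move=> n0; rewrite sqrtr_gt0 ltr0n. Qed.

Let sqrtn2 n : (n%:R : R) = Num.sqrt n%:R * Num.sqrt n%:R.
Proof. by rewrite -expr2 sqr_sqrtr. Qed.

Definition increment_error (t x : R) : R := (x <= t)%R%:R - (x <= q)%R%:R - (F t - F q).

(** The sign of the right-hand side decides on which side of [t] the estimator
    [qhat n] lies. The left-hand side splits it into a fluctuation between [q] and
    [t], a drift, and the fluctuation at [q]. *)
Lemma count_deviation n w t : (0 < n)%N ->
  normalized_sum X (increment_error t) n w + Num.sqrt n%:R * (F t - F q) -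
    normalized_sum X (quantile_influence alpha q) n w =
  (count_le n (fun i => X i w) t - alpha * n%:R) / Num.sqrt n%:R.
Proof.
move=> n0; have s0 := sqrtn_gt0 n0.
rewrite /normalized_sum -!mulr_suml /increment_error /quantile_influence.
rewrite !sumrB !sumr_const card_ord -(mulr_natr alpha) -(mulr_natr (F t)) -(mulr_natr (F q)) /count_le.
have := sqrtn2 n; move: s0; set s := Num.sqrt _ => s0 ->; rewrite -Fq.
by field; exact: lt0r_neq0.
Qed.

Lemma measurable_increment_error t : measurable_fun setT (increment_error t).
Proof.
have [] // : bounded_rv (increment_error t).
apply: bounded_rvB; last exact: bounded_rv_cst.
by apply: bounded_rvB; apply: bounded_rv_bool; exact: measurable_fun_ler.
Qed.

Let bI t : bounded_rv (fun w => (X 0%N w <= t)%R%:R : R).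
Proof. by apply: bounded_rv_bool; exact: measurable_fun_ler. Qed.

Let berr t : bounded_rv (fun w => increment_error t (X 0%N w)).
Proof. by apply: bounded_rvB; [exact: bounded_rvB|exact: bounded_rv_cst]. Qed.

Let ExI t : Ex P (fun w => (X 0%N w <= t)%R%:R) = F t.
Proof. exact: Ex_le_cdf. Qed.

Let bi {e} {S : measurableType e} (O : probability S R) (f : S -> R) := @bounded_rv_integrable _ _ _ O f.

Let ExJ t : Ex P (fun w => (X 0%N w <= t)%R%:R - (X 0%N w <= q)%R%:R) = F t - F q.
Proof. by rewrite ExB ?ExI//; exact: bi. Qed.

Lemma Ex_increment_error t : Ex P (fun w => increment_error t (X 0%N w)) = 0.
Proof.
have bJ : bounded_rv (fun w => (X 0%N w <= t)%R%:R - (X 0%N w <= q)%R%:R : R) by exact: bounded_rvB.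
rewrite (ExB (bi P bJ) (bi P (bounded_rv_cst _))) ExJ Ex_cst; exact: subrr.
Qed.

Let ierr2 t : integrableR P (fun w => increment_error t (X 0%N w) ^+ 2).
Proof. by apply: bi; under eq_fun do rewrite expr2; exact: bounded_rvM. Qed.

Lemma Ex_sqr_increment_error t :
  Ex P (fun w => increment_error t (X 0%N w) ^+ 2) <= `|F t - F q|.
Proof.
pose J w : R := (X 0%N w <= t)%R%:R - (X 0%N w <= q)%R%:R.
have bJ : bounded_rv J by exact: bounded_rvB.
have bJ2 : bounded_rv (fun w => J w ^+ 2) by under eq_fun do rewrite expr2; exact: bounded_rvM.
have EJ : Ex P J = F t - F q by exact: ExJ.
have iJ := bi P bJ; have iJ2 := bi P bJ2.
have E w : increment_error t (X 0%N w) ^+ 2 = J w ^+ 2 - 2 * (F t - F q) * J w + (F t - F q) ^+ 2.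
  by rewrite /increment_error -/(J w); ring.
under eq_Rintegral do rewrite E.
rewrite (ExD (integrableRB iJ2 (integrableRZ _ iJ)) (bi P (bounded_rv_cst _))).
rewrite (ExB iJ2 (integrableRZ _ iJ)) (ExZ _ iJ) Ex_cst EJ.
apply: (@le_trans _ _ (Ex P (fun w => J w ^+ 2))).
  by have := sqr_ge0 (F t - F q); rewrite expr2; lra.
(* [J] takes the values [0] and [1], or [0] and [-1], depending on the side of
   [q] on which [t] lies *)
have J2 w : J w ^+ 2 = if t <= q then - J w else J w.
  rewrite /J; have [tq|qt] := leP t q; have [Xt|Xt] := leP (X 0%N w) t;
    have [Xq|Xq] := leP (X 0%N w) q; rewrite /=; lra.
under eq_Rintegral do rewrite J2.
case: (leP t q) => [tq|qt]; last by rewrite EJ ler_norm.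
under eq_Rintegral do rewrite -mulN1r; rewrite ExZ// EJ mulN1r.
by rewrite -normrN ler_norm.
Qed.

Let cvg_aV : (a n)^-1 @[n --> \oo] --> (0 : R).
Proof.
apply/gtr0_cvgV0; last exact: ha.
by near=> n; apply: ha0; near: n; exact: nbhs_infty_gt.
Unshelve. all: by end_near. Qed.

Let cvg_Fn t : F (q + t / a n) @[n --> \oo] --> F q.
Proof.
have c : q + t / a n @[n --> \oo] --> q.
  by have := cvgnD (@cvgn_cst R q) (cvgnM (@cvgn_cst R t) cvg_aV); rewrite mulr0 addr0.
exact: (cvg_comp _ _ c hFcont).
Qed.

Context (psi : R -> \bar R).
Hypothesis hpsi : forall t : R,
     (Num.sqrt n%:R * (F (q + t / a n) - F q))%:E @[n --> \oo] --> psi t.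

Let A n w := a n * (qhat n w - q).
Let B n w := Num.sqrt n%:R * (eshat n w - es).
Let U n w := normalized_sum X (quantile_influence alpha q) n w.
Let V n w := normalized_sum X (shortfall_influence alpha q es) n w.

(** The fluctuation between [q] and [q + t / a n] has variance at most
    [`|F (q + t / a n) - F q|], which tends to [0] by continuity. *)
Lemma quantile_sign_criterion t : sign_criterion P A U psi t.
Proof.
exists (fun n w => normalized_sum X (increment_error (q + t / a n)) n w),
  (fun n => Num.sqrt n%:R * (F (q + t / a n) - F q)); split.
- by move=> n; apply: measurable_normalized_sum; exact: measurable_increment_error.
- move=> n; apply: sqr_integrable_normalized_sum => //; exact: measurable_increment_error.
- have c0 : `|F (q + t / a n) - F q| @[n --> \oo] --> (0 : R).
    have := cvgnB (cvg_Fn t) (@cvgn_cst R (F q)); rewrite subrr => /cvg_norm; rewrite normr0; exact.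
  apply: (squeeze_cvgr _ (cvg_cst 0) c0); near=> n; apply/andP; split.
    by apply: Rintegral_ge0 => w _; exact: sqr_ge0.
  apply: le_trans (Ex_sqr_increment_error _); apply: Ex_sqr_normalized_sum_le => //.
    exact: measurable_increment_error.
  exact: Ex_increment_error.
- exact: hpsi.
- near=> n => w; have n0 : (0 < n)%N by near: n; exact: nbhs_infty_gt.
  rewrite /U count_deviation// ltr_pdivlMr ?sqrtn_gt0// mul0r ltr_pdivrMr ?sqrtn_gt0// mul0r.
  rewrite subr_gt0 subr_lt0 /A -ler_pdivlMl ?ha0// -[X in _ /\ (_ -> is_true X)]ltr_pdivrMl ?ha0//.
  rewrite lerBlDl ltrBrDl ![_^-1 * t]mulrC.
  split => h.
    exact: (argmin_quantile_le hcG hG hG' hGlim alpha0 (X := fun i => X i w) (hhat n0 w)).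
  exact: (argmin_quantile_gt hcG hG hG' hGlim alpha0 (X := fun i => X i w) (hhat n0 w)).
Unshelve. all: by end_near. Qed.

(** [V n] is the error of the shortfall functional at the true quantile [q]; its
    value at [qhat n] differs by a term of second order. *)
Lemma shortfall_deviation n w : (0 < n)%N ->
  `|B n w - V n w| <= (alpha * a n)^-1 * (`|A n w| * `|U n w|).
Proof.
move=> n0; have s0 := sqrtn_gt0 n0.
pose phi := shortfall_functional alpha n (fun i => X i w).
have BE : B n w - V n w = Num.sqrt n%:R * (phi (qhat n w) - phi q).
  rewrite /B (argmin_shortfall hcG hG hG' alpha0 n0 (X := fun i => X i w) (hhat n0 w)) -/phi.
  suff -> : V n w = Num.sqrt n%:R * (phi q - es) by ring.
  rewrite /V /normalized_sum -mulr_suml sumrB sumr_const card_ord -mulr_suml -(mulr_natr (q - es)).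
  rewrite /phi /shortfall_functional /shortfall_sum.
  have := sqrtn2 n; move: s0; set s := Num.sqrt _ => s0 ->.
  by field; rewrite !lt0r_neq0.
have UE : U n w = (alpha * n%:R - count_le n (fun i => X i w) q) / Num.sqrt n%:R.
  by rewrite /U /normalized_sum -mulr_suml sumrB sumr_const card_ord -(mulr_natr alpha).
have an0 := ha0 n0.
rewrite BE ger0_norm; last first.
  rewrite mulr_ge0//; exact: (shortfall_functional_max hcG hG hG' hGlim alpha0 n0 (X := fun i => X i w) (hhat n0 w)).
have := shortfall_functional_flat alpha0 n0 (fun i => X i w) (qhat n w) q => h.
apply: le_trans (ler_wpM2l (ltW s0) h) _.
rewrite UE /A normrM (gtr0_norm an0) normrM normfV (gtr0_norm s0).
rewrite le_eqVlt; apply/orP; left; apply/eqP.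
have := sqrtn2 n; move: s0; set s := Num.sqrt _ => s0 ->.
by field; rewrite !lt0r_neq0.
Qed.

End Estimator.

(** * The limit law of the estimator *)

Theorem theorem4 (R : realType) (alpha : R)
  (halpha0 : 0 < alpha) (halpha1 : alpha < 1)
  (* Y, with distribution function F *)
  (dY : measure_display) (TY : measurableType dY) (PY : probability TY R)
  (Y : {RV PY >-> R}) (F : R -> R)
  (hF : forall x : R, cdf Y x = (F x)%:E)
  (hY1 : ('E_PY[fun w => `|Y w|%R] < +oo)%E)
  (* the alpha-quantile and the expected shortfall *)
  (q : R) (hq : q = quantile F alpha)
  (hFcont : {for q, continuous F}) (hFincr : strictly_increasing_at F q)
  (es : R) (hes : es = lower_expected_shortfall F alpha)
  (* X_1, X_2, ... i.i.d. with distribution function F (indexed from 0) *)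
  (d : measure_display) (T : measurableType d) (P : probability T R)
  (X : nat -> {RV P >-> R})
  (hXindep : mutually_independent X)
  (hXF : forall (i : nat) (x : R), cdf (X i) x = (F x)%:E)
  (* scoring function *)
  (G cG : R -> R) (hcG : continuously_differentiable 3 cG)
  (hG : forall x : R, derive1 cG x = G x)
  (hG' : forall x : R, 0 < derive1 G x)
  (hGlim : G x @[x --> -oo%R] --> (0 : R))
  (* the minimum contrast estimator *)
  (qhat eshat : nat -> {RV P >-> R})
  (hhat : forall n : nat, (0 < n)%N -> forall w : T,
     argmin (fun z : R * R => \sum_(i < n) score alpha G cG z.1 z.2 (X i w))
       (qhat n w, eshat n w))
  (* Assumption [A] *)
  (a : nat -> R) (psi : R -> \bar R)
  (ha0 : forall n : nat, (0 < n)%N -> 0 < a n)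
  (ha : a n @[n --> \oo] --> +oo%R)
  (hpsi_pinfty : psi t @[t --> +oo%R] --> (+oo)%E)
  (hpsi_ninfty : psi t @[t --> -oo%R] --> (-oo)%E)
  (hpsi : forall t : R,
     (Num.sqrt n%:R * (F (q + t / a n) - F q))%:E @[n --> \oo] --> psi t)
  (* Assumption [B] *)
  (hB : ('E_PY[fun w => ((Y w <= 0)%R%:R * Y w ^+ 2)%R] < +oo)%E)
  (* the normal limit (W_1, W_2), with coordinates indexed by 0 and 1 *)
  (dW : measure_display) (TW : measurableType dW) (PW : probability TW R)
  (W : 'I_2 -> {RV PW >-> R})
  (hW : jointly_normal W 0
     (mx22 (alpha * (1 - alpha))
           ((1 - alpha) * (q - es))
           ((1 - alpha) * (q - es))
           (fine 'V_PY[fun w => ((Y w <= q)%R%:R * (q - Y w) / alpha)%R]))) :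
  cvg_in_distribution P
    (fun (n : nat) (w : T) =>
       (a n * (qhat n w - q), Num.sqrt n%:R * (eshat n w - es)))
    PW
    (fun w : TW => (psi_inv psi (W 0 w), W 1 w)).
Proof.
have Fq : F q = alpha by exact: (quantile_value hF halpha0 halpha1 hq hFcont).
have lawX i : same_law (X i) (X 0%N) by apply: same_law_cdf => x; rewrite !hXF.
have lawXY : same_law (X 0%N) Y by apply: same_law_cdf => x; rewrite hXF hF.
pose fu := quantile_influence alpha q.
pose fv := shortfall_influence alpha q es.
pose va := fine 'V_PY[fun w => ((Y w <= q)%R%:R * (q - Y w) / alpha)%R].
pose v s t := s ^+ 2 * (alpha * (1 - alpha)) + 2 * (s * t) * ((1 - alpha) * (q - es)) + t ^+ 2 * va.
have mfu : measurable_fun setT fu by exact: measurable_quantile_influence.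
have mfv : measurable_fun setT fv by exact: measurable_shortfall_influence.
have lawYX : same_law Y (X 0%N) by move=> D mD; rewrite lawXY.
have m2 (h : R -> R) : measurable_fun setT h -> measurable_fun setT (fun x => h x ^+ 2).
  by move=> mh; exact: measurable_funX.
have fu2 : integrableR P (fun w => fu (X 0%N w) ^+ 2).
  apply: (same_law_integrable lawYX (m2 _ mfu)); exact: sqr_integrable_quantile_influence.
have fv2 : integrableR P (fun w => fv (X 0%N w) ^+ 2).
  apply: (same_law_integrable lawYX (m2 _ mfv)).
  exact: sqr_integrable_shortfall_influence.
have mX (h : R -> R) : measurable_fun setT h -> measurable_fun setT (fun w => h (X 0%N w)).
  by move=> mh; exact: measurableT_comp.
have fu0 : Ex P (fun w => fu (X 0%N w)) = 0.
  rewrite (same_law_Ex lawXY mfu); first exact: (Ex_quantile_influence hF halpha0 halpha1 hq hFcont).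
  by apply: integrable_of_sqr => //; exact: mX.
have fv0 : Ex P (fun w => fv (X 0%N w)) = 0.
  rewrite (same_law_Ex lawXY mfv); first exact: (Ex_shortfall_influence hF halpha0 halpha1 hq hFcont hB hes).
  by apply: integrable_of_sqr => //; exact: mX.
have vE s t : Ex P (fun w => (s * fu (X 0%N w) + t * fv (X 0%N w)) ^+ 2) = v s t.
  have mh : measurable_fun setT (fun x => s * fu x + t * fv x).
    by apply: measurable_funD; exact: measurable_funM.
  rewrite (same_law_Ex lawXY (m2 _ mh)).
    exact: (Ex_influence_sqr hF halpha0 halpha1 hq hFcont hB hes).
  apply: sqr_integrableD; try exact: sqr_integrableZ.
    by apply: measurable_funM => //; exact: mX.
  by apply: measurable_funM => //; exact: mX.
pose U := normalized_sum X fu; pose V := normalized_sum X fv.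
pose A n w := a n * (qhat n w - q); pose B n w := Num.sqrt n%:R * (eshat n w - es).
pose C := Num.max (Ex P (fun w => fu (X 0%N w) ^+ 2)) (Ex P (fun w => fv (X 0%N w) ^+ 2)).
have mU n : measurable_fun setT (U n) by exact: measurable_normalized_sum.
have mV n : measurable_fun setT (V n) by exact: measurable_normalized_sum.
have mA n : measurable_fun setT (A n).
  by apply: measurable_funM => //; exact: measurable_funB.
have mB n : measurable_fun setT (B n).
  by apply: measurable_funM => //; exact: measurable_funB.
have iU n : integrableR P (fun w => U n w ^+ 2) by exact: sqr_integrable_normalized_sum.
have iV n : integrableR P (fun w => V n w ^+ 2) by exact: sqr_integrable_normalized_sum.
have UC n : Ex P (fun w => U n w ^+ 2) <= C.
  by apply: le_trans (Ex_sqr_normalized_sum_le hXindep lawX mfu fu2 fu0 n) _; rewrite le_max lexx.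
have VC n : Ex P (fun w => V n w ^+ 2) <= C.
  by apply: le_trans (Ex_sqr_normalized_sum_le hXindep lawX mfv fv2 fv0 n) _; rewrite le_max lexx orbT.
(* both sides have the limit [cos th * expR (- v s t / 2)] *)
have cvg_cos s t th : Ex P (fun w => cos (s * U n w + t * V n w + th)) @[n --> \oo] -->
    Ex PW (fun w => cos (s * W 0 w + t * W 1 w + th)).
  rewrite (jointly_normal_cos hW) -/va -/(v s t) -vE.
  exact: (cvg_Ex_cos_normalized_sums hXindep lawX).
have cvg_UV (f g : R -> R) (M : R) (cf : continuous f) (cg : continuous g)
    (fM : forall x, `|f x| <= M) (gM : forall x, `|g x| <= M) :
    Ex P (fun w => f (U n w) * g (V n w)) @[n --> \oo] --> Ex PW (fun w => f (W 0 w) * g (W 1 w)).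
  exact: (cvg_Ex_product mU mV _ _ cvg_cos iU iV UC VC cf cg fM gM).
have atomless c : Ex PW (fun w => (W 0 w == c)%:R) = 0.
  by apply: (jointly_normal_atomless hW); rewrite mulr_gt0// subr_gt0.
have crit t : sign_criterion P A U psi t.
  exact: (quantile_sign_criterion halpha0 hXindep hXF Fq hFcont hcG hG hG' hGlim hhat ha0 ha).
have cvg_ind (t : R) (g : R -> R) (M : R) : continuous g -> (forall x, `|g x| <= M) ->
    Ex P (fun w => (A n w <= t)%R%:R * g (V n w)) @[n --> \oo] -->
    Ex PW (fun w => ((W 0 w)%:E <= psi t)%E%:R * g (W 1 w)).
  move=> cg gM; exact: (cvg_indicator mA mU mV _ _ cvg_UV iU UC atomless crit cg gM).
have psi_nd s t : s <= t -> (psi s <= psi t)%E by exact: (psi_nondecreasing hF ha0 hpsi).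
have psi0 := psi_at0 hpsi.
move=> f cf [M fM].
have bP n : bounded_rv (fun w => f (A n w, B n w)).
  by split; [exact: measurable_fun_continuous_pair|exists M => w; exact: fM].
have bW : bounded_rv (fun w => f (psi_inv psi (W 0 w), W 1 w)).
  split; last by exists M => w; exact: fM.
  apply: measurable_fun_continuous_pair => //; apply: measurableT_comp => //.
  exact: measurable_psi_inv.
have EE e (S : measurableType e) (O : probability S R) (h : S -> R) : bounded_rv h ->
    'E_O[h]%E = (Ex O h)%:E.
  by move=> bh; rewrite unlock /Rintegral fineK//; exact/integrable_fin_num/bounded_rv_integrable.
rewrite (EE _ _ PW _ bW); under eq_fun do rewrite (EE _ _ P _ (bP _)).
apply: cvg_EFin; first by near=> n.
have cvg_k : (alpha * a n)^-1 @[n --> \oo] --> (0 : R).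
  have aV : (a n)^-1 @[n --> \oo] --> (0 : R).
    apply/gtr0_cvgV0; last exact: ha.
    by near=> n; apply: ha0; near: n; exact: nbhs_infty_gt.
  have := cvgnM (@cvgn_cst R alpha^-1) aV; rewrite mulr0.
  by under eq_fun do rewrite -invfM.
have BV : \forall n \near \oo, forall w, `|B n w - V n w| <= (alpha * a n)^-1 * (`|A n w| * `|U n w|).
  near=> n => w; apply: (shortfall_deviation halpha0 q es hcG hG hG' hGlim hhat ha0).
  by near: n; exact: nbhs_infty_gt.
exact: (cvg_joint mA mB mU mV _ _ iU iV UC VC atomless psi_nd psi0 hpsi_pinfty hpsi_ninfty cvg_ind cvg_k BV cf fM).
Unshelve. all: by end_near.
Qed.
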